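(* The class of Gul'ko compact spaces is absolute. That is, for all transitive models $M\subseteq N$ of ZFC and every $X\in M$ such that $M\models$ ''$X$ is a Gul'ko compact space'', we have $N\models$ ''$X^N$ is a Gul'ko compact space'', where $X^N$ is the interpretation of $X$ in $N$.
   Context: All compact spaces are Hausdorff. A family $\mathcal{U}$ of subsets of $X$ is $T_0$ separating if for all $x\neq y$ in $X$ there is $U\in\mathcal{U}$ with $|\{x,y\}\cap U|=1$. For a family $\mathcal{V}$ of subsets of $X$ and $x\in X$, $\mathrm{ord}(x,\mathcal{V})=|\{V\in\mathcal{V}: x\in V\}|$. A family $\mathcal{U}$ of subsets of $X$ is weakly $\sigma$-point-finite if it can be written as $\mathcal{U}=\bigcup_{n\in\omega}\mathcal{U}_n$ so that for each $x\in X$, $\mathcal{U}=\bigcup\{\mathcal{U}_n: \mathrm{ord}(x,\mathcal{U}_n)<\aleph_0\}$. A compact space $X$ is Gul'ko compact if there exists a $T_0$ separating family of open $F_\sigma$ subsets of $X$ which is weakly $\sigma$-point-finite (this covering characterization, due to Sokolov, is used as the definition). Lattices are bounded (they have a least element $0$ and a greatest element $1$). A filter in a lattice $L$ is a set $F\subseteq L$ with $0\notin F$, $1\in F$, and such that $a,b\in F$ and $x\geq a\cdot b$ imply $x\in F$ (here $\cdot$ is the meet). An ultrafilter is a maximal filter. $\mathrm{Ult}(L)$ is the set of all ultrafilters of $L$, with the topology having as open base the sets $a^-=\{p\in\mathrm{Ult}(L): a\notin p\}$, $a\in L$. If $M\subseteq N$ are transitive models of ZFC and $X\in M$ is a compact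 space in $M$, let $L=\mathrm{Closed}^M(X)$ be the lattice of closed subsets of $X$ as computed in $M$. The interpretation of $X$ in $N$ is the space $X^N=\mathrm{Ult}^N(L)$, i.e. the space $\mathrm{Ult}(L)$ of all ultrafilters of $L$ as computed in $N$. A class $\mathcal{K}=\{X:\phi(X)\}$ of compact spaces, given by a formula $\phi$ such that ZFC proves that $\phi(x)$ implies ''$x$ is a compact space'', is absolute if for all models $M\subseteq N$ of ZFC, $M\models\phi(X)$ implies $N\models\phi(X^N)$. *)

(* Defs.v *)
(* A structure for the language of set theory.  All notions below are first
   order: their quantifiers range over the elements of the structure, so
   "M |= phi(X)" is phi evaluated in the structure carried by M. *)
Record set_structure := SetStructure {
  carrier :> Type;
  mem : carrier -> carrier -> Prop
}.
Arguments mem {s} _ _.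

Declare Scope set_scope.
Notation "x ∈ y" := (mem x y) (at level 70, no associativity) : set_scope.
Notation "x ∉ y" := (~ mem x y) (at level 70, no associativity) : set_scope.
Open Scope set_scope.

(* Formulas with de Bruijn indices, for the two axiom schemas. *)
Inductive formula :=
| fMem (i j : nat)
| fEq (i j : nat)
| fNot (f : formula)
| fAnd (f g : formula)
| fAll (f : formula).

Definition scons {T : Type} (x : T) (e : nat -> T) (n : nat) : T :=
  match n with O => x | S m => e m end.

Fixpoint sat (A : set_structure) (e : nat -> A) (f : formula) : Prop :=
  match f with
  | fMem i j => e i ∈ e j
  | fEq i j => e i = e j
  | fNot g => ~ sat A e g
  | fAnd g h => sat A e g /\ sat A e h
  | fAll g => forall x : A, sat A (scons x e) g
  end.

Definition is_empty {A : set_structure} (x : A) : Prop := forall z, z ∉ x.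

Definition subset {A : set_structure} (x y : A) : Prop :=
  forall z, z ∈ x -> z ∈ y.

Definition is_upair {A : set_structure} (u x y : A) : Prop :=
  forall z, z ∈ u <-> z = x \/ z = y.

Definition is_union {A : set_structure} (u F : A) : Prop :=
  forall z, z ∈ u <-> exists y, y ∈ F /\ z ∈ y.

Definition is_inter {A : set_structure} (w x y : A) : Prop :=
  forall z, z ∈ w <-> z ∈ x /\ z ∈ y.

Definition is_diff {A : set_structure} (w x y : A) : Prop :=
  forall z, z ∈ w <-> z ∈ x /\ z ∉ y.

Definition is_power {A : set_structure} (p x : A) : Prop :=
  forall z, z ∈ p <-> subset z x.

Definition is_succ {A : set_structure} (s x : A) : Prop :=
  forall z, z ∈ s <-> z ∈ x \/ z = x.

Definition is_inductive {A : set_structure} (w : A) : Prop :=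
  (exists e, is_empty e /\ e ∈ w) /\
  (forall x, x ∈ w -> exists s, is_succ s x /\ s ∈ w).

Record ZFC (A : set_structure) : Prop := {
  zfc_extensionality :
    forall x y : A, (forall z, z ∈ x <-> z ∈ y) -> x = y;
  zfc_foundation :
    forall x : A, (exists y, y ∈ x) ->
      exists y, y ∈ x /\ forall z, z ∈ x -> z ∉ y;
  zfc_pairing : forall x y : A, exists u, is_upair u x y;
  zfc_union : forall F : A, exists u, is_union u F;
  zfc_power : forall x : A, exists p, is_power p x;
  zfc_infinity : exists w : A, is_inductive w;
  zfc_separation :
    forall (f : formula) (e : nat -> A) (a : A),
      exists b, forall x, x ∈ b <-> x ∈ a /\ sat A (scons x e) f;
  zfc_replacement :
    forall (f : formula) (e : nat -> A) (a : A),
      (forall x, x ∈ a -> exists! y, sat A (scons x (scons y e)) f) ->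
      exists b, forall y,
        y ∈ b <-> exists x, x ∈ a /\ sat A (scons x (scons y e)) f;
  zfc_choice :
    forall a : A,
      (forall x, x ∈ a -> exists z, z ∈ x) ->
      (forall x y z, x ∈ a -> y ∈ a -> z ∈ x -> z ∈ y -> x = y) ->
      exists c, forall x, x ∈ a -> exists! z, z ∈ c /\ z ∈ x
}.

Definition is_opair {A : set_structure} (p x y : A) : Prop :=
  exists s d, is_upair s x x /\ is_upair d x y /\ is_upair p s d.

Definition rel {A : set_structure} (R x y : A) : Prop :=
  exists p, is_opair p x y /\ p ∈ R.

Definition is_function_on {A : set_structure} (f D : A) : Prop :=
  (forall p, p ∈ f -> exists x y, x ∈ D /\ is_opair p x y) /\
  (forall x, x ∈ D -> exists! y, rel f x y).

Definition is_bijection {A : set_structure} (f D E : A) : Prop :=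
  is_function_on f D /\
  (forall x y, rel f x y -> y ∈ E) /\
  (forall y, y ∈ E -> exists! x, rel f x y).

Definition is_omega {A : set_structure} (w : A) : Prop :=
  is_inductive w /\ forall v, is_inductive v -> subset w v.

Definition is_finite {A : set_structure} (a : A) : Prop :=
  exists w n f, is_omega w /\ n ∈ w /\ is_bijection f n a.

(* A space is the pair (P, T) of its set of points and its topology. *)
Definition is_topology {A : set_structure} (P T : A) : Prop :=
  (forall U, U ∈ T -> subset U P) /\
  (forall U, is_empty U -> U ∈ T) /\
  P ∈ T /\
  (forall U V W, U ∈ T -> V ∈ T -> is_inter W U V -> W ∈ T) /\
  (forall F U, subset F T -> is_union U F -> U ∈ T).

Definition is_closed {A : set_structure} (P T C : A) : Prop :=
  subset C P /\ exists U, is_diff U P C /\ U ∈ T.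

Definition is_hausdorff {A : set_structure} (P T : A) : Prop :=
  forall x y, x ∈ P -> y ∈ P -> x <> y ->
    exists U V, U ∈ T /\ V ∈ T /\ x ∈ U /\ y ∈ V /\
      forall z, ~ (z ∈ U /\ z ∈ V).

Definition covers_compactly {A : set_structure} (P T : A) : Prop :=
  forall F, subset F T -> is_union P F ->
    exists G, subset G F /\ is_finite G /\ is_union P G.

Definition is_compact_top {A : set_structure} (P T : A) : Prop :=
  is_topology P T /\ is_hausdorff P T /\ covers_compactly P T.

Definition T0_separating {A : set_structure} (P U : A) : Prop :=
  forall x y, x ∈ P -> y ∈ P -> x <> y ->
    exists B, B ∈ U /\ exists! z, (z = x \/ z = y) /\ z ∈ B.

Definition is_F_sigma {A : set_structure} (P T B : A) : Prop :=
  exists w s, is_omega w /\ is_function_on s w /\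
    (forall n C, rel s n C -> is_closed P T C) /\
    (forall z, z ∈ B <-> exists n C, rel s n C /\ z ∈ C).

Definition finite_ord {A : set_structure} (x F : A) : Prop :=
  exists a, (forall B, B ∈ a <-> B ∈ F /\ x ∈ B) /\ is_finite a.

(* The function s on omega is the sequence of the families U_n. *)
Definition weakly_sigma_point_finite {A : set_structure} (P U : A) : Prop :=
  exists w s, is_omega w /\ is_function_on s w /\
    (forall B, B ∈ U <-> exists n Un, rel s n Un /\ B ∈ Un) /\
    (forall x, x ∈ P ->
      forall B, B ∈ U <->
        exists n Un, rel s n Un /\ finite_ord x Un /\ B ∈ Un).

Definition is_gulko_compact {A : set_structure} (X : A) : Prop :=
  exists P T, is_opair X P T /\ is_compact_top P T /\
    exists U,
      (forall B, B ∈ U -> B ∈ T /\ is_F_sigma P T B) /\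
      T0_separating P U /\ weakly_sigma_point_finite P U.

(* A lattice is the pair (D, R) of its underlying set and its order. *)
Definition is_least {A : set_structure} (D R o : A) : Prop :=
  o ∈ D /\ forall a, a ∈ D -> rel R o a.

Definition is_greatest {A : set_structure} (D R i : A) : Prop :=
  i ∈ D /\ forall a, a ∈ D -> rel R a i.

Definition is_meet {A : set_structure} (D R c a b : A) : Prop :=
  c ∈ D /\ rel R c a /\ rel R c b /\
  forall d, d ∈ D -> rel R d a -> rel R d b -> rel R d c.

Definition is_filter {A : set_structure} (D R F : A) : Prop :=
  subset F D /\
  (forall o, is_least D R o -> o ∉ F) /\
  (forall i, is_greatest D R i -> i ∈ F) /\
  (forall a b c x, a ∈ F -> b ∈ F -> is_meet D R c a b ->
     x ∈ D -> rel R c x -> x ∈ F).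

Definition is_ultrafilter {A : set_structure} (D R F : A) : Prop :=
  is_filter D R F /\ forall G, is_filter D R G -> subset F G -> G = F.

(* b is the set a^- of the points p of Q with a not in p *)
Definition is_minus {A : set_structure} (Q b a : A) : Prop :=
  forall p, p ∈ b <-> p ∈ Q /\ a ∉ p.

Definition is_Ult {A : set_structure} (L Y : A) : Prop :=
  exists D R Q T, is_opair L D R /\ is_opair Y Q T /\
    (forall p, p ∈ Q <-> is_ultrafilter D R p) /\
    (forall U, U ∈ T <->
       exists F, (forall b, b ∈ F -> exists a, a ∈ D /\ is_minus Q b a) /\
         is_union U F).

Definition is_closed_lattice {A : set_structure} (X L : A) : Prop :=
  exists P T D R, is_opair X P T /\ is_opair L D R /\
    (forall C, C ∈ D <-> is_closed P T C) /\
    (forall r, r ∈ R <->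
       exists a b, a ∈ D /\ b ∈ D /\ subset a b /\ is_opair r a b).

(* Models are arbitrary classes of the universe V, sets or proper classes. *)
Definition transitive_class {V : set_structure} (M : V -> Prop) : Prop :=
  forall x y, M y -> x ∈ y -> M x.

Definition model {V : set_structure} (M : V -> Prop) : set_structure :=
  SetStructure {x : V | M x} (fun x y => proj1_sig x ∈ proj1_sig y).

Definition incl {V : set_structure} {M N : V -> Prop}
    (MN : forall x, M x -> N x) (x : model M) : model N :=
  exist N (proj1_sig x) (MN _ (proj2_sig x)).

(* Y = X^N: the lattice L of closed sets is computed in M, Ult(L) in N. *)
Definition is_interpretation {V : set_structure} {M N : V -> Prop}
    (MN : forall x, M x -> N x) (X : model M) (Y : model N) : Prop :=
  exists L : model M, is_closed_lattice X L /\ is_Ult (incl MN L) Y.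

(* Main.v *)
Require Import Defs.
From Stdlib Require Import Arith Classical ClassicalEpsilon.

(** Let [M] be the smaller and [N] the larger model, [X] a Gul'ko compact space of
    [M] and [L] its lattice of closed sets.  In [N], for any normal lattice of
    sets, the ultrafilters form a compact Hausdorff space: normality separates
    points, and compactness is Zorn's lemma applied to the filter of those
    members whose complements are finitely covered ([ultra_compact_top]).  Normality
    of [L] holds in [M] because [X] is compact Hausdorff, and it is a statement
    about elements of [L] only, so it holds in [N] too.

    An open set [B] of [X] is interpreted in [N] by the set of ultrafilters having
    a member inside [B] ([inside], [is_lift]).  If [U] is the weakly
    sigma-point-finite family of [X], with pieces [U_n], the family of the
    interpretations of its members is the witness in [N].  These are open.  They
    are F-sigma because in [M] every member of [U] is exhausted by a
    sequence of closed sets such that every closed subset lies inside one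
    of them ([F_sigma_exhaustion]).

    The two remaining properties are not absolute separately: a family such as
    the complements of the points of the interval separates its points in [M] but
    not the new points of [N].  They are transferred together.  Suppose that
    ultrafilters [p], [q] are a counterexample in [N].  For each [n], either
    infinitely many members of [U_n] contain [p], or the finitely many that do form
    a set of [M], and then, by compactness in [M], a single member of [p] decides
    every element of [U_n]: it lies inside it or misses it ([trace_decided]).  In
    both cases what is asked of [n] follows from the presence in [p] and [q] of
    suitable closed sets of [M], countably many in all.  The finite attempts to
    choose such closed sets, with nonempty intersections, form a tree of [M].  In
    [N] the pair [p], [q] shows that the tree is not well-founded.  By absoluteness
    of well-foundedness ([well_founded_absolute], through a rank function that is a
    set of [M]) it is not well-founded in [M], and a branch gives, by compactness,
    two points of [X] with the same behaviour as [p] and [q] ([reflection]).  Every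
    element of [U] lies in some piece in which the first point has finite order, so
    these points contradict the properties of [U] in [M]
    ([inside_sigma_point_finite], [inside_T0]).

    The axiom schemas speak of formulas, whereas the arguments are about
    predicates.  The first part therefore shows that the definable predicates are
    closed under the logical operations, which lets a tactic discharge every use of
    separation, replacement and induction. *)

(** As a class, the axioms reach every lemma, and the pairing function [opair],
    without being named. *)
Existing Class ZFC.

(** * Definable predicates *)

Definition mix {T} (e c : nat -> T) (n : nat) : T :=
  if Nat.even n then e (Nat.div2 n) else c (Nat.div2 n).

Lemma mix_even {T} (e c : nat -> T) n : mix e c (2 * n) = e n.
Proof.
  unfold mix. rewrite Nat.even_mul, Nat.div2_double. reflexivity.
Qed.

Lemma mix_odd {T} (e c : nat -> T) n : mix e c (S (2 * n)) = c n.
Proof.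
  unfold mix. rewrite Nat.even_succ, Nat.odd_mul, Nat.div2_succ_double.
  reflexivity.
Qed.

Definition mix_ren (r s : nat -> nat) (n : nat) : nat :=
  if Nat.even n then r (Nat.div2 n) else s (Nat.div2 n).

Definition up_ren (r : nat -> nat) (n : nat) : nat :=
  match n with O => O | S m => S (r m) end.

Fixpoint ren (r : nat -> nat) (f : formula) : formula :=
  match f with
  | fMem i j => fMem (r i) (r j)
  | fEq i j => fEq (r i) (r j)
  | fNot g => fNot (ren r g)
  | fAnd g h => fAnd (ren r g) (ren r h)
  | fAll g => fAll (ren (up_ren r) g)
  end.

Lemma sat_ren (A : set_structure) f : forall r (e e' : nat -> A),
  (forall n, e' n = e (r n)) -> sat A e (ren r f) <-> sat A e' f.
Proof.
  induction f as [i j|i j|g IH|g IHg h IHh|g IH]; simpl; intros r e e' H.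
  - rewrite !H. tauto.
  - rewrite !H. tauto.
  - rewrite (IH r e e' H). tauto.
  - rewrite (IHg r e e' H), (IHh r e e' H). tauto.
  - assert (E : forall x n, scons x e' n = scons x e (up_ren r n)).
    { intros x [|n]; simpl; auto. }
    split; intros G x.
    + apply (IH _ _ _ (E x)). apply G.
    + apply (IH _ _ _ (E x)). apply G.
Qed.

(** Parameters are kept in the odd positions of the environment, so that they
    never interfere with the variables and two parameter lists can be merged.  A
    predicate of one or two arguments is definable as a predicate of the entries 0
    and 1 of the environment. *)
Definition definable {A : set_structure} (P : (nat -> A) -> Prop) : Prop :=
  exists f c, forall e, P e <-> sat A (mix e c) f.

(** Definability of the graph: entry 0 is the value, and the other entries, moved
    down by one, are the arguments. *)
Definition definable_term {A : set_structure} (t : (nat -> A) -> A) : Prop :=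
  definable (fun e => e 0 = t (fun n => e (S n))).

Section Definability.
Context {A : set_structure} {HA : ZFC A}.
Implicit Types (P Q : (nat -> A) -> Prop) (s t : (nat -> A) -> A).

Lemma definable_iff P Q :
  (forall e, P e <-> Q e) -> definable Q -> definable P.
Proof.
  intros H (f & c & Hf). exists f, c. intros e. rewrite H. apply Hf.
Qed.

Lemma definable_not P : definable P -> definable (fun e => ~ P e).
Proof.
  intros (f & c & H). exists (fNot f), c. intros e. simpl. rewrite H. tauto.
Qed.

Lemma definable_and P Q :
  definable P -> definable Q -> definable (fun e => P e /\ Q e).
Proof.
  intros (f & c & Hf) (g & d & Hg).
  (* The merged parameter list has those of [f] at its even positions and those of
     [g] at its odd ones. *)
  exists (fAnd (ren (mix_ren (fun n => 2 * n) (fun n => S (2 * (2 * n)))) f)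
               (ren (mix_ren (fun n => 2 * n) (fun n => S (2 * (S (2 * n))))) g)),
    (mix c d).
  intros e. rewrite Hf, Hg. cbn [sat].
  rewrite (sat_ren A f _ (mix e (mix c d)) (mix e c)).
  2:{ intros n. unfold mix_ren, mix at 1.
      destruct (Nat.even n); rewrite ?mix_even, ?mix_odd, ?mix_even; reflexivity. }
  rewrite (sat_ren A g _ (mix e (mix c d)) (mix e d)).
  2:{ intros n. unfold mix_ren, mix at 1.
      destruct (Nat.even n); rewrite ?mix_even, ?mix_odd, ?mix_odd; reflexivity. }
  tauto.
Qed.

(** The bound variable becomes entry 0, so the other variables move up by one; the
    same holds inside [sat], where it moves the merged environment by one only. *)
Lemma definable_all (P : A -> (nat -> A) -> Prop) :
  definable (fun e => P (e 0) (fun n => e (S n))) ->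
  definable (fun e => forall x, P x e).
Proof.
  intros (f & c & H).
  exists (fAll (ren (mix_ren (fun n => match n with 0 => 0 | S m => S (2 * m) end)
                             (fun n => S (S (2 * n)))) f)), c.
  intros e. cbn [sat].
  assert (E : forall x, P x e <-> sat A (scons x (mix e c))
    (ren (mix_ren (fun n => match n with 0 => 0 | S m => S (2 * m) end)
                  (fun n => S (S (2 * n)))) f)).
  { intros x. etransitivity; [exact (H (scons x e))|].
    symmetry. apply sat_ren. intros n. unfold mix_ren, mix at 1.
    destruct (Nat.even n).
    - destruct (Nat.div2 n); cbn [scons]; rewrite ?mix_even; reflexivity.
    - cbn [scons]. rewrite mix_odd. reflexivity. }
  split; intros G x; apply E, G.
Qed.

Lemma definable_rename P (r : nat -> nat) :
  definable P -> definable (fun e => P (fun n => e (r n))).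
Proof.
  intros (f & c & H).
  exists (ren (mix_ren (fun n => 2 * r n) (fun n => S (2 * n))) f), c.
  intros e. rewrite H. symmetry. apply sat_ren.
  intros n. unfold mix_ren, mix at 1.
  destruct (Nat.even n); rewrite ?mix_even, ?mix_odd; reflexivity.
Qed.

Lemma definable_or P Q :
  definable P -> definable Q -> definable (fun e => P e \/ Q e).
Proof.
  intros HP HQ. apply (definable_iff _ (fun e => ~ (~ P e /\ ~ Q e))).
  - intros e. tauto.
  - apply definable_not, definable_and; apply definable_not; assumption.
Qed.

Lemma definable_imp P Q :
  definable P -> definable Q -> definable (fun e => P e -> Q e).
Proof.
  intros HP HQ. apply (definable_iff _ (fun e => ~ P e \/ Q e)).
  - intros e. tauto.
  - apply definable_or; [apply definable_not|]; assumption.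
Qed.

Lemma definable_equiv P Q :
  definable P -> definable Q -> definable (fun e => P e <-> Q e).
Proof.
  intros HP HQ. apply definable_and; apply definable_imp; assumption.
Qed.

Lemma definable_ex (P : A -> (nat -> A) -> Prop) :
  definable (fun e => P (e 0) (fun n => e (S n))) ->
  definable (fun e => exists x, P x e).
Proof.
  intros H. apply (definable_iff _ (fun e => ~ forall x, ~ P x e)).
  - intros e. split.
    + intros [x Hx] G. exact (G x Hx).
    + intros G. apply not_all_not_ex. exact G.
  - apply definable_not. apply (definable_all (fun x e => ~ P x e)).
    apply definable_not. exact H.
Qed.

Lemma definable_term_var i : definable_term (fun e : nat -> A => e i).
Proof.
  destruct (zfc_infinity A HA) as [a _].
  exists (fEq (2 * 0) (2 * S i)), (fun _ => a). intros e. cbn [sat].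
  rewrite !mix_even. tauto.
Qed.

Lemma definable_term_const a : definable_term (fun e : nat -> A => a).
Proof.
  exists (fEq (2 * 0) (S (2 * 0))), (fun _ => a). intros e. cbn [sat].
  rewrite mix_even, mix_odd. tauto.
Qed.

(** Terms can be substituted because [P (t e)] is equivalent to
    [exists x, x = t e /\ P x]. *)
Lemma definable_subst (P : A -> (nat -> A) -> Prop) t :
  definable (fun e => P (e 0) (fun n => e (S n))) -> definable_term t ->
  definable (fun e => P (t e) e).
Proof.
  intros HP Ht. apply (definable_iff _ (fun e => exists x, x = t e /\ P x e)).
  - intros e. split; [intros H; exists (t e); auto|intros (x & -> & H); exact H].
  - apply (definable_ex (fun x e => x = t e /\ P x e)).
    apply definable_and; assumption.
Qed.

Lemma definable_app1 (P : A -> Prop) t :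
  definable (fun e => P (e 0)) -> definable_term t ->
  definable (fun e => P (t e)).
Proof. exact (definable_subst (fun x _ => P x) t). Qed.

Lemma definable_term_rename t (r : nat -> nat) :
  definable_term t -> definable_term (fun e => t (fun n => e (r n))).
Proof.
  intros H. unfold definable_term in *.
  destruct H as (f & c & H).
  exists (ren (mix_ren (fun n => 2 * up_ren r n) (fun n => S (2 * n))) f), c.
  intros e. etransitivity; [exact (H (scons (e 0) (fun n => e (S (r n)))))|].
  symmetry. apply sat_ren. intros n. unfold mix_ren, mix at 1.
  destruct (Nat.even n); [destruct (Nat.div2 n)|];
    cbn [scons up_ren]; rewrite ?mix_even, ?mix_odd; reflexivity.
Qed.

Lemma definable_app2 (P : A -> A -> Prop) s t :
  definable (fun e => P (e 0) (e 1)) -> definable_term s -> definable_term t ->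
  definable (fun e => P (s e) (t e)).
Proof.
  intros HP Hs Ht.
  apply (definable_subst (fun x e => P x (t e)) s); [|exact Hs].
  apply (definable_subst (fun y e => P (e 0) y) (fun e => t (fun n => e (S n)))).
  - apply (definable_rename (fun e => P (e 0) (e 1))
             (fun n => match n with 0 => 1 | _ => 0 end) HP).
  - exact (definable_term_rename t S Ht).
Qed.

Lemma definable_mem s t :
  definable_term s -> definable_term t -> definable (fun e => s e ∈ t e).
Proof.
  apply (definable_app2 (fun x y => x ∈ y)).
  destruct (zfc_infinity A HA) as [a _].
  exists (fMem (2 * 0) (2 * 1)), (fun _ => a). intros e. cbn [sat].
  rewrite !mix_even. tauto.
Qed.

Lemma definable_eq s t :
  definable_term s -> definable_term t -> definable (fun e => s e = t e).
Proof.
  apply (definable_app2 (fun x y => x = y)).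
  destruct (zfc_infinity A HA) as [a _].
  exists (fEq (2 * 0) (2 * 1)), (fun _ => a). intros e. cbn [sat].
  rewrite !mix_even. tauto.
Qed.

Lemma definable_term_app2 (g : A -> A -> A) s t :
  definable (fun e => e 0 = g (e 1) (e 2)) ->
  definable_term s -> definable_term t ->
  definable_term (fun e => g (s e) (t e)).
Proof.
  intros Hg Hs Ht. unfold definable_term.
  apply (definable_subst (fun x e => e 0 = g x (t (fun n => e (S n))))
           (fun e => s (fun n => e (S n)))).
  2: exact (definable_term_rename s S Hs).
  apply (definable_subst (fun y e => e 1 = g (e 0) y)
           (fun e => t (fun n => e (S (S n))))).
  2: exact (definable_term_rename t (fun n => S (S n)) Ht).
  apply (definable_rename (fun e => e 0 = g (e 1) (e 2))
    (fun n => match n with 0 => 2 | 1 => 1 | _ => 0 end) Hg).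
Qed.

Lemma definable_prop (p : Prop) : definable (fun _ : nat -> A => p).
Proof.
  destruct (zfc_infinity A HA) as [a _].
  destruct (classic p) as [H|H].
  - apply (definable_iff _ (fun e => a = a)); [intros; tauto|].
    apply definable_eq; apply definable_term_const.
  - apply (definable_iff _ (fun e => ~ a = a)); [intros; tauto|].
    apply definable_not, definable_eq; apply definable_term_const.
Qed.

End Definability.

Create HintDb definable_unfold.

Ltac solve_term :=
  cbv beta;
  first [ apply definable_term_const | apply definable_term_var ].

Ltac definability_step :=
  cbv beta;
  match goal with
  | |- definable_term _ => solve_term
  | |- definable (fun e => ?p) => apply (definable_prop p)
  | |- definable (fun e => ~ _) => apply definable_not
  | |- definable (fun e => _ /\ _) => apply definable_and
  | |- definable (fun e => _ \/ _) => apply definable_or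
  | |- definable (fun e => _ <-> _) => apply definable_equiv
  | |- definable (fun e => ex _) => apply definable_ex
  | |- definable (fun e => unique _ _) => unfold unique
  | |- definable (fun e => mem _ _) => apply definable_mem
  | |- definable (fun e => _ = _) => apply definable_eq
  | H : definable (fun e => ?P (e 0)) |- definable (fun e => ?P _) =>
      apply (definable_app1 P _ H)
  | H : definable (fun e => ?P (e 0) (e 1)) |- definable (fun e => ?P _ _) =>
      apply (definable_app2 P _ _ H)
  | |- definable (fun e => _ -> _) => apply definable_imp
  | |- definable (fun e => forall x, _) => apply definable_all
  end.

Ltac definability :=
  autounfold with definable_unfold; repeat definability_step.

#[global] Hint Unfold is_empty subset is_upair is_union is_inter is_diff is_power
  is_succ is_inductive is_opair rel is_function_on is_bijection is_omega
  is_finite is_topology is_closed is_hausdorff covers_compactly is_compact_top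
  T0_separating is_F_sigma finite_ord weakly_sigma_point_finite is_least
  is_greatest is_meet is_filter is_ultrafilter is_minus : definable_unfold.

(** * Elementary set theory in a model *)

Section Basics.
Context {A : set_structure} {HA : ZFC A}.

Lemma set_ext (x y : A) : (forall z, z ∈ x <-> z ∈ y) -> x = y.
Proof. apply (zfc_extensionality A HA). Qed.

Lemma separation (P : A -> Prop) (a : A) :
  definable (fun e => P (e 0)) -> exists b, forall x, x ∈ b <-> x ∈ a /\ P x.
Proof.
  intros (f & c & H).
  destruct (zfc_separation A HA
    (ren (mix_ren (fun _ => 0) (fun n => S n)) f) c a) as [b Hb].
  exists b. intros x. rewrite Hb.
  rewrite (sat_ren A f _ _ (mix (fun _ => x) c)).
  - rewrite <- H. tauto.
  - intros n. unfold mix_ren, mix. destruct (Nat.even n); reflexivity.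
Qed.

Lemma replacement (Q : A -> A -> Prop) (a : A) :
  definable (fun e => Q (e 0) (e 1)) ->
  (forall x y z, x ∈ a -> Q x y -> Q x z -> y = z) ->
  exists b, forall y, y ∈ b <-> exists x, x ∈ a /\ Q x y.
Proof.
  intros HQ Hfun.
  destruct (separation (fun x => exists y, Q x y) a) as [a' Ha']; [definability|].
  (* The axiom asks for totality, hence the restriction to the domain [a']. *)
  destruct HQ as (f & c & H).
  pose (g := ren (mix_ren (fun n => match n with 0 => 0 | _ => 1 end)
                          (fun n => S (S n))) f).
  assert (E : forall x y, sat A (scons x (scons y c)) g <-> Q x y).
  { intros x y. unfold g.
    rewrite (sat_ren A f _ _ (mix (scons x (fun _ => y)) c)).
    - rewrite <- H. cbn [scons]. tauto.
    - intros n. unfold mix_ren, mix.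
      destruct (Nat.even n); [destruct (Nat.div2 n)|]; reflexivity. }
  destruct (zfc_replacement A HA g c a') as [b Hb].
  - intros x Hx. apply Ha' in Hx. destruct Hx as [Hx [y Hy]].
    exists y. split; [apply E, Hy|].
    intros z Hz. apply E in Hz. exact (Hfun x y z Hx Hy Hz).
  - exists b. intros y. rewrite Hb. split.
    + intros (x & Hx & Hs). apply Ha' in Hx. apply E in Hs.
      exists x. tauto.
    + intros (x & Hx & Hs). exists x. rewrite E. split; [|exact Hs].
      apply Ha'. split; [exact Hx|exists y; exact Hs].
Qed.

Lemma not_mem_self (x : A) : x ∉ x.
Proof.
  destruct (zfc_pairing A HA x x) as [u Hu].
  destruct (zfc_foundation A HA u) as (y & Hy & Hn).
  - exists x. apply Hu. tauto.
  - apply Hu in Hy. assert (y = x) by tauto. subst y.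
    apply Hn. apply Hu. tauto.
Qed.

Lemma not_mem_cycle (x y : A) : x ∈ y -> y ∉ x.
Proof.
  intros Hxy Hyx. destruct (zfc_pairing A HA x y) as [u Hu].
  destruct (zfc_foundation A HA u) as (z & Hz & Hn).
  - exists x. apply Hu. tauto.
  - apply Hu in Hz. destruct Hz as [-> | ->].
    + apply (Hn y); [apply Hu; tauto|exact Hyx].
    + apply (Hn x); [apply Hu; tauto|exact Hxy].
Qed.

Lemma exists_empty : exists o : A, is_empty o.
Proof.
  destruct (zfc_infinity A HA) as [w [[o [Ho _]] _]]. exists o. exact Ho.
Qed.

Lemma empty_unique (x y : A) : is_empty x -> is_empty y -> x = y.
Proof. intros Hx Hy. apply set_ext. firstorder. Qed.

Lemma exists_union2 (x y : A) : exists u, forall z, z ∈ u <-> z ∈ x \/ z ∈ y.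
Proof.
  destruct (zfc_pairing A HA x y) as [p Hp].
  destruct (zfc_union A HA p) as [u Hu]. exists u. intros z. rewrite (Hu z). split.
  - intros (t & Ht & Hz). apply Hp in Ht. destruct Ht as [-> | ->]; auto.
  - intros [H|H]; [exists x|exists y]; rewrite (Hp _); auto.
Qed.

Lemma exists_singleton (x : A) : exists s, forall z, z ∈ s <-> z = x.
Proof.
  destruct (zfc_pairing A HA x x) as [s Hs]. exists s. intros z.
  rewrite (Hs z). tauto.
Qed.

Lemma exists_adjoin (a x : A) : exists b, forall z, z ∈ b <-> z ∈ a \/ z = x.
Proof.
  destruct (exists_singleton x) as [s Hs].
  destruct (exists_union2 a s) as [b Hb]. exists b. intros z.
  rewrite Hb, Hs. tauto.
Qed.

Lemma exists_inter (x y : A) : exists w, is_inter w x y.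
Proof.
  destruct (separation (fun z => z ∈ y) x) as [w Hw]; [definability|].
  exists w. exact Hw.
Qed.

Lemma exists_diff (x y : A) : exists w, is_diff w x y.
Proof.
  destruct (separation (fun z => z ∉ y) x) as [w Hw]; [definability|].
  exists w. exact Hw.
Qed.

(** ** Ordered pairs *)

Lemma exists_opair (x y : A) : exists p, is_opair p x y.
Proof.
  destruct (zfc_pairing A HA x x) as [s Hs].
  destruct (zfc_pairing A HA x y) as [d Hd].
  destruct (zfc_pairing A HA s d) as [p Hp].
  exists p, s, d. auto.
Qed.

Definition opair (x y : A) : A :=
  proj1_sig (constructive_indefinite_description _ (exists_opair x y)).

Lemma opair_spec x y : is_opair (opair x y) x y.
Proof. unfold opair. apply proj2_sig. Qed.

Lemma upair_unique (u v x y : A) : is_upair u x y -> is_upair v x y -> u = v.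
Proof.
  intros Hu Hv. apply set_ext. intros z. rewrite (Hu z), (Hv z). tauto.
Qed.

Lemma is_opair_iff p x y : is_opair p x y <-> p = opair x y.
Proof.
  split; [|intros ->; apply opair_spec].
  intros (s & d & Hs & Hd & Hp).
  destruct (opair_spec x y) as (s' & d' & Hs' & Hd' & Hp').
  rewrite (upair_unique s s' x x Hs Hs') in Hp.
  rewrite (upair_unique d d' x y Hd Hd') in Hp.
  exact (upair_unique _ _ _ _ Hp Hp').
Qed.

Lemma opair_inj x y x' y' : opair x y = opair x' y' -> x = x' /\ y = y'.
Proof.
  intros E. destruct (opair_spec x y) as (s & d & Hs & Hd & Hp).
  destruct (opair_spec x' y') as (s' & d' & Hs' & Hd' & Hp').
  rewrite <- E in Hp'.
  assert (Ex : x = x').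
  { assert (H : s ∈ opair x y) by (apply Hp; auto). apply Hp' in H.
    destruct H as [-> | ->].
    - assert (H : x ∈ s') by (apply Hs; auto). apply Hs' in H. tauto.
    - assert (H : x' ∈ d') by (apply Hd'; auto). apply Hs in H.
      symmetry. tauto. }
  subst x'. split; [reflexivity|].
  rewrite <- (upair_unique _ _ _ _ Hs Hs') in Hp'.
  destruct (classic (y = x)) as [->|Hne].
  - assert (H : d' ∈ opair x x) by (apply Hp'; auto). apply Hp in H.
    assert (K : y' ∈ d') by (apply Hd'; auto).
    destruct H as [-> | ->].
    + apply Hs in K. symmetry. tauto.
    + apply Hd in K. symmetry. tauto.
  - assert (H : d ∈ opair x y) by (apply Hp; auto). apply Hp' in H.
    assert (K : y ∈ d) by (apply Hd; auto).
    destruct H as [-> | ->].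
    + apply Hs in K. tauto.
    + apply Hd' in K. tauto.
Qed.

Lemma definable_opair (s t : (nat -> A) -> A) :
  definable_term s -> definable_term t ->
  definable_term (fun e => opair (s e) (t e)).
Proof.
  apply definable_term_app2.
  apply (definable_iff _ (fun e => is_opair (e 0) (e 1) (e 2))).
  - intros e. symmetry. apply is_opair_iff.
  - definability.
Qed.

Lemma rel_iff (R x y : A) : rel R x y <-> opair x y ∈ R.
Proof.
  split.
  - intros (p & Hp & H). apply is_opair_iff in Hp. subst p. exact H.
  - intros H. exists (opair x y). split; [apply opair_spec|exact H].
Qed.

Lemma exists_product (a b : A) :
  exists c, forall z, z ∈ c <-> exists x y, x ∈ a /\ y ∈ b /\ z = opair x y.
Proof.
  destruct (exists_union2 a b) as [u Hu].
  destruct (zfc_power A HA u) as [p Hp].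
  destruct (zfc_power A HA p) as [pp Hpp].
  destruct (separation (fun z => exists x y, x ∈ a /\ y ∈ b /\ is_opair z x y) pp)
    as [c Hc]; [definability|].
  exists c. intros z. rewrite Hc. split.
  - intros [_ (x & y & Hx & Hy & Hz)]. apply is_opair_iff in Hz. eauto.
  - intros (x & y & Hx & Hy & ->). split.
    + apply Hpp. intros s Hs. apply Hp. intros t Ht. apply Hu.
      destruct (opair_spec x y) as (s1 & d1 & Hs1 & Hd1 & Hp1).
      apply Hp1 in Hs. destruct Hs as [-> | ->].
      * apply Hs1 in Ht. left. destruct Ht as [-> | ->]; assumption.
      * apply Hd1 in Ht. destruct Ht as [-> | ->]; auto.
    + exists x, y. split; [|split]; auto using opair_spec.
Qed.

Lemma exists_relation (Q : A -> A -> Prop) (a b : A) :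
  definable (fun e => Q (e 0) (e 1)) ->
  exists R, (forall x y, rel R x y <-> x ∈ a /\ y ∈ b /\ Q x y) /\
    forall p, p ∈ R -> exists x y, x ∈ a /\ y ∈ b /\ p = opair x y.
Proof.
  intros HQ. destruct (exists_product a b) as [c Hc].
  destruct (separation (fun z => exists x y, is_opair z x y /\ Q x y) c)
    as [R HR]; [definability|].
  exists R. split.
  - intros x y. rewrite rel_iff, HR, Hc. split.
    + intros [(x1 & y1 & Hx & Hy & E) (x2 & y2 & E2 & H)].
      apply is_opair_iff in E2.
      apply opair_inj in E. apply opair_inj in E2.
      destruct E as [-> ->]. destruct E2 as [-> ->]. auto.
    + intros (Hx & Hy & H). split; [eauto|].
      exists x, y. split; [apply opair_spec|exact H].
  - intros p Hp. apply HR in Hp. destruct Hp as [Hp _]. apply Hc, Hp.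
Qed.

Lemma exists_function (Q : A -> A -> Prop) (a b : A) :
  definable (fun e => Q (e 0) (e 1)) ->
  (forall x, x ∈ a -> exists y, y ∈ b /\ Q x y) ->
  (forall x y z, x ∈ a -> Q x y -> Q x z -> y = z) ->
  exists f, is_function_on f a /\
    forall x y, rel f x y <-> x ∈ a /\ y ∈ b /\ Q x y.
Proof.
  intros HQ Hex Hun. destruct (exists_relation Q a b HQ) as [f [Hf Hp]].
  exists f. split; [|exact Hf]. split.
  - intros p H. destruct (Hp p H) as (x & y & Hx & _ & ->).
    exists x, y. split; [exact Hx|apply opair_spec].
  - intros x Hx. destruct (Hex x Hx) as (y & Hy & HQy). exists y. split.
    + apply Hf. auto.
    + intros z Hz. apply Hf in Hz. destruct Hz as (_ & _ & Hz).
      exact (Hun x y z Hx HQy Hz).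
Qed.

Lemma exists_range (f : A) : exists r, forall y, y ∈ r <-> exists x, rel f x y.
Proof.
  destruct (zfc_union A HA f) as [u Hu].
  destruct (zfc_union A HA u) as [v Hv].
  destruct (separation (fun y => exists x, rel f x y) v) as [r Hr]; [definability|].
  exists r. intros y. rewrite Hr. split; [tauto|].
  intros [x H]. split; [|eauto].
  apply rel_iff in H. destruct (opair_spec x y) as (s & d & _ & Hd & Hp).
  apply Hv. exists d. split; [|apply Hd; auto].
  apply Hu. exists (opair x y). split; [exact H|apply Hp; auto].
Qed.

End Basics.

(** From here on terms may also be built with [opair]. *)
Ltac solve_term ::=
  cbv beta;
  first [ apply definable_term_const | apply definable_term_var
        | apply definable_opair; solve_term ].

(** * Natural numbers and finite sets *)

Definition equipotent {A : set_structure} (a b : A) : Prop :=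
  exists f, is_bijection f a b.

#[global] Hint Unfold equipotent : definable_unfold.

Section Omega.
Context {A : set_structure} {HA : ZFC A}.

Lemma exists_omega : exists w : A, is_omega w.
Proof.
  destruct (zfc_infinity A HA) as [w0 [(o & Ho & How) Hs]].
  destruct (separation (fun x => forall v, is_inductive v -> x ∈ v) w0)
    as [w Hw]; [definability|].
  exists w. split; [split|].
  - exists o. split; [exact Ho|]. apply Hw. split; [exact How|].
    intros v [(o' & Ho' & H) _]. rewrite (empty_unique o o' Ho Ho'). exact H.
  - intros x Hx. apply Hw in Hx. destruct Hx as [Hx Hi].
    destruct (Hs x Hx) as (s & Hsx & Hsw). exists s. split; [exact Hsx|].
    apply Hw. split; [exact Hsw|]. intros v Hv.
    destruct (proj2 Hv x (Hi v Hv)) as (s' & Hs' & H).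
    replace s with s'; [exact H|]. apply set_ext. intros z.
    rewrite (Hs' z), (Hsx z). tauto.
  - intros v Hv x Hx. apply Hw in Hx. apply Hx, Hv.
Qed.

Lemma omega_unique (w w' : A) : is_omega w -> is_omega w' -> w = w'.
Proof.
  intros [Hi Hl] [Hi' Hl']. apply set_ext. intros z. split; auto.
  - intros H. exact (Hl w' Hi' z H).
  - intros H. exact (Hl' w Hi z H).
Qed.

Lemma succ_unique (s t n : A) : is_succ s n -> is_succ t n -> s = t.
Proof. intros Hs Ht. apply set_ext. intros z. rewrite (Hs z), (Ht z). tauto. Qed.

Lemma exists_succ (n : A) : exists s, is_succ s n.
Proof. exact (exists_adjoin n n). Qed.

Section Fixed.
Context (w : A) (Hw : is_omega w).

Lemma omega_empty o : is_empty o -> o ∈ w.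
Proof.
  intros Ho. destruct Hw as [[(o' & Ho' & H) _] _].
  rewrite (empty_unique o o' Ho Ho'). exact H.
Qed.

Lemma omega_succ n s : n ∈ w -> is_succ s n -> s ∈ w.
Proof.
  intros Hn Hs. destruct Hw as [[_ H] _]. destruct (H n Hn) as (t & Ht & Htw).
  rewrite (succ_unique s t n Hs Ht). exact Htw.
Qed.

Lemma omega_ind (P : A -> Prop) :
  definable (fun e => P (e 0)) ->
  (forall o, is_empty o -> P o) ->
  (forall n s, n ∈ w -> P n -> is_succ s n -> P s) ->
  forall n, n ∈ w -> P n.
Proof.
  intros HP H0 HS.
  destruct (separation P w HP) as [v Hv].
  assert (Hi : is_inductive v).
  { split.
    - destruct exists_empty as [o Ho]. exists o. split; [exact Ho|].
      apply Hv. split; [apply omega_empty, Ho|apply H0, Ho].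
    - intros x Hx. apply Hv in Hx. destruct (exists_succ x) as [s Hs].
      exists s. split; [exact Hs|]. apply Hv.
      split; [apply (omega_succ x); tauto|apply (HS x); tauto]. }
  intros n Hn. apply Hv. exact (proj2 Hw v Hi n Hn).
Qed.

Lemma omega_mem n m : n ∈ w -> m ∈ n -> m ∈ w.
Proof.
  intros Hn. revert m.
  apply (omega_ind (fun n => forall m, m ∈ n -> m ∈ w)); [definability| | |exact Hn].
  - intros o Ho m Hm. destruct (Ho m Hm).
  - intros k s Hk IH Hs m Hm. apply Hs in Hm. destruct Hm as [Hm| ->]; auto.
Qed.

Lemma omega_trans n m k : n ∈ w -> m ∈ n -> k ∈ m -> k ∈ n.
Proof.
  intros Hn. revert m k.
  apply (omega_ind (fun n => forall m k, m ∈ n -> k ∈ m -> k ∈ n));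
    [definability| | |exact Hn].
  - intros o Ho m k Hm. destruct (Ho m Hm).
  - intros x s Hx IH Hs m k Hm Hk. apply Hs in Hm. apply Hs. left.
    destruct Hm as [Hm| ->]; eauto.
Qed.

Lemma omega_cases n : n ∈ w -> is_empty n \/ exists m, m ∈ w /\ is_succ n m.
Proof.
  revert n. apply omega_ind; [definability| |].
  - auto.
  - intros n s Hn _ Hs. right. exists n. auto.
Qed.

Lemma omega_succ_le n k s : n ∈ w -> k ∈ n -> is_succ s k -> s ∈ n \/ s = n.
Proof.
  intros Hn. revert k s.
  apply (omega_ind (fun n => forall k s, k ∈ n -> is_succ s k -> s ∈ n \/ s = n));
    [definability| | |exact Hn].
  - intros o Ho k s Hk. destruct (Ho k Hk).
  - intros x t Hx IH Ht k s Hk Hs. apply Ht in Hk. destruct Hk as [Hk| ->].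
    + left. apply Ht. apply (IH k s Hk Hs).
    + right. exact (succ_unique s t x Hs Ht).
Qed.

Lemma omega_empty_le n o : n ∈ w -> is_empty o -> o ∈ n \/ o = n.
Proof.
  intros Hn Ho. revert n Hn. apply omega_ind; [definability| |].
  - intros o' Ho'. right. apply empty_unique; assumption.
  - intros n s Hn IH Hs. left. apply Hs. destruct IH as [H| ->]; auto.
Qed.

Lemma omega_total n m : n ∈ w -> m ∈ w -> n ∈ m \/ n = m \/ m ∈ n.
Proof.
  intros Hn Hm. revert n Hn. apply omega_ind; [definability|..].
  - intros o Ho. destruct (omega_empty_le m o Hm Ho); auto.
  - intros n s Hn IH Hs. destruct IH as [H|[->|H]].
    + destruct (omega_succ_le m n s Hm H Hs); auto.
    + right. right. apply Hs. auto.
    + right. right. apply Hs. auto.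
Qed.

End Fixed.

(** ** Equipotence *)

Lemma bijection_intro (Q : A -> A -> Prop) (a b : A) :
  definable (fun e => Q (e 0) (e 1)) ->
  (forall x, x ∈ a -> exists y, y ∈ b /\ Q x y) ->
  (forall x y z, x ∈ a -> Q x y -> Q x z -> y = z) ->
  (forall y, y ∈ b -> exists x, x ∈ a /\ Q x y) ->
  (forall x z y, x ∈ a -> z ∈ a -> Q x y -> Q z y -> x = z) ->
  equipotent a b.
Proof.
  intros HQ Htot Hfun Hsur Hinj.
  destruct (exists_function Q a b HQ Htot Hfun) as (f & Hf & Hr).
  exists f. split; [exact Hf|split].
  - intros x y H. apply Hr in H. tauto.
  - intros y Hy. destruct (Hsur y Hy) as (x & Hx & H). exists x. split.
    + apply Hr. auto.
    + intros z Hz. apply Hr in Hz. apply (Hinj x z y); tauto.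
Qed.

Lemma function_on_dom (f a x y : A) :
  is_function_on f a -> rel f x y -> x ∈ a.
Proof.
  intros [Hp _] H. apply rel_iff in H.
  destruct (Hp _ H) as (x' & y' & Hx & E). apply is_opair_iff in E.
  apply opair_inj in E. destruct E as [-> _]. exact Hx.
Qed.

Lemma function_on_unique (f a x y z : A) :
  is_function_on f a -> rel f x y -> rel f x z -> y = z.
Proof.
  intros Hf H1 H2.
  destruct (proj2 Hf x (function_on_dom f a x y Hf H1)) as (u & _ & Hu).
  rewrite <- (Hu y H1). apply Hu, H2.
Qed.

Lemma function_on_total (f a x : A) :
  is_function_on f a -> x ∈ a -> exists y, rel f x y.
Proof. intros [_ H] Hx. destruct (H x Hx) as (y & Hy & _). eauto. Qed.

Lemma bijection_elim (f a b : A) : is_bijection f a b ->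
  (forall x y, rel f x y -> x ∈ a /\ y ∈ b) /\
  (forall x, x ∈ a -> exists y, rel f x y) /\
  (forall x y z, rel f x y -> rel f x z -> y = z) /\
  (forall y, y ∈ b -> exists x, rel f x y) /\
  (forall x z y, rel f x y -> rel f z y -> x = z).
Proof.
  intros (Hf & Hr & Hi). repeat split.
  - eapply function_on_dom; eauto.
  - eapply Hr; eauto.
  - intros x. apply function_on_total, Hf.
  - intros x y z. apply (function_on_unique f a x y z Hf).
  - intros y Hy. destruct (Hi y Hy) as (x & Hx & _). eauto.
  - intros x z y H1 H2. destruct (Hi y (Hr _ _ H1)) as (u & _ & Hu).
    rewrite <- (Hu x H1). apply Hu, H2.
Qed.

Lemma equipotent_empty (a b : A) : is_empty a -> is_empty b -> equipotent a b.
Proof.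
  intros Ha Hb. apply (bijection_intro (fun x y => x = y)); [definability|..].
  all: intros x; intros; exfalso; firstorder.
Qed.

Lemma equipotent_empty_inv (a b : A) : equipotent a b -> is_empty a -> is_empty b.
Proof.
  intros [f Hf] Ha y Hy. apply bijection_elim in Hf.
  destruct Hf as (Hd & _ & _ & Hs & _). destruct (Hs y Hy) as [x Hx].
  apply Hd in Hx. destruct (Ha x). tauto.
Qed.

(** The new index is [n] itself, which foundation keeps distinct from the others. *)
Lemma equipotent_adjoin (n s a b x : A) :
  equipotent n a -> is_succ s n -> x ∉ a ->
  (forall z, z ∈ b <-> z ∈ a \/ z = x) -> equipotent s b.
Proof.
  intros [f Hf] Hs Hx Hb. apply bijection_elim in Hf.
  destruct Hf as (Hd & Ht & Hu & Hsur & Hinj).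
  apply (bijection_intro (fun i y => rel f i y \/ (i = n /\ y = x)));
    [definability|..].
  - intros i Hi. apply Hs in Hi. destruct Hi as [Hi| ->].
    + destruct (Ht i Hi) as [y Hy]. exists y. split; [|auto].
      apply Hb. left. apply (Hd i y Hy).
    + exists x. split; [apply Hb; auto|auto].
  - intros i y z _ [H1|[-> ->]] [H2|[E ->]]; auto.
    + eauto.
    + subst i. apply Hd in H1. destruct (not_mem_self n). tauto.
    + apply Hd in H2. destruct (not_mem_self n). tauto.
  - intros y Hy. apply Hb in Hy. destruct Hy as [Hy| ->].
    + destruct (Hsur y Hy) as [i Hi]. exists i. split; [|auto].
      apply Hs. left. apply (Hd i y Hi).
    + exists n. split; [apply Hs; auto|auto].
  - intros i k y _ _ [H1|[-> ->]] [H2|[-> E]]; auto.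
    + eauto.
    + subst y. apply Hd in H1. tauto.
    + apply Hd in H2. tauto.
Qed.

(** The index of the removed point [x] receives the last value [l] instead. *)
Lemma equipotent_remove (n s a b x : A) :
  equipotent s a -> is_succ s n -> x ∈ a ->
  (forall z, z ∈ b <-> z ∈ a /\ z <> x) -> equipotent n b.
Proof.
  intros [f Hf] Hs Hx Hb. apply bijection_elim in Hf.
  destruct Hf as (Hd & Ht & Hu & Hsur & Hinj).
  assert (Hns : n ∈ s) by (apply Hs; auto).
  assert (Hin : forall i, i ∈ n -> i ∈ s /\ i <> n).
  { intros i Hi. split; [apply Hs; auto|]. intros ->. exact (not_mem_self n Hi). }
  destruct (Ht n Hns) as [l Hl].
  apply (bijection_intro (fun i y => (rel f i y /\ y <> x) \/ (rel f i x /\ y = l)));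
    [definability|..].
  - intros i Hi. destruct (Hin i Hi) as [His Hne]. destruct (Ht i His) as [y Hy].
    destruct (classic (y = x)) as [->|Hyx].
    + exists l. split; [|auto]. apply Hb. split; [apply (Hd n l Hl)|].
      intros ->. apply Hne. eauto.
    + exists y. split; [|auto]. apply Hb. split; [apply (Hd i y Hy)|exact Hyx].
  - intros i y z _ [[H1 N1]|[H1 ->]] [[H2 N2]|[H2 ->]]; eauto.
    + destruct N1. eauto.
    + destruct N2. eauto.
  - intros y Hy. apply Hb in Hy. destruct Hy as [Hy Hyx].
    destruct (classic (y = l)) as [->|Hyl].
    + destruct (Hsur x Hx) as [i Hi]. exists i. split; [|auto].
      destruct (Hd i x Hi) as [His _]. apply Hs in His. destruct His as [H| ->]; auto.
      destruct Hyx. eauto.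
    + destruct (Hsur y Hy) as [i Hi]. exists i. split; [|auto].
      destruct (Hd i y Hi) as [His _]. apply Hs in His. destruct His as [H| ->]; auto.
      destruct Hyl. eauto.
  - intros i k y Hi Hk [[H1 N1]|[H1 ->]] [[H2 N2]|[H2 E]]; eauto.
    + subst y. destruct (Hin i Hi) as [_ []]. eauto.
    + destruct (Hin k Hk) as [_ []]. eauto.
Qed.

(** ** Finite sets *)

Lemma is_finite_iff (w a : A) : is_omega w ->
  is_finite a <-> exists n, n ∈ w /\ equipotent n a.
Proof.
  intros Hw. split.
  - intros (w' & n & f & Hw' & Hn & Hf). rewrite (omega_unique w w' Hw Hw').
    exists n. split; [exact Hn|exists f; exact Hf].
  - intros (n & Hn & f & Hf). exists w, n, f. auto.
Qed.

Lemma finite_empty (a : A) : is_empty a -> is_finite a.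
Proof.
  intros Ha. destruct exists_omega as [w Hw]. apply (is_finite_iff w a Hw).
  exists a. split; [apply omega_empty; assumption|apply equipotent_empty; exact Ha].
Qed.

Lemma finite_adjoin (a b x : A) :
  is_finite a -> (forall z, z ∈ b <-> z ∈ a \/ z = x) -> is_finite b.
Proof.
  intros Ha Hb. destruct (classic (x ∈ a)) as [Hx|Hx].
  { replace b with a; [exact Ha|]. apply set_ext. intros z. rewrite Hb.
    split; [auto|]. intros [H| ->]; auto. }
  destruct exists_omega as [w Hw]. apply (is_finite_iff w a Hw) in Ha.
  apply (is_finite_iff w b Hw). destruct Ha as (n & Hn & E).
  destruct (exists_succ n) as [s Hs]. exists s. split.
  - exact (omega_succ w Hw n s Hn Hs).
  - exact (equipotent_adjoin n s a b x E Hs Hx Hb).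
Qed.

Lemma finite_ind (P : A -> Prop) :
  definable (fun e => P (e 0)) ->
  (forall a, is_empty a -> P a) ->
  (forall a b x, P a -> x ∉ a -> (forall z, z ∈ b <-> z ∈ a \/ z = x) -> P b) ->
  forall a, is_finite a -> P a.
Proof.
  intros HP H0 HS a Ha. destruct exists_omega as [w Hw].
  apply (is_finite_iff w a Hw) in Ha. destruct Ha as (n & Hn & E).
  revert a E.
  apply (omega_ind w Hw (fun n => forall a, equipotent n a -> P a));
    [definability| | |exact Hn].
  - intros o Ho a E. apply H0. exact (equipotent_empty_inv o a E Ho).
  - intros k s Hk IH Hs a E.
    assert (Hx : exists x, x ∈ a).
    { destruct E as [f Hf]. apply bijection_elim in Hf.
      destruct Hf as (Hd & Ht & _). destruct (Ht k) as [x Hx]; [apply Hs; auto|].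
      exists x. apply (Hd k x Hx). }
    destruct Hx as [x Hx].
    destruct (separation (fun z => z <> x) a) as [a' Ha']; [definability|].
    apply (HS a' a x).
    + apply IH. exact (equipotent_remove k s a a' x E Hs Hx Ha').
    + rewrite Ha'. tauto.
    + intros z. rewrite Ha'. split; [|intros [H| ->]; tauto].
      intros Hz. destruct (classic (z = x)); tauto.
Qed.

Lemma finite_subset (a b : A) : is_finite a -> subset b a -> is_finite b.
Proof.
  intros Ha. revert b.
  apply (finite_ind (fun a => forall b, subset b a -> is_finite b));
    [definability| | |exact Ha].
  - intros o Ho b Hb. apply finite_empty. intros z Hz. exact (Ho z (Hb z Hz)).
  - intros c d x IH Hx Hd b Hb.
    destruct (separation (fun z => z <> x) b) as [b' Hb']; [definability|].
    assert (F : is_finite b').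
    { apply IH. intros z Hz. apply Hb' in Hz. destruct Hz as [Hz N].
      apply Hb, Hd in Hz. tauto. }
    destruct (classic (x ∈ b)) as [H|H].
    + apply (finite_adjoin b' b x F). intros z. rewrite Hb'.
      destruct (classic (z = x)) as [->|]; tauto.
    + replace b with b'; [exact F|]. apply set_ext. intros z. rewrite Hb'.
      split; [tauto|]. intros Hz. split; [exact Hz|]. intros ->. tauto.
Qed.

(** By induction on the domain rather than by composing bijections, since the image
    map need not be injective. *)
Lemma finite_image (Q : A -> A -> Prop) (a b : A) :
  definable (fun e => Q (e 0) (e 1)) ->
  (forall x y z, Q x y -> Q x z -> y = z) ->
  is_finite a -> (forall y, y ∈ b -> exists x, x ∈ a /\ Q x y) -> is_finite b.
Proof.
  intros HQ Hfun Ha. revert b.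
  apply (finite_ind (fun a => forall b,
    (forall y, y ∈ b -> exists x, x ∈ a /\ Q x y) -> is_finite b));
    [definability| | |exact Ha].
  - intros o Ho b Hb. apply finite_empty. intros z Hz.
    destruct (Hb z Hz) as (x & Hx & _). exact (Ho x Hx).
  - intros c d x IH Hx Hd b Hb.
    destruct (separation (fun y => exists x, x ∈ c /\ Q x y) b) as [b' Hb'];
      [definability|].
    assert (F : is_finite b') by (apply IH; intros y Hy; apply Hb' in Hy; tauto).
    destruct (classic (exists y, Q x y)) as [[y Hy]|N].
    + destruct (exists_adjoin b' y) as [b'' Hb''].
      apply (finite_subset b''); [exact (finite_adjoin b' b'' y F Hb'')|].
      intros z Hz. apply Hb''. destruct (Hb z Hz) as (t & Ht & HQt).
      apply Hd in Ht. destruct Ht as [Ht| ->]; [|right; eauto].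
      left. apply Hb'. eauto.
    + apply (finite_subset b' b F). intros z Hz. apply Hb'. split; [exact Hz|].
      destruct (Hb z Hz) as (t & Ht & HQt). apply Hd in Ht.
      destruct Ht as [Ht| ->]; [eauto|]. destruct N. eauto.
Qed.

Lemma finite_union2 (a b c : A) : is_finite a -> is_finite b ->
  (forall z, z ∈ c <-> z ∈ a \/ z ∈ b) -> is_finite c.
Proof.
  intros Ha Hb. revert c.
  apply (finite_ind (fun b => forall c, (forall z, z ∈ c <-> z ∈ a \/ z ∈ b) ->
    is_finite c)); [definability| | |exact Hb].
  - intros o Ho c Hc. replace c with a; [exact Ha|]. apply set_ext. intros z.
    rewrite Hc. split; [auto|]. intros [H|H]; [auto|]. destruct (Ho z H).
  - intros d d' x IH _ Hd' c Hc. destruct (exists_union2 a d) as [u Hu].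
    apply (finite_adjoin u c x (IH u Hu)). intros z. rewrite Hc, Hd', Hu. tauto.
Qed.

(** The pigeonhole principle.  It is what makes a family infinite once it has
    subfamilies of every finite size. *)
Lemma equipotent_subset_le (w n m a b : A) : is_omega w -> n ∈ w -> m ∈ w ->
  equipotent n a -> equipotent m b -> subset b a -> m ∈ n \/ m = n.
Proof.
  intros Hw Hn. revert m a b.
  apply (omega_ind w Hw (fun n => forall m a b, m ∈ w -> equipotent n a ->
    equipotent m b -> subset b a -> m ∈ n \/ m = n)); [definability| | |exact Hn].
  - intros o Ho m a b Hm Ea Eb Hba. right.
    apply empty_unique; [|exact Ho].
    intros i Hi. destruct Eb as [f Hf]. apply bijection_elim in Hf.
    destruct Hf as (Hd & Ht & _). destruct (Ht i Hi) as [y Hy].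
    apply Hd in Hy. apply (equipotent_empty_inv o a Ea Ho y). apply Hba. tauto.
  - intros k s Hk IH Hs m a b Hm Ea Eb Hba.
    destruct (omega_cases w Hw m Hm) as [Hm0|(l & Hl & Hml)].
    + apply (omega_empty_le w Hw); [exact (omega_succ w Hw k s Hk Hs)|exact Hm0].
    + assert (Hx : exists x, x ∈ b).
      { destruct Eb as [f Hf]. apply bijection_elim in Hf.
        destruct Hf as (Hd & Ht & _). destruct (Ht l) as [x Hx]; [apply Hml; auto|].
        exists x. apply (Hd l x Hx). }
      destruct Hx as [x Hx].
      destruct (separation (fun z => z <> x) a) as [a' Ha']; [definability|].
      destruct (separation (fun z => z <> x) b) as [b' Hb']; [definability|].
      destruct (IH l a' b') as [H| ->]; auto.
      * exact (equipotent_remove k s a a' x Ea Hs (Hba x Hx) Ha').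
      * exact (equipotent_remove l m b b' x Eb Hml Hx Hb').
      * intros z Hz. apply Hb' in Hz. apply Ha'. split; [apply Hba|]; tauto.
      * left. apply Hs. exact (omega_succ_le w Hw k l m Hk H Hml).
      * right. exact (succ_unique m s k Hml Hs).
Qed.

End Omega.

(** * Choice and maximal elements *)

Definition is_chain {A : set_structure} (c : A) : Prop :=
  forall x y, x ∈ c -> y ∈ c -> subset x y \/ subset y x.

#[global] Hint Unfold is_chain : definable_unfold.

Section Choice.
Context {A : set_structure} {HA : ZFC A}.

(** The axiom of choice provides a transversal of a disjoint family, so it is
    applied to the slices of the graph of [Q], which are disjoint. *)
Lemma choice_function (Q : A -> A -> Prop) (a b : A) :
  definable (fun e => Q (e 0) (e 1)) ->
  (forall x, x ∈ a -> exists y, y ∈ b /\ Q x y) ->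
  exists f, is_function_on f a /\ forall x y, rel f x y -> y ∈ b /\ Q x y.
Proof.
  intros HQ Htot.
  pose (slice := fun x g => forall p, p ∈ g <-> exists y, y ∈ b /\ Q x y /\ p = opair x y).
  assert (Hslice : forall x, x ∈ a -> exists g, slice x g).
  { intros x Hx. destruct (exists_product a b) as [c Hc].
    destruct (separation (fun p => exists y, Q x y /\ p = opair x y) c) as [g Hg];
      [definability|].
    exists g. intros p. rewrite Hg, Hc. split.
    - intros [(x' & y' & Hx' & Hy' & ->) (y & HQy & E)].
      apply opair_inj in E. destruct E as [-> ->]. eauto.
    - intros (y & Hy & HQy & ->). split; eauto. }
  destruct (replacement slice a) as [G HG].
  { unfold slice. definability. }
  { intros x y z _ Hy Hz. apply set_ext. intros p. rewrite (Hy p), (Hz p). tauto. }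
  destruct (zfc_choice A HA G) as [c Hc].
  - intros g Hg. apply HG in Hg. destruct Hg as (x & Hx & Hg).
    destruct (Htot x Hx) as (y & Hy & HQy). exists (opair x y). apply Hg. eauto.
  - intros g h p Hg Hh Hpg Hph. apply HG in Hg. apply HG in Hh.
    destruct Hg as (x & Hx & Hg). destruct Hh as (x' & Hx' & Hh).
    pose proof (proj1 (Hg p) Hpg) as (y & _ & _ & E).
    pose proof (proj1 (Hh p) Hph) as (y' & _ & _ & E').
    rewrite E in E'. apply opair_inj in E'. destruct E' as [<- _].
    apply set_ext. intros q. rewrite (Hg q), (Hh q). tauto.
  - assert (K : forall x, x ∈ a -> exists y, (y ∈ b /\ Q x y /\ opair x y ∈ c) /\
      forall y', y' ∈ b -> Q x y' -> opair x y' ∈ c -> y' = y).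
    { intros x Hx. destruct (Hslice x Hx) as [g Hg].
      destruct (Hc g) as (p & [Hpc Hpg] & Hp); [apply HG; eauto|].
      apply Hg in Hpg. destruct Hpg as (y & Hy & HQy & ->). exists y.
      split; [auto|]. intros y' Hy' HQy' Hc'.
      assert (E : opair x y = opair x y') by (apply Hp; split; [exact Hc'|apply Hg; eauto]).
      apply opair_inj in E. symmetry. tauto. }
    destruct (exists_function (fun x y => y ∈ b /\ Q x y /\ opair x y ∈ c) a b)
      as (f & Hf & Hr); [definability|..].
    + intros x Hx. destruct (K x Hx) as (y & Hy & _). exists y. tauto.
    + intros x y z Hx Hy Hz. destruct (K x Hx) as (u & _ & Hu).
      rewrite (Hu y), (Hu z); tauto.
    + exists f. split; [exact Hf|]. intros x y H. apply Hr in H. tauto.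
Qed.

(** Zorn's lemma for families of sets, proved with the Bourbaki-Witt tower of a
    function choosing a strictly larger member. *)
Lemma zorn (F x0 : A) :
  x0 ∈ F ->
  (forall c u, subset c F -> (exists x, x ∈ c) -> is_chain c -> is_union u c ->
     u ∈ F) ->
  exists m, m ∈ F /\ subset x0 m /\ forall y, y ∈ F -> subset m y -> y = m.
Proof.
  intros Hx0 Hchain. apply NNPP. intros Hno.
  assert (sub_antisym : forall x y : A, subset x y -> subset y x -> x = y).
  { intros x y H1 H2. apply set_ext. firstorder. }
  destruct (separation (fun y => subset x0 y) F) as [F' HF']; [definability|].
  destruct (choice_function (fun x y => subset x y /\ y <> x) F' F') as (f & Hf & Hfr);
    [definability|..].
  { intros x Hx. apply HF' in Hx. apply NNPP. intros Hn. apply Hno.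
    exists x. split; [tauto|split; [tauto|]]. intros y Hy Hxy.
    apply NNPP. intros Hne. apply Hn. exists y. split; [|auto].
    apply HF'. split; [exact Hy|]. intros z Hz. apply Hxy. apply Hx, Hz. }
  pose (tower := fun Z => subset Z F' /\ x0 ∈ Z /\
    (forall x y, x ∈ Z -> rel f x y -> y ∈ Z) /\
    (forall c u, subset c Z -> (exists x, x ∈ c) -> is_chain c -> is_union u c -> u ∈ Z)).
  assert (HT : definable (fun e => tower (e 0))) by (unfold tower; definability).
  pose proof (fun Y (HY : tower Y) => proj1 (proj2 (proj2 HY))) as tower_step.
  pose proof (fun Y (HY : tower Y) => proj2 (proj2 (proj2 HY))) as tower_union.
  destruct (separation (fun x => forall Z, tower Z -> x ∈ Z) F') as [Z HZ];
    [definability|].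
  assert (HtF : tower F').
  { split; [intros x; auto|]. split.
    - apply HF'. split; [exact Hx0|intros z; auto].
    - split.
      + intros x y _ H. apply (Hfr x y H).
      + intros c u Hc [x Hx] Hch Hu. apply HF'. split.
        * apply (Hchain c u); eauto. intros z Hz. apply Hc, HF' in Hz. tauto.
        * intros z Hz. apply Hu. exists x. split; [exact Hx|].
          apply Hc, HF' in Hx. apply Hx, Hz. }
  assert (Hmin : forall Y, tower Y -> subset Z Y).
  { intros Y HY x Hx. apply HZ in Hx. apply Hx, HY. }
  assert (HtZ : tower Z).
  { split; [intros x Hx; apply HZ in Hx; tauto|]. split.
    - apply HZ. split; [apply HtF|]. intros Y HY. apply HY.
    - split.
      + intros x y Hx Hxy. apply HZ. split; [apply (Hfr x y Hxy)|].
        intros Y HY. apply (tower_step Y HY x y (Hmin Y HY x Hx) Hxy).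
      + intros c u Hc Hne Hch Hu. apply HZ. split.
        * apply (tower_union F' HtF c); auto. intros x Hx. apply Hc, HZ in Hx. tauto.
        * intros Y HY. apply (tower_union Y HY c); auto.
          intros x Hx. apply (Hmin Y HY), Hc, Hx. }
  assert (ind : forall P : A -> Prop, definable (fun e => P (e 0)) -> P x0 ->
    (forall x y, x ∈ Z -> P x -> rel f x y -> P y) ->
    (forall c u, subset c Z -> (forall x, x ∈ c -> P x) -> (exists x, x ∈ c) ->
       is_union u c -> u ∈ Z -> P u) ->
    forall x, x ∈ Z -> P x).
  { intros P HP H0 HS HU x Hx. destruct (separation P Z HP) as [Y HY].
    assert (HtY : tower Y).
    { split; [intros z Hz; apply HY in Hz; apply HtZ; tauto|]. split.
      - apply HY. split; [apply HtZ|exact H0].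
      - split.
        + intros y z Hy Hyz. apply HY in Hy. apply HY. split.
          * apply (tower_step Z HtZ y z); tauto.
          * apply (HS y z); tauto.
        + intros c u Hc Hne Hch Hu.
          assert (Hc' : subset c Z) by (intros z Hz; apply Hc, HY in Hz; tauto).
          assert (u ∈ Z) by (apply (tower_union Z HtZ c); auto).
          apply HY. split; [assumption|]. apply (HU c u); auto.
          intros z Hz. apply Hc, HY in Hz. tauto. }
    apply (Hmin Y HtY), HY in Hx. tauto. }
  assert (Hbot : forall x, x ∈ Z -> subset x0 x).
  { intros x Hx. apply HZ in Hx. destruct Hx as [Hx _]. apply HF' in Hx. tauto. }
  assert (Hf_ex : forall x, x ∈ Z -> exists y, rel f x y /\ y ∈ Z /\ subset x y /\ y <> x).
  { intros x Hx. destruct (function_on_total f F' x Hf) as [y Hy]; [apply HtZ, Hx|].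
    exists y. split; [exact Hy|]. split; [apply (tower_step Z HtZ x y Hx Hy)|].
    apply (Hfr x y Hy). }
  assert (Hf_un : forall x y z, rel f x y -> rel f x z -> y = z).
  { intros x y z. apply (function_on_unique f F' x y z Hf). }
  (* Every member of the tower is extreme: everything strictly below it stays
     below it after one more step.  This makes the tower a chain. *)
  pose (extreme := fun c => forall x y, x ∈ Z -> subset x c -> x <> c ->
    rel f x y -> subset y c).
  assert (HD : definable (fun e => extreme (e 0))) by (unfold extreme; definability).
  assert (Hext : forall c fc, c ∈ Z -> extreme c -> rel f c fc ->
    forall x, x ∈ Z -> subset x c \/ subset fc x).
  { intros c fc Hc Hec Hfc. apply ind; [definability|..].
    - left. apply Hbot, Hc.
    - intros x y Hx [H|H] Hxy.
      + destruct (classic (x = c)) as [->|Hne].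
        * right. rewrite (Hf_un c y fc Hxy Hfc). intros z; auto.
        * left. apply (Hec x y); auto.
      + right. intros z Hz. apply (Hfr x y Hxy). apply H, Hz.
    - intros d u Hd Hall _ Hu _.
      destruct (classic (exists x, x ∈ d /\ subset fc x)) as [(x & Hx & H)|N].
      + right. intros z Hz. apply Hu. exists x. auto.
      + left. intros z Hz. apply Hu in Hz. destruct Hz as (x & Hx & Hz).
        destruct (Hall x Hx) as [H|H]; [apply H, Hz|]. destruct N. eauto. }
  assert (all_extreme : forall c, c ∈ Z -> extreme c).
  { apply ind; [exact HD|..].
    - intros x y Hx H Hne _. destruct Hne. apply sub_antisym; auto.
    - intros c fc Hc Hec Hfc x y Hx Hxf Hne Hxy.
      destruct (Hext c fc Hc Hec Hfc x Hx) as [H|H].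
      + destruct (classic (x = c)) as [->|Hne'].
        * rewrite (Hf_un c y fc Hxy Hfc). intros z; auto.
        * intros z Hz. apply (Hfr c fc Hfc). apply (Hec x y); auto.
      + destruct Hne. apply sub_antisym; auto.
    - intros d u Hd Hall Hne Hu HuZ x y Hx Hxu Hxne Hxy.
      assert (Hc : exists c, c ∈ d /\ subset x c).
      { apply NNPP. intros N. apply Hxne. apply sub_antisym; [exact Hxu|].
        intros z Hz. apply Hu in Hz. destruct Hz as (c & Hc & Hz).
        destruct (Hf_ex c (Hd c Hc)) as (fc & Hfc & _ & Hsub & _).
        destruct (Hext c fc (Hd c Hc) (Hall c Hc) Hfc x Hx) as [H|H].
        - destruct N. eauto.
        - apply H, Hsub, Hz. }
      destruct Hc as (c & Hc & Hxc).
      destruct (classic (x = c)) as [->|Hne'].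
      + destruct (Hext c y Hx (Hall c Hc) Hxy u HuZ) as [H|H]; [|exact H].
        destruct Hxne. apply sub_antisym; auto.
      + intros z Hz. apply Hu. exists c. split; [exact Hc|].
        apply (Hall c Hc x y); auto. }
  destruct (zfc_union A HA Z) as [u Hu].
  assert (HuZ : u ∈ Z).
  { apply (tower_union Z HtZ Z); auto.
    - exists x0. apply HtZ.
    - intros x y Hx Hy. destruct (Hf_ex x Hx) as (fx & Hfx & _ & Hsub & _).
      destruct (Hext x fx Hx (all_extreme x Hx) Hfx y Hy) as [H|H]; [auto|].
      left. intros z Hz. apply H, Hsub, Hz. }
  destruct (Hf_ex u HuZ) as (y & _ & HyZ & Hsub & Hne).
  apply Hne, sub_antisym; [|exact Hsub].
  intros z Hz. apply Hu. exists y. auto.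
Qed.

End Choice.

(** * Ranks of well-founded relations *)

Section Rank.
Context {A : set_structure} {HA : ZFC A}.
Context (T : A) (lt : A -> A -> Prop).
Context (lt_definable : definable (fun e => lt (e 0) (e 1))).
Context (lt_wf : forall S, subset S T -> (exists x, x ∈ S) ->
  exists x, x ∈ S /\ forall y, y ∈ S -> ~ lt y x).

(** A partial collapse: its domain is closed downwards and the value at [t] is the
    set of the values below [t]. *)
Definition rank_approximation (f : A) : Prop :=
  forall t v, rel f t v -> t ∈ T /\
    (forall z, z ∈ v <-> exists s, s ∈ T /\ lt s t /\ rel f s z) /\
    (forall s, s ∈ T -> lt s t -> exists z, rel f s z).

Lemma rank_approximation_definable :
  definable (fun e => rank_approximation (e 0)).
Proof. unfold rank_approximation. definability. Qed.

Lemma lt_induction (P : A -> Prop) : definable (fun e => P (e 0)) ->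
  (forall t, t ∈ T -> (forall s, s ∈ T -> lt s t -> P s) -> P t) ->
  forall t, t ∈ T -> P t.
Proof.
  intros HP HS t Ht. apply NNPP. intros Hn.
  destruct (separation (fun x => ~ P x) T) as [S HSd]; [definability|].
  destruct (lt_wf S) as (x & Hx & Hm).
  - intros z Hz. apply HSd in Hz. tauto.
  - exists t. apply HSd. auto.
  - apply HSd in Hx. apply Hx. apply HS; [tauto|].
    intros s Hs Hlt. apply NNPP. intros Hps. apply (Hm s); [|exact Hlt].
    apply HSd. auto.
Qed.

Lemma rank_approximation_unique f g t v u :
  rank_approximation f -> rank_approximation g ->
  rel f t v -> rel g t u -> v = u.
Proof.
  intros Hf Hg Hv Hu. assert (Ht : t ∈ T) by apply (Hf t v Hv).
  revert v u Hv Hu.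
  apply (lt_induction (fun t => forall v u, rel f t v -> rel g t u -> v = u));
    [definability| |exact Ht].
  clear t Ht. intros t Ht IH v u Hv Hu. apply set_ext. intros z.
  destruct (Hf t v Hv) as (_ & Hfv & Hfex).
  destruct (Hg t u Hu) as (_ & Hgu & Hgex).
  rewrite Hfv, Hgu. split.
  - intros (s & Hs & Hlt & Hz). exists s. split; [|split]; auto.
    destruct (Hgex s Hs Hlt) as [z' Hz']. rewrite (IH s Hs Hlt z z' Hz Hz'). exact Hz'.
  - intros (s & Hs & Hlt & Hz). exists s. split; [|split]; auto.
    destruct (Hfex s Hs Hlt) as [z' Hz']. rewrite <- (IH s Hs Hlt z' z Hz' Hz). exact Hz'.
Qed.

(** The Mostowski collapse of a well-founded relation.  It exists as a set of
    the model, which is what makes well-foundedness pass to larger models. *)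
Lemma exists_rank : exists F,
  (forall t, t ∈ T -> exists v, rel F t v) /\
  (forall s t u v, s ∈ T -> lt s t -> rel F s u -> rel F t v -> u ∈ v).
Proof.
  pose proof rank_approximation_definable as HD.
  pose (value := fun t v => exists f, rank_approximation f /\ rel f t v).
  assert (HV : definable (fun e => value (e 0) (e 1))) by (unfold value; definability).
  assert (Hval : forall t v u, value t v -> value t u -> v = u).
  { intros t v u (f & Hf & H1) (g & Hg & H2).
    exact (rank_approximation_unique f g t v u Hf Hg H1 H2). }
  destruct (replacement (fun t p => exists v, value t v /\ p = opair t v) T)
    as [F HF]; [definability|..].
  { intros t p q _ (v & Hv & ->) (u & Hu & ->). rewrite (Hval t v u Hv Hu). reflexivity. }
  assert (HFr : forall t v, rel F t v <-> t ∈ T /\ value t v).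
  { intros t v. rewrite rel_iff, HF. split.
    - intros (x & Hx & y & Hy & E). apply opair_inj in E.
      destruct E as [-> ->]. auto.
    - intros [Ht Hv]. exists t. split; [exact Ht|]. exists v. auto. }
  assert (Hap : rank_approximation F).
  { intros t v Hv. apply HFr in Hv. destruct Hv as [Ht (f & Hf & Hv)].
    destruct (Hf t v Hv) as (_ & H1 & H2). split; [exact Ht|]. split.
    - intros z. rewrite H1. split.
      + intros (s & Hs & Hlt & Hz). exists s. split; [|split]; auto.
        apply HFr. split; [exact Hs|]. exists f. auto.
      + intros (s & Hs & Hlt & Hz). exists s. split; [|split]; auto.
        apply HFr in Hz. destruct Hz as [_ Hz].
        destruct (H2 s Hs Hlt) as [z' Hz'].
        assert (value s z') by (exists f; auto).
        rewrite (Hval s z z'); auto.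
    - intros s Hs Hlt. destruct (H2 s Hs Hlt) as [z Hz]. exists z.
      apply HFr. split; [exact Hs|]. exists f. auto. }
  assert (Htot : forall t, t ∈ T -> exists v, rel F t v).
  { apply lt_induction; [definability|].
    intros t Ht IH. apply NNPP. intros Hn.
    destruct (exists_range F) as [r Hr].
    destruct (separation (fun z => exists s, s ∈ T /\ lt s t /\ rel F s z) r)
      as [v Hv]; [definability|].
    (* If all points below [t] have a value, so has [t]. *)
    destruct (exists_adjoin F (opair t v)) as [G HG].
    assert (HGr : forall s u, rel G s u <-> rel F s u \/ (s = t /\ u = v)).
    { intros s u. rewrite !rel_iff, HG. split; intros [H|H]; auto.
      - right. apply opair_inj, H.
      - destruct H as [-> ->]. auto. }
    assert (Htt : ~ lt t t).
    { intros H. destruct (exists_singleton t) as [S HS].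
      destruct (lt_wf S) as (x & Hx & Hm).
      - intros z Hz. apply HS in Hz. subst z. exact Ht.
      - exists t. apply HS. reflexivity.
      - apply HS in Hx. subst x. apply (Hm t); [apply HS; reflexivity|exact H]. }
    apply Hn. exists v. apply HFr. split; [exact Ht|].
    exists G. split; [|apply HGr; auto].
    intros s u Hs. apply HGr in Hs. destruct Hs as [Hs|[-> ->]].
    - destruct (Hap s u Hs) as (HsT & H1 & H2). split; [exact HsT|]. split.
      + intros z. rewrite H1. split.
        * intros (x & Hx & Hlt & Hz). exists x. rewrite HGr. auto.
        * intros (x & Hx & Hlt & Hz). exists x. apply HGr in Hz.
          destruct Hz as [Hz|[-> ->]]; [auto|]. destruct Hn. apply (H2 t Hx Hlt).
      + intros x Hx Hlt. destruct (H2 x Hx Hlt) as [z Hz]. exists z.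
        apply HGr. auto.
    - split; [exact Ht|]. split.
      + intros z. rewrite Hv, Hr. split.
        * intros [_ (s & Hs & Hlt & Hz)]. exists s. rewrite HGr. auto.
        * intros (s & Hs & Hlt & Hz). apply HGr in Hz.
          destruct Hz as [Hz|[-> _]]; [|tauto].
          split; [eauto|]. exists s. auto.
      + intros s Hs Hlt. destruct (IH s Hs Hlt) as [z Hz]. exists z.
        apply HGr. auto. }
  exists F. split; [exact Htot|].
  intros s t u v Hs Hlt Hu Hv. apply (Hap t v Hv). exists s. auto.
Qed.

End Rank.

(** * Compact Hausdorff spaces in a model *)

Definition disjoint {A : set_structure} (x y : A) : Prop :=
  forall z, ~ (z ∈ x /\ z ∈ y).

#[global] Hint Unfold disjoint : definable_unfold.

Section Compact.
Context {A : set_structure} {HA : ZFC A}.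
Context (P T : A) (HPT : is_compact_top P T).

Lemma open_subset U : U ∈ T -> subset U P.
Proof. apply HPT. Qed.

Lemma open_empty o : is_empty o -> o ∈ T.
Proof. apply HPT. Qed.

Lemma open_full : P ∈ T.
Proof. apply HPT. Qed.

Lemma open_inter U V W : U ∈ T -> V ∈ T -> is_inter W U V -> W ∈ T.
Proof. apply HPT. Qed.

Lemma open_union F U : subset F T -> is_union U F -> U ∈ T.
Proof. apply HPT. Qed.

Lemma open_union2 U V W :
  U ∈ T -> V ∈ T -> (forall z, z ∈ W <-> z ∈ U \/ z ∈ V) -> W ∈ T.
Proof.
  intros HU HV HW. destruct (zfc_pairing A HA U V) as [F HF].
  apply (open_union F).
  - intros x Hx. apply HF in Hx. destruct Hx as [-> | ->]; assumption.
  - intros z. rewrite HW. split.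
    + intros [H|H]; [exists U|exists V]; rewrite (HF _); auto.
    + intros (y & Hy & Hz). apply HF in Hy. destruct Hy as [-> | ->]; auto.
Qed.

Lemma closed_intro C U :
  subset C P -> U ∈ T -> (forall z, z ∈ P -> z ∈ U <-> z ∉ C) -> is_closed P T C.
Proof.
  intros HC HU H. split; [exact HC|]. exists U. split; [|exact HU].
  intros z. split.
  - intros Hz. assert (z ∈ P) by (apply (open_subset U HU z Hz)).
    split; [assumption|]. apply H; assumption.
  - intros [Hz Hn]. apply H; assumption.
Qed.

Lemma compl_closed U C : U ∈ T -> is_diff C P U -> is_closed P T C.
Proof.
  intros HU HC. apply (closed_intro C U); [|exact HU|].
  - intros z Hz. apply HC in Hz. tauto.
  - intros z Hz. rewrite (HC z). tauto.
Qed.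

Lemma closed_exists_compl C : is_closed P T C -> exists U, U ∈ T /\ is_diff U P C.
Proof. intros [_ (U & HU & H)]. eauto. Qed.

Lemma closed_full : is_closed P T P.
Proof.
  destruct exists_empty as [o Ho].
  apply (closed_intro P o); [intros z; auto|apply open_empty, Ho|].
  intros z Hz. split; [|tauto]. intros H. destruct (Ho z H).
Qed.

Lemma closed_empty o : is_empty o -> is_closed P T o.
Proof.
  intros Ho. apply (closed_intro o P); [|apply open_full|].
  - intros z Hz. destruct (Ho z Hz).
  - intros z Hz. split; auto.
Qed.

Lemma closed_inter2 C D E :
  is_closed P T C -> is_closed P T D -> is_inter E C D -> is_closed P T E.
Proof.
  intros HC HD HE.
  destruct (closed_exists_compl C HC) as (U & HU & HUC).
  destruct (closed_exists_compl D HD) as (V & HV & HVD).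
  destruct (exists_union2 U V) as [W HW].
  apply (closed_intro E W).
  - intros z Hz. apply HE in Hz. apply HC. tauto.
  - exact (open_union2 U V W HU HV HW).
  - intros z Hz. rewrite HW, (HUC z), (HVD z), (HE z). tauto.
Qed.

Lemma closed_union2 C D E :
  is_closed P T C -> is_closed P T D -> (forall z, z ∈ E <-> z ∈ C \/ z ∈ D) ->
  is_closed P T E.
Proof.
  intros HC HD HE.
  destruct (closed_exists_compl C HC) as (U & HU & HUC).
  destruct (closed_exists_compl D HD) as (V & HV & HVD).
  destruct (exists_inter U V) as [W HW].
  apply (closed_intro E W).
  - intros z Hz. apply HE in Hz. destruct Hz as [Hz|Hz]; [apply HC|apply HD]; exact Hz.
  - exact (open_inter U V W HU HV HW).
  - intros z Hz. rewrite (HW z), (HUC z), (HVD z), HE. tauto.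
Qed.

Lemma closed_avoiding F C : subset F T ->
  (forall z, z ∈ C <-> z ∈ P /\ forall V, V ∈ F -> z ∉ V) -> is_closed P T C.
Proof.
  intros HF HC. destruct (zfc_union A HA F) as [U HU].
  apply (closed_intro C U).
  - intros z Hz. apply HC in Hz. tauto.
  - exact (open_union F U HF HU).
  - intros z Hz. rewrite (HU z), HC. split.
    + intros (V & HV & HzV) [_ H]. exact (H V HV HzV).
    + intros H. apply NNPP. intros N. apply H. split; [exact Hz|].
      intros V HV HzV. apply N. eauto.
Qed.

(** Compactness as an induction principle: an ideal-like property that holds
    locally on a closed set holds for an open neighbourhood of it. *)
Lemma compact_ind (Q : A -> Prop) K :
  definable (fun e => Q (e 0)) ->
  (forall o, is_empty o -> Q o) ->
  (forall U V W, Q U -> Q V -> (forall z, z ∈ W <-> z ∈ U \/ z ∈ V) -> Q W) ->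
  is_closed P T K ->
  (forall x, x ∈ K -> exists U, U ∈ T /\ x ∈ U /\ Q U) ->
  exists U, U ∈ T /\ Q U /\ subset K U.
Proof.
  intros HQ H0 HU HK Hloc.
  destruct exists_empty as [o Ho].
  (* Away from [K] nothing is asked, so the complement of [K] completes the cover. *)
  destruct (separation (fun U => exists V, V ∈ T /\ Q V /\
    forall z, z ∈ U -> z ∈ K -> z ∈ V) T) as [F HF]; [definability|].
  assert (HPF : is_union P F).
  { intros x. split.
    - intros Hx. destruct (classic (x ∈ K)) as [HxK|HxK].
      + destruct (Hloc x HxK) as (U & HUT & HxU & HQU). exists U.
        split; [|exact HxU]. apply HF. split; [exact HUT|]. exists U. auto.
      + destruct (closed_exists_compl K HK) as (U & HUT & HUK). exists U.
        split; [|apply HUK; auto]. apply HF. split; [exact HUT|].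
        exists o. split; [apply open_empty, Ho|]. split; [apply H0, Ho|].
        intros z Hz. apply HUK in Hz. tauto.
    - intros (U & HUF & Hx). apply HF in HUF. apply (open_subset U); tauto. }
  destruct (proj2 (proj2 HPT) F) as (G & HGF & HGfin & HPG).
  { intros x Hx. apply HF in Hx. tauto. }
  { exact HPF. }
  assert (Hfin : subset G F -> exists V, V ∈ T /\ Q V /\
    forall z, z ∈ K -> (exists U, U ∈ G /\ z ∈ U) -> z ∈ V).
  { apply (finite_ind (fun G => subset G F -> exists V, V ∈ T /\ Q V /\
      forall z, z ∈ K -> (exists U, U ∈ G /\ z ∈ U) -> z ∈ V));
      [definability|..|exact HGfin].
    - intros g Hg _. exists o. split; [apply open_empty, Ho|].
      split; [apply H0, Ho|]. intros z _ (U & HUg & _). destruct (Hg U HUg).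
    - intros g h U IH _ Hh Hsub.
      destruct IH as (V & HVT & HQV & HV).
      { intros x Hx. apply Hsub, Hh. auto. }
      assert (HUF : U ∈ F) by (apply Hsub, Hh; auto).
      apply HF in HUF. destruct HUF as (HUT & V' & HVT' & HQV' & HV').
      destruct (exists_union2 V V') as [W HW]. exists W.
      split; [exact (open_union2 V V' W HVT HVT' HW)|].
      split; [exact (HU V V' W HQV HQV' HW)|].
      intros z Hz (X & HX & HzX). apply HW. apply Hh in HX.
      destruct HX as [HX| ->]; [left; apply HV; eauto|right; auto]. }
  destruct (Hfin HGF) as (V & HVT & HQV & HV). exists V.
  split; [exact HVT|]. split; [exact HQV|].
  intros z Hz. apply HV; [exact Hz|]. apply HPG. apply HK, Hz.
Qed.

(** Induction over [K]: the sets [V] that can be separated from [y] by an open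
    neighbourhood of [y]. *)
Lemma compact_regular y K : y ∈ P -> y ∉ K -> is_closed P T K ->
  exists U V, U ∈ T /\ V ∈ T /\ y ∈ U /\ subset K V /\ disjoint U V.
Proof.
  intros Hy HyK HK.
  destruct (compact_ind (fun V => exists U, U ∈ T /\ y ∈ U /\ disjoint U V) K)
    as (V & HVT & (U & HUT & HyU & Hd) & HKV); [definability|..].
  - intros o Ho. exists P. split; [apply open_full|]. split; [exact Hy|].
    intros z [_ Hz]. exact (Ho z Hz).
  - intros V V' W (U & HU & HyU & Hd) (U' & HU' & HyU' & Hd') HW.
    destruct (exists_inter U U') as [X HX]. exists X.
    split; [exact (open_inter U U' X HU HU' HX)|]. split; [apply HX; auto|].
    intros z [Hz HzW]. apply HX in Hz. apply HW in HzW.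
    destruct HzW as [H|H]; [apply (Hd z)|apply (Hd' z)]; tauto.
  - exact HK.
  - intros x Hx. assert (HxP : x ∈ P) by apply HK, Hx.
    destruct (proj1 (proj2 HPT) y x Hy HxP) as (U & V & HU & HV & HyU & HxV & Hd).
    { intros ->. tauto. }
    exists V. split; [exact HV|]. split; [exact HxV|]. exists U. auto.
  - exists U, V. auto.
Qed.

Lemma compact_normal C K : is_closed P T C -> is_closed P T K -> disjoint C K ->
  exists U V, U ∈ T /\ V ∈ T /\ subset C U /\ subset K V /\ disjoint U V.
Proof.
  intros HC HK Hdis.
  destruct (compact_ind (fun V => exists U, U ∈ T /\ subset C U /\ disjoint U V) K)
    as (V & HVT & (U & HUT & HCU & Hd) & HKV); [definability|..].
  - intros o Ho. exists P. split; [apply open_full|]. split; [apply HC|].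
    intros z [_ Hz]. exact (Ho z Hz).
  - intros V V' W (U & HU & HCU & Hd) (U' & HU' & HCU' & Hd') HW.
    destruct (exists_inter U U') as [X HX]. exists X.
    split; [exact (open_inter U U' X HU HU' HX)|]. split.
    { intros z Hz. apply HX; auto. }
    intros z [Hz HzW]. apply HX in Hz. apply HW in HzW.
    destruct HzW as [H|H]; [apply (Hd z)|apply (Hd' z)]; tauto.
  - exact HK.
  - intros x Hx.
    destruct (compact_regular x C) as (V & U & HV & HU & HxV & HCU & Hd); auto.
    { apply HK, Hx. }
    { intros H. apply (Hdis x). auto. }
    exists V. split; [exact HV|]. split; [exact HxV|]. exists U.
    split; [exact HU|]. split; [exact HCU|]. intros z [H1 H2]. apply (Hd z). auto.
  - exists U, V. auto.
Qed.

(** Were there no common point, each point would have a neighbourhood missed by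
    some member of [K], and then by directedness one member would miss everything. *)
Lemma compact_directed K :
  (exists C, C ∈ K) ->
  (forall C, C ∈ K -> is_closed P T C /\ exists x, x ∈ C) ->
  (forall C D, C ∈ K -> D ∈ K -> exists E, E ∈ K /\ subset E C /\ subset E D) ->
  exists x, forall C, C ∈ K -> x ∈ C.
Proof.
  intros [C0 HC0] Hcl Hdir. apply NNPP. intros Hno.
  destruct (compact_ind (fun U => exists C, C ∈ K /\ disjoint C U) P)
    as (U & _ & (C & HC & Hd) & HPU); [definability|..].
  - intros o Ho. exists C0. split; [exact HC0|]. intros z [_ Hz]. exact (Ho z Hz).
  - intros U V W (C & HC & HCU) (D & HD & HDV) HW.
    destruct (Hdir C D HC HD) as (E & HE & HEC & HED). exists E.
    split; [exact HE|]. intros z [Hz HzW]. apply HW in HzW.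
    destruct HzW as [H|H]; [apply (HCU z)|apply (HDV z)]; auto.
  - exact closed_full.
  - intros x Hx. apply NNPP. intros N. apply Hno. exists x. intros C HC.
    apply NNPP. intros HxC. apply N.
    destruct (closed_exists_compl C) as (U & HU & HUC); [apply Hcl, HC|].
    exists U. split; [exact HU|]. split; [apply HUC; auto|].
    exists C. split; [exact HC|]. intros z [H1 H2]. apply HUC in H2. tauto.
  - destruct (Hcl C HC) as [[HCP _] [x Hx]]. apply (Hd x). auto.
Qed.

Lemma compact_subcover F K : subset F T -> is_closed P T K ->
  (forall x, x ∈ K -> exists V, V ∈ F /\ x ∈ V) ->
  exists G, subset G F /\ is_finite G /\
    forall x, x ∈ K -> exists V, V ∈ G /\ x ∈ V.
Proof.
  intros HF HK Hcov.
  destruct (compact_ind (fun U => exists G, subset G F /\ is_finite G /\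
    forall x, x ∈ U -> exists V, V ∈ G /\ x ∈ V) K)
    as (U & _ & (G & HG & Hfin & H) & HKU); [definability|..].
  - intros o Ho. exists o. split; [intros z Hz; destruct (Ho z Hz)|].
    split; [apply finite_empty, Ho|]. intros z Hz. destruct (Ho z Hz).
  - intros U V W (G & HG & Hfin & H) (G' & HG' & Hfin' & H') HW.
    destruct (exists_union2 G G') as [J HJ]. exists J. split; [|split].
    + intros z Hz. apply HJ in Hz. destruct Hz; auto.
    + exact (finite_union2 G G' J Hfin Hfin' HJ).
    + intros x Hx. apply HW in Hx. destruct Hx as [Hx|Hx].
      * destruct (H x Hx) as (X & HX & HxX). exists X. rewrite HJ. auto.
      * destruct (H' x Hx) as (X & HX & HxX). exists X. rewrite HJ. auto.
  - exact HK.
  - intros x Hx. destruct (Hcov x Hx) as (V & HV & HxV). exists V.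
    split; [auto|]. split; [exact HxV|].
    destruct (exists_singleton V) as [G HG]. destruct exists_empty as [o Ho].
    exists G. split; [|split].
    + intros z Hz. apply HG in Hz. subst z. exact HV.
    + apply (finite_adjoin o G V (finite_empty o Ho)). intros z. rewrite HG.
      split; [auto|]. intros [H|H]; [destruct (Ho z H)|exact H].
    + intros z Hz. exists V. rewrite HG. auto.
  - exists G. split; [exact HG|]. split; [exact Hfin|]. auto.
Qed.

(** The closed sets are first fattened inside the open set, so that by
    compactness the finite unions catch every closed subset. *)
Lemma F_sigma_exhaustion w B : is_omega w -> B ∈ T -> is_F_sigma P T B ->
  exists s, is_function_on s w /\
    (forall n C, rel s n C -> is_closed P T C /\ subset C B) /\
    (forall K, is_closed P T K -> subset K B ->
       exists n C, rel s n C /\ subset K C).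
Proof.
  intros Hw HB (w' & s & Hw' & Hs & Hcl & HBs).
  rewrite <- (omega_unique w w' Hw Hw') in *. clear w' Hw'.
  destruct (zfc_power A HA P) as [PP HPP].
  destruct (exists_diff P B) as [PB HPB].
  assert (HPBc : is_closed P T PB) by exact (compl_closed B PB HB HPB).
  destruct (choice_function (fun n D => is_closed P T D /\ subset D B /\
    exists C U, rel s n C /\ U ∈ T /\ subset C U /\ subset U D) w PP)
    as (d & Hd & Hdr); [definability|..].
  { intros n Hn. destruct (function_on_total s w n Hs Hn) as [C HC].
    destruct (compact_normal C PB (Hcl n C HC) HPBc) as (U & V & HU & HV & HCU & HPV & Hdis).
    { intros z [HzC Hz]. apply HPB in Hz. apply Hz, HBs. eauto. }
    destruct (exists_diff P V) as [D HD]. exists D.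
    assert (HUD : subset U D).
    { intros z Hz. apply HD. split; [apply (open_subset U HU z Hz)|].
      intros HzV. apply (Hdis z). auto. }
    split; [apply HPP; intros z Hz; apply HD in Hz; tauto|].
    split; [exact (compl_closed V D HV HD)|]. split.
    - intros z Hz. apply HD in Hz. apply NNPP. intros N.
      apply Hz, HPV, HPB. tauto.
    - exists C, U. auto. }
  pose (upto := fun n E => forall z, z ∈ E <-> exists i D, (i ∈ n \/ i = n) /\
    rel d i D /\ z ∈ D).
  assert (Hupto : definable (fun e => upto (e 0) (e 1))) by (unfold upto; definability).
  assert (Hsub : forall n E, upto n E -> subset E B).
  { intros n E HE z Hz. apply HE in Hz. destruct Hz as (i & D & _ & HD & Hz).
    apply (Hdr i D HD). exact Hz. }
  destruct (exists_function upto w PP Hupto) as (t & Ht & Htr).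
  { intros n Hn. destruct (separation (fun z => exists i D, (i ∈ n \/ i = n) /\
      rel d i D /\ z ∈ D) P) as [E HE]; [definability|].
    exists E. split.
    - apply HPP. intros z Hz. apply HE in Hz. tauto.
    - intros z. rewrite HE. split; [tauto|]. intros (i & D & Hi & HD & Hz).
      split; [|eauto]. apply (Hdr i D HD). exact Hz. }
  { intros n E E' _ HE HE'. apply set_ext. intros z. rewrite (HE z), (HE' z). tauto. }
  assert (Hclosed : forall n, n ∈ w -> forall E, upto n E -> is_closed P T E).
  { apply (omega_ind w Hw (fun n => forall E, upto n E -> is_closed P T E));
      [definability|..].
    - intros o Ho E HE. destruct (function_on_total d w o Hd) as [D HD];
        [apply (omega_empty w Hw), Ho|].
      replace E with D; [apply (Hdr o D HD)|]. apply set_ext. intros z.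
      rewrite (HE z). split.
      + intros Hz. exists o, D. auto.
      + intros (i & D' & [Hi| ->] & HD' & Hz); [destruct (Ho i Hi)|].
        rewrite (function_on_unique d w o D D' Hd HD HD'). exact Hz.
    - intros n k Hn IH Hk E HE.
      assert (Hkw : k ∈ w) by exact (omega_succ w Hw n k Hn Hk).
      destruct (function_on_total d w k Hd Hkw) as [D HD].
      destruct (function_on_total t w n Ht Hn) as [E' HE'].
      apply Htr in HE'. destruct HE' as (_ & _ & HE').
      apply (closed_union2 E' D E (IH E' HE')); [apply (Hdr k D HD)|].
      intros z. rewrite (HE z), (HE' z). split.
      + intros (i & D' & [Hi| ->] & HD' & Hz).
        * left. exists i, D'. apply Hk in Hi. auto.
        * right. rewrite (function_on_unique d w k D D' Hd HD HD'). exact Hz.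
      + intros [(i & D' & Hi & HD' & Hz)|Hz].
        * exists i, D'. rewrite (Hk i). auto.
        * exists k, D. auto. }
  exists t. split; [exact Ht|]. split.
  - intros n E HE. apply Htr in HE. destruct HE as (Hn & _ & HE).
    split; [exact (Hclosed n Hn E HE)|exact (Hsub n E HE)].
  - intros K HK HKB.
    destruct (compact_ind (fun U => exists n C, rel t n C /\ subset U C) K)
      as (U & _ & (n & C & HC & HUC) & HKU); [definability|..].
    + intros o Ho. destruct (function_on_total t w o Ht) as [E HE];
        [apply (omega_empty w Hw), Ho|].
      exists o, E. split; [exact HE|]. intros z Hz. destruct (Ho z Hz).
    + intros U V W (n & C & HC & HUC) (m & D & HD & HVD) HW.
      pose proof (proj1 (Htr n C) HC) as (Hn & _ & HC').
      pose proof (proj1 (Htr m D) HD) as (Hm & _ & HD').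
      destruct (omega_total w Hw n m Hn Hm) as [H|[<-|H]].
      * exists m, D. split; [exact HD|]. intros z Hz. apply HW in Hz.
        destruct Hz as [Hz|Hz]; [|auto]. apply HD'.
        apply HUC, HC' in Hz. destruct Hz as (i & X & Hi & HX & Hz).
        exists i, X. split; [left|auto].
        destruct Hi as [Hi| ->]; [exact (omega_trans w Hw m n i Hm H Hi)|exact H].
      * exists n, C. split; [exact HC|]. intros z Hz. apply HW in Hz.
        rewrite (function_on_unique t w n D C Ht HD HC) in HVD.
        destruct Hz; auto.
      * exists n, C. split; [exact HC|]. intros z Hz. apply HW in Hz.
        destruct Hz as [Hz|Hz]; [auto|]. apply HC'.
        apply HVD, HD' in Hz. destruct Hz as (i & X & Hi & HX & Hz).
        exists i, X. split; [left|auto].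
        destruct Hi as [Hi| ->]; [exact (omega_trans w Hw n m i Hn H Hi)|exact H].
    + exact HK.
    + intros x Hx. apply HKB, HBs in Hx. destruct Hx as (n & C & HC & Hx).
      pose proof (function_on_dom s w n C Hs HC) as Hn.
      destruct (function_on_total d w n Hd Hn) as [D HD].
      pose proof (Hdr n D HD) as (_ & _ & _ & C' & U & HC' & HU & HCU & HUD).
      rewrite (function_on_unique s w n C C' Hs HC HC') in Hx.
      destruct (function_on_total t w n Ht Hn) as [E HE].
      exists U. split; [exact HU|]. split; [auto|]. exists n, E.
      split; [exact HE|]. apply Htr in HE. intros z Hz.
      apply (proj2 (proj2 HE)). exists n, D. auto.
    + exists n, C. split; [exact HC|]. intros z Hz. apply HUC, HKU, Hz.
Qed.

End Compact.

(** * Ultrafilters of a normal lattice of sets *)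

(** What the lattice of closed sets of a compact Hausdorff space keeps in a larger
    model, where it need no longer consist of the closed sets of a compact space. *)
Record normal_lattice {A : set_structure} (P D R : A) : Prop := {
  nl_subset : forall C, C ∈ D -> subset C P;
  nl_empty : forall o, is_empty o -> o ∈ D;
  nl_full : P ∈ D;
  nl_inter : forall B C E, B ∈ D -> C ∈ D -> is_inter E B C -> E ∈ D;
  nl_union : forall B C E, B ∈ D -> C ∈ D ->
    (forall z, z ∈ E <-> z ∈ B \/ z ∈ C) -> E ∈ D;
  nl_normal : forall B C, B ∈ D -> C ∈ D -> disjoint B C ->
    exists E F, E ∈ D /\ F ∈ D /\ disjoint B F /\ disjoint C E /\
      forall z, z ∈ P -> z ∈ E \/ z ∈ F;
  nl_order : forall B C, rel R B C <-> B ∈ D /\ C ∈ D /\ subset B C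
}.

(** For an open set [V] of the smaller space, this says that the ultrafilter [p]
    belongs to the open set of the larger space that interprets [V]. *)
Definition inside {A : set_structure} (p V : A) : Prop :=
  exists C, C ∈ p /\ subset C V.

Definition finite_inside {A : set_structure} (p F : A) : Prop :=
  exists a, (forall B, B ∈ a <-> B ∈ F /\ inside p B) /\ is_finite a.

#[global] Hint Unfold inside finite_inside : definable_unfold.

Section Ultrafilters.
Context {A : set_structure} {HA : ZFC A}.
Context (P D R : A) (HD : normal_lattice P D R).

Let D_empty := nl_empty P D R HD.
Let D_full := nl_full P D R HD.
Let D_order := nl_order P D R HD.

(** In a lattice of sets the meet is the intersection, the least element is empty
    and the greatest is the whole space. *)
Lemma filter_iff F : is_filter D R F <->
  subset F D /\ (forall o, is_empty o -> o ∉ F) /\ P ∈ F /\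
  (forall a b c, a ∈ F -> b ∈ F -> is_inter c a b -> c ∈ F) /\
  (forall a b, a ∈ F -> b ∈ D -> subset a b -> b ∈ F).
Proof.
  assert (refl : forall a : A, subset a a) by (intros a z; auto).
  split.
  - intros (HF & Hl & Hg & Hm). split; [exact HF|]. split; [|split; [|split]].
    + intros o Ho. apply Hl. split; [apply D_empty, Ho|]. intros a Ha.
      apply D_order. split; [apply D_empty, Ho|]. split; [exact Ha|].
      intros z Hz. destruct (Ho z Hz).
    + apply Hg. split; [apply D_full|]. intros a Ha. apply D_order.
      split; [exact Ha|]. split; [apply D_full|]. apply (nl_subset _ _ _ HD a Ha).
    + intros a b c Ha Hb Hc. assert (HcD : c ∈ D).
      { apply (nl_inter _ _ _ HD a b); auto. }
      apply (Hm a b c c Ha Hb); [|exact HcD|apply D_order; auto].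
      split; [exact HcD|]. split; [|split].
      * apply D_order. split; [exact HcD|]. split; [auto|].
        intros z Hz. apply Hc in Hz. tauto.
      * apply D_order. split; [exact HcD|]. split; [auto|].
        intros z Hz. apply Hc in Hz. tauto.
      * intros d HdD H1 H2. apply D_order in H1. apply D_order in H2. apply D_order.
        split; [exact HdD|]. split; [exact HcD|]. intros z Hz. apply Hc.
        split; [apply H1|apply H2]; exact Hz.
    + intros a b Ha Hb Hab. apply (Hm a a a b Ha Ha); [|exact Hb|apply D_order; auto].
      split; [auto|]. split; [apply D_order; auto|]. split; [apply D_order; auto|auto].
  - intros (HF & Hl & Hg & Hm & Hup). split; [exact HF|]. split; [|split].
    + intros o [HoD Ho]. apply Hl. destruct exists_empty as [e He].
      intros z Hz. assert (H : rel R o e) by (apply Ho, D_empty, He).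
      apply D_order in H. apply (He z). apply H, Hz.
    + intros i [HiD Hi]. replace i with P; [exact Hg|].
      assert (H : rel R P i) by (apply Hi, D_full). apply D_order in H.
      apply set_ext. intros z. split; [apply H|apply (nl_subset _ _ _ HD i HiD)].
    + intros a b c x Ha Hb (HcD & Hca & Hcb & Hc) Hx Hcx.
      destruct (exists_inter a b) as [d Hd].
      apply (Hup d x); [exact (Hm a b d Ha Hb Hd)|exact Hx|].
      assert (HdD : d ∈ D) by (apply (nl_inter _ _ _ HD a b); auto).
      assert (H : rel R d c).
      { apply Hc; [exact HdD|..]; apply D_order; (split; [exact HdD|]);
          (split; [auto|]); intros z Hz; apply Hd in Hz; tauto. }
      apply D_order in H. apply D_order in Hcx. intros z Hz. apply Hcx, H, Hz.
Qed.

Section OneUltrafilter.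
Context (p : A) (Hp : is_ultrafilter D R p).

Lemma ultra_subset a : a ∈ p -> a ∈ D.
Proof. apply Hp. Qed.

Lemma ultra_empty o : is_empty o -> o ∉ p.
Proof. destruct Hp as [H _]. apply filter_iff in H. apply H. Qed.

Lemma ultra_full : P ∈ p.
Proof. destruct Hp as [H _]. apply filter_iff in H. apply H. Qed.

Lemma ultra_inter a b c : a ∈ p -> b ∈ p -> is_inter c a b -> c ∈ p.
Proof. destruct Hp as [H _]. apply filter_iff in H. apply H. Qed.

Lemma ultra_up a b : a ∈ p -> b ∈ D -> subset a b -> b ∈ p.
Proof. destruct Hp as [H _]. apply filter_iff in H. apply H. Qed.

Lemma ultra_not_disjoint a b : a ∈ p -> b ∈ p -> ~ disjoint a b.
Proof.
  intros Ha Hb Hd. destruct (exists_inter a b) as [c Hc].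
  apply (ultra_empty c); [|exact (ultra_inter a b c Ha Hb Hc)].
  intros z Hz. apply (Hd z). apply Hc, Hz.
Qed.

Lemma ultra_disjoint a : a ∈ D -> a ∉ p -> exists b, b ∈ p /\ disjoint a b.
Proof.
  intros Ha Hap. apply NNPP. intros N.
  (* The filter generated by [p] and [a]. *)
  destruct (separation (fun x => exists b, b ∈ p /\ forall z, z ∈ a -> z ∈ b -> z ∈ x) D)
    as [G HG]; [definability|].
  assert (HGF : is_filter D R G).
  { apply filter_iff. split; [|split; [|split; [|split]]].
    - intros x Hx. apply HG in Hx. tauto.
    - intros o Ho H. apply HG in H. destruct H as (_ & b & Hb & H).
      apply N. exists b. split; [exact Hb|]. intros z [H1 H2].
      exact (Ho z (H z H1 H2)).
    - apply HG. split; [apply D_full|]. exists P. split; [apply ultra_full|auto].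
    - intros x y z Hx Hy Hz. apply HG in Hx. apply HG in Hy.
      destruct Hx as (HxD & b & Hb & Hx). destruct Hy as (HyD & c & Hc & Hy).
      destruct (exists_inter b c) as [d Hd]. apply HG.
      split; [apply (nl_inter _ _ _ HD x y); auto|]. exists d.
      split; [exact (ultra_inter b c d Hb Hc Hd)|].
      intros t Hta Htd. apply Hd in Htd. apply Hz. split; [apply Hx|apply Hy]; tauto.
    - intros x y Hx Hy Hxy. apply HG in Hx. destruct Hx as (_ & b & Hb & Hx).
      apply HG. split; [exact Hy|]. exists b. auto. }
  apply Hap. rewrite <- (proj2 Hp G HGF).
  - apply HG. split; [exact Ha|]. exists P. split; [apply ultra_full|auto].
  - intros x Hx. apply HG. split; [apply ultra_subset, Hx|]. exists x. auto.
Qed.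

Lemma ultra_prime a b c : a ∈ D -> b ∈ D -> c ∈ p ->
  (forall z, z ∈ c -> z ∈ a \/ z ∈ b) -> a ∈ p \/ b ∈ p.
Proof.
  intros Ha Hb Hc Hab. apply NNPP. intros N.
  destruct (ultra_disjoint a Ha) as (a' & Ha' & Hda); [tauto|].
  destruct (ultra_disjoint b Hb) as (b' & Hb' & Hdb); [tauto|].
  destruct (exists_inter a' b') as [d Hd].
  apply (ultra_not_disjoint c d Hc); [exact (ultra_inter a' b' d Ha' Hb' Hd)|].
  intros z [Hzc Hzd]. apply Hd in Hzd.
  destruct (Hab z Hzc); [apply (Hda z)|apply (Hdb z)]; tauto.
Qed.

(** Finitely many requirements that persist under shrinking are met by one member,
    since the ultrafilter is closed under intersections. *)
Lemma ultra_finite_choice (Phi : A -> A -> Prop) F :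
  definable (fun e => Phi (e 0) (e 1)) ->
  (forall C C' B, subset C' C -> Phi C B -> Phi C' B) ->
  is_finite F -> (forall B, B ∈ F -> exists C, C ∈ p /\ Phi C B) ->
  exists C, C ∈ p /\ forall B, B ∈ F -> Phi C B.
Proof.
  intros HPhi Hmono HF.
  apply (finite_ind (fun F => (forall B, B ∈ F -> exists C, C ∈ p /\ Phi C B) ->
    exists C, C ∈ p /\ forall B, B ∈ F -> Phi C B)); [definability|..|exact HF].
  - intros o Ho _. exists P. split; [exact ultra_full|].
    intros B HB. destruct (Ho B HB).
  - intros F1 F2 B IH _ HF2 Hin.
    destruct IH as (C & HC & HCF); [intros B' HB'; apply Hin, HF2; auto|].
    destruct (Hin B) as (C' & HC' & HCB); [apply HF2; auto|].
    destruct (exists_inter C C') as [E HE]. exists E.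
    split; [exact (ultra_inter C C' E HC HC' HE)|].
    intros X HX. apply HF2 in HX. destruct HX as [HX| ->].
    + apply (Hmono C); [intros z Hz; apply HE in Hz; tauto|apply (HCF X HX)].
    + apply (Hmono C'); [intros z Hz; apply HE in Hz; tauto|exact HCB].
Qed.

Lemma inside_all F : is_finite F -> (forall B, B ∈ F -> inside p B) ->
  exists C, C ∈ p /\ forall B, B ∈ F -> subset C B.
Proof.
  intros HF Hin. apply (ultra_finite_choice (fun C B => subset C B)); auto.
  - definability.
  - intros C C' B H1 H2 z Hz. apply H2, H1, Hz.
Qed.

End OneUltrafilter.

Lemma exists_ultrafilter F : is_filter D R F ->
  exists p, is_ultrafilter D R p /\ subset F p.
Proof.
  intros HF. destruct (zfc_power A HA D) as [PD HPD].
  destruct (separation (fun G => is_filter D R G) PD) as [FF HFF]; [definability|].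
  assert (HFF' : forall G, G ∈ FF <-> is_filter D R G).
  { intros G. rewrite HFF, (HPD G). split; [tauto|]. intros H. split; [apply H|exact H]. }
  destruct (zorn FF F) as (p & Hp & HFp & Hmax).
  - apply HFF', HF.
  - intros c u Hc [G0 HG0] Hch Hu. apply HFF', filter_iff.
    assert (Hc' : forall G, G ∈ c -> subset G D /\ (forall o, is_empty o -> o ∉ G) /\ P ∈ G /\
      (forall a b c, a ∈ G -> b ∈ G -> is_inter c a b -> c ∈ G) /\
      (forall a b, a ∈ G -> b ∈ D -> subset a b -> b ∈ G)).
    { intros G HG. apply filter_iff, HFF', Hc, HG. }
    split; [|split; [|split; [|split]]].
    + intros x Hx. apply Hu in Hx. destruct Hx as (G & HG & Hx). apply (Hc' G HG), Hx.
    + intros o Ho H. apply Hu in H. destruct H as (G & HG & H).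
      apply (Hc' G HG) in H; assumption.
    + apply Hu. exists G0. split; [exact HG0|apply (Hc' G0 HG0)].
    + intros a b d Ha Hb Hd. apply Hu in Ha. apply Hu in Hb. apply Hu.
      destruct Ha as (G & HG & Ha). destruct Hb as (G' & HG' & Hb).
      destruct (Hch G G' HG HG') as [H|H].
      * exists G'. split; [exact HG'|].
        apply (proj1 (proj2 (proj2 (proj2 (Hc' G' HG')))) a b d); auto.
      * exists G. split; [exact HG|].
        apply (proj1 (proj2 (proj2 (proj2 (Hc' G HG)))) a b d); auto.
    + intros a b Ha Hb Hab. apply Hu in Ha. destruct Ha as (G & HG & Ha).
      apply Hu. exists G. split; [exact HG|].
      apply (proj2 (proj2 (proj2 (proj2 (Hc' G HG)))) a b); auto.
  - exists p. split; [|exact HFp]. split; [apply HFF', Hp|].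
    intros G HG HpG. apply Hmax; [apply HFF', HG|exact HpG].
Qed.

(** ** The space of ultrafilters *)

(** The sets open in the topology generated by the base of the sets of points
    that omit a given member of the lattice. *)
Definition ultra_open (Q U : A) : Prop :=
  subset U Q /\ forall p, p ∈ U -> exists a, a ∈ D /\ a ∉ p /\
    forall q, q ∈ Q -> a ∉ q -> q ∈ U.

Lemma exists_Ult L : is_opair L D R -> exists Q T, is_Ult L (opair Q T) /\
  (forall p, p ∈ Q <-> is_ultrafilter D R p) /\
  (forall U, U ∈ T <-> ultra_open Q U).
Proof.
  intros HL. destruct (zfc_power A HA D) as [PD HPD].
  destruct (separation (fun p => is_ultrafilter D R p) PD) as [Q HQ]; [definability|].
  assert (HQ' : forall p, p ∈ Q <-> is_ultrafilter D R p).
  { intros p. rewrite HQ, (HPD p). split; [tauto|]. intros H. split; [apply H|exact H]. }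
  destruct (zfc_power A HA Q) as [PQ HPQ].
  destruct (separation (fun U => ultra_open Q U) PQ) as [T HT].
  { unfold ultra_open. definability. }
  assert (HT' : forall U, U ∈ T <-> ultra_open Q U).
  { intros U. rewrite HT, (HPQ U). split; [tauto|]. intros H. split; [apply H|exact H]. }
  exists Q, T. split; [|auto].
  exists D, R, Q, T. split; [exact HL|]. split; [apply opair_spec|].
  split; [exact HQ'|]. intros U. rewrite HT'. split.
  - intros [HUQ HU].
    destruct (separation (fun b => subset b U /\ exists a, a ∈ D /\ is_minus Q b a) PQ)
      as [F HF]; [definability|].
    exists F. split.
    + intros b Hb. apply HF in Hb. tauto.
    + intros p. split.
      * intros Hp. destruct (HU p Hp) as (a & Ha & Hap & Hsub).
        destruct (separation (fun q => a ∉ q) Q) as [b Hb]; [definability|].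
        exists b. split; [|apply Hb; auto]. apply HF. split; [|split].
        -- apply HPQ. intros z Hz. apply Hb in Hz. tauto.
        -- intros z Hz. apply Hb in Hz. apply Hsub; tauto.
        -- exists a. split; [exact Ha|exact Hb].
      * intros (b & Hb & Hpb). apply HF in Hb. apply Hb, Hpb.
  - intros (F & HF & HU). split.
    + intros p Hp. apply HU in Hp. destruct Hp as (b & Hb & Hpb).
      destruct (HF b Hb) as (a & _ & Hm). apply Hm in Hpb. tauto.
    + intros p Hp. apply HU in Hp. destruct Hp as (b & Hb & Hpb).
      destruct (HF b Hb) as (a & Ha & Hm). exists a. split; [exact Ha|].
      split; [apply Hm in Hpb; tauto|]. intros q Hq Haq. apply HU.
      exists b. split; [exact Hb|]. apply Hm. auto.
Qed.

Section Space.
Context (Q T : A) (HQ : forall p, p ∈ Q <-> is_ultrafilter D R p)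
  (HT : forall U, U ∈ T <-> ultra_open Q U).

Lemma minus_open a b : a ∈ D -> is_minus Q b a -> b ∈ T.
Proof.
  intros Ha Hb. apply HT. split.
  - intros p Hp. apply Hb in Hp. tauto.
  - intros p Hp. apply Hb in Hp. exists a. split; [exact Ha|].
    split; [tauto|]. intros q Hq Haq. apply Hb. auto.
Qed.

Lemma star_closed a C : a ∈ D -> (forall p, p ∈ C <-> p ∈ Q /\ a ∈ p) ->
  is_closed Q T C.
Proof.
  intros Ha HC. split; [intros p Hp; apply HC in Hp; tauto|].
  destruct (exists_diff Q C) as [U HU]. exists U. split; [exact HU|].
  apply (minus_open a U Ha). intros p. rewrite (HU p), HC. tauto.
Qed.

Lemma ultra_topology : is_topology Q T.
Proof.
  split; [|split; [|split; [|split]]].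
  - intros U HU. apply HT in HU. apply HU.
  - intros U HU. apply HT. split; intros p Hp; destruct (HU p Hp).
  - apply HT. split; [intros p; auto|]. intros p Hp. apply HQ in Hp.
    destruct exists_empty as [o Ho]. exists o. split; [apply D_empty, Ho|].
    split; [apply ultra_empty; assumption|auto].
  - intros U V W HU HV HW. apply HT in HU. apply HT in HV. apply HT.
    split; [intros p Hp; apply HW in Hp; apply HU; tauto|].
    intros p Hp. apply HW in Hp. destruct Hp as [HpU HpV].
    assert (HpQ : p ∈ Q) by apply HU, HpU.
    destruct (proj2 HU p HpU) as (a & Ha & Hap & HaU).
    destruct (proj2 HV p HpV) as (b & Hb & Hbp & HbV).
    destruct (exists_union2 a b) as [c Hc]. exists c.
    assert (HcD : c ∈ D) by exact (nl_union _ _ _ HD a b c Ha Hb Hc).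
    split; [exact HcD|]. split.
    + intros Hcp. apply HQ in HpQ.
      destruct (ultra_prime p HpQ a b c Ha Hb Hcp); [|tauto..].
      intros z Hz. apply Hc, Hz.
    + intros q Hq Hcq. assert (Hqu := Hq). apply HQ in Hqu. apply HW. split.
      * apply HaU; [exact Hq|]. intros H. apply Hcq.
        apply (ultra_up q Hqu a c H HcD). intros z Hz. apply Hc. auto.
      * apply HbV; [exact Hq|]. intros H. apply Hcq.
        apply (ultra_up q Hqu b c H HcD). intros z Hz. apply Hc. auto.
  - intros F U HF HU. apply HT. split.
    + intros p Hp. apply HU in Hp. destruct Hp as (V & HV & Hp).
      apply HF, HT in HV. apply HV, Hp.
    + intros p Hp. apply HU in Hp. destruct Hp as (V & HV & Hp).
      pose proof (proj1 (HT V) (HF V HV)) as [_ H].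
      destruct (H p Hp) as (a & Ha & Hap & HaV). exists a.
      split; [exact Ha|]. split; [exact Hap|]. intros q Hq Haq.
      apply HU. exists V. auto.
Qed.

Lemma ultra_separate p q : p ∈ Q -> q ∈ Q -> p <> q ->
  exists a b, a ∈ p /\ b ∈ q /\ disjoint a b.
Proof.
  intros Hp Hq Hne. apply HQ in Hp. apply HQ in Hq.
  assert (H : exists a, a ∈ p /\ a ∉ q).
  { apply NNPP. intros N. apply Hne. symmetry. apply (proj2 Hp q); [apply Hq|].
    intros a Ha. apply NNPP. intros Haq. apply N. eauto. }
  destruct H as (a & Ha & Haq).
  destruct (ultra_disjoint q Hq a (ultra_subset p Hp a Ha) Haq) as (b & Hb & Hd).
  exists a, b. auto.
Qed.

Lemma ultra_hausdorff : is_hausdorff Q T.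
Proof.
  intros p q Hp Hq Hne.
  destruct (ultra_separate p q Hp Hq Hne) as (a & b & Ha & Hb & Hd).
  pose proof (proj1 (HQ p) Hp) as Hpu. pose proof (proj1 (HQ q) Hq) as Hqu.
  destruct (nl_normal _ _ _ HD a b (ultra_subset p Hpu a Ha) (ultra_subset q Hqu b Hb) Hd)
    as (E & F & HE & HF & HaF & HbE & Hcov).
  destruct (separation (fun r => F ∉ r) Q) as [U HU]; [definability|].
  destruct (separation (fun r => E ∉ r) Q) as [V HV]; [definability|].
  exists U, V. split; [exact (minus_open F U HF HU)|].
  split; [exact (minus_open E V HE HV)|]. split; [|split].
  - apply HU. split; [exact Hp|]. intros H.
    exact (ultra_not_disjoint p Hpu a F Ha H HaF).
  - apply HV. split; [exact Hq|]. intros H.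
    exact (ultra_not_disjoint q Hqu b E Hb H HbE).
  - intros r [HrU HrV]. apply HU in HrU. apply HV in HrV.
    destruct HrU as [Hr HFr]. apply HQ in Hr.
    destruct (ultra_prime r Hr E F P HE HF (ultra_full r Hr) Hcov); tauto.
Qed.

(** If no finite part of an open cover covers, then the members of the lattice
    whose complements are finitely covered form a filter, and an ultrafilter
    above it is a point that no member of the cover contains. *)
Lemma ultra_compact : covers_compactly Q T.
Proof.
  intros F HF HQF. apply NNPP. intros N.
  destruct exists_empty as [o Ho].
  destruct (separation (fun a => exists H, subset H F /\ is_finite H /\
    forall p, p ∈ Q -> a ∉ p -> exists U, U ∈ H /\ p ∈ U) D) as [G HG]; [definability|].
  assert (HGF : is_filter D R G).
  { apply filter_iff. split; [|split; [|split; [|split]]].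
    - intros a Ha. apply HG in Ha. tauto.
    - intros e He Hin. apply HG in Hin. destruct Hin as (_ & H & HHF & Hfin & Hcov).
      apply N. exists H. split; [exact HHF|]. split; [exact Hfin|].
      intros p. split.
      + intros Hp. destruct (Hcov p Hp) as (U & HU & HpU); [|eauto].
        apply HQ in Hp. apply ultra_empty; assumption.
      + intros (U & HU & HpU). apply HQF. exists U. auto.
    - apply HG. split; [apply D_full|]. exists o.
      split; [intros z Hz; destruct (Ho z Hz)|]. split; [apply finite_empty, Ho|].
      intros p Hp Hn. destruct Hn. apply ultra_full. apply HQ, Hp.
    - intros a b c Ha Hb Hc. apply HG in Ha. apply HG in Hb.
      destruct Ha as (HaD & H & HHF & Hfin & Hcov).
      destruct Hb as (HbD & H' & HHF' & Hfin' & Hcov').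
      destruct (exists_union2 H H') as [J HJ]. apply HG.
      split; [exact (nl_inter _ _ _ HD a b c HaD HbD Hc)|]. exists J.
      split; [|split].
      + intros z Hz. apply HJ in Hz. destruct Hz; auto.
      + exact (finite_union2 H H' J Hfin Hfin' HJ).
      + intros p Hp Hcp. pose proof (proj1 (HQ p) Hp) as Hpu.
        destruct (classic (a ∈ p)) as [Hap|Hap].
        * destruct (Hcov' p Hp) as (U & HU & HpU).
          { intros Hbp. apply Hcp. exact (ultra_inter p Hpu a b c Hap Hbp Hc). }
          exists U. rewrite HJ. auto.
        * destruct (Hcov p Hp Hap) as (U & HU & HpU). exists U. rewrite HJ. auto.
    - intros a b Ha Hb Hab. apply HG in Ha. destruct Ha as (HaD & H & HHF & Hfin & Hcov).
      apply HG. split; [exact Hb|]. exists H. split; [exact HHF|].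
      split; [exact Hfin|]. intros p Hp Hbp. apply Hcov; [exact Hp|].
      intros Hap. apply Hbp. apply HQ in Hp. exact (ultra_up p Hp a b Hap Hb Hab). }
  destruct (exists_ultrafilter G HGF) as (p & Hp & HGp).
  pose proof (proj2 (HQ p) Hp) as HpQ.
  pose proof (proj1 (HQF p) HpQ) as (U & HUF & HpU).
  pose proof (proj1 (HT U) (HF U HUF)) as [_ HU].
  destruct (HU p HpU) as (a & Ha & Hap & HaU).
  apply Hap, HGp, HG. split; [exact Ha|].
  destruct (exists_singleton U) as [H HH]. exists H. split; [|split].
  - intros z Hz. apply HH in Hz. subst z. exact HUF.
  - apply (finite_adjoin o H U (finite_empty o Ho)). intros z. rewrite HH.
    split; [auto|]. intros [Hz|Hz]; [destruct (Ho z Hz)|exact Hz].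
  - intros q Hq Haq. exists U. rewrite HH. auto.
Qed.

Lemma ultra_compact_top : is_compact_top Q T.
Proof.
  split; [exact ultra_topology|]. split; [exact ultra_hausdorff|exact ultra_compact].
Qed.

End Space.
End Ultrafilters.

(** * Transitive embeddings of models *)

(** The inclusion of a transitive model into a larger one, seen from the two models
    alone.  Injectivity follows from extensionality. *)
Record transitive_embedding {M N : set_structure} (j : M -> N) : Prop := {
  te_mem : forall x y, j x ∈ j y <-> x ∈ y;
  te_range : forall x z, z ∈ j x -> exists y, z = j y
}.

Section Embedding.
Context {M N : set_structure} {HM : ZFC M} {HN : ZFC N}.
Context (j : M -> N) (Hj : transitive_embedding j).

Let j_mem := te_mem j Hj.

Lemma j_elim x z : z ∈ j x -> exists y, y ∈ x /\ z = j y.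
Proof.
  intros Hz. destruct (te_range j Hj x z Hz) as [y ->]. exists y.
  split; [apply j_mem, Hz|reflexivity].
Qed.

Lemma j_inj x y : j x = j y -> x = y.
Proof.
  intros E. apply set_ext. intros z. rewrite <- (j_mem z x), <- (j_mem z y), E. tauto.
Qed.

Lemma j_subset x y : subset (j x) (j y) <-> subset x y.
Proof.
  split; intros H z Hz.
  - apply j_mem, H, j_mem, Hz.
  - apply j_elim in Hz. destruct Hz as (t & Ht & ->). apply j_mem, H, Ht.
Qed.

Lemma j_disjoint x y : disjoint (j x) (j y) <-> disjoint x y.
Proof.
  split; intros H z [H1 H2].
  - apply (H (j z)). rewrite !j_mem. auto.
  - apply j_elim in H1. destruct H1 as (t & Ht & ->).
    apply (H t). split; [exact Ht|apply j_mem, H2].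
Qed.

(** Reduces the absoluteness of a set described by its members to that of the
    description; the last hypothesis keeps new elements of the larger model out. *)
Lemma j_members (x : M) (Q : M -> Prop) (Q' : N -> Prop) :
  (forall z, z ∈ x <-> Q z) -> (forall z, Q z <-> Q' (j z)) ->
  (forall z, Q' z -> exists y, z = j y) ->
  forall z, z ∈ j x <-> Q' z.
Proof.
  intros Hx HQ Hr z. split.
  - intros Hz. apply j_elim in Hz. destruct Hz as (y & Hy & ->).
    apply HQ, Hx, Hy.
  - intros Hz. destruct (Hr z Hz) as [y ->]. apply j_mem, Hx, HQ, Hz.
Qed.

Lemma j_eq x y : j x = j y <-> x = y.
Proof. split; [apply j_inj|intros ->; reflexivity]. Qed.

Lemma j_empty x : is_empty (j x) <-> is_empty x.
Proof.
  split; intros H z Hz.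
  - apply (H (j z)), j_mem, Hz.
  - apply j_elim in Hz. destruct Hz as (y & Hy & _). exact (H y Hy).
Qed.

Lemma j_upair u x y : is_upair u x y -> is_upair (j u) (j x) (j y).
Proof.
  intros H. unfold is_upair.
  apply (j_members u _ (fun z => z = j x \/ z = j y) H).
  - intros z. rewrite !j_eq. tauto.
  - intros z [-> | ->]; eauto.
Qed.

Lemma j_opair x y : opair (j x) (j y) = j (opair x y).
Proof.
  symmetry. apply is_opair_iff. destruct (opair_spec x y) as (s & d & Hs & Hd & Hp).
  exists (j s), (j d). auto using j_upair.
Qed.

Lemma j_rel R x y : rel (j R) (j x) (j y) <-> rel R x y.
Proof. rewrite !rel_iff, j_opair. apply j_mem. Qed.

Lemma j_rel_elim R u v :
  rel (j R) u v -> exists x y, u = j x /\ v = j y /\ rel R x y.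
Proof.
  intros H. assert (H' := H). apply rel_iff in H'.
  destruct (te_range j Hj _ _ H') as [r Hr].
  destruct (opair_spec u v) as (s & d & _ & Hd & Hp). rewrite Hr in Hp.
  assert (Hdr : d ∈ j r) by (apply Hp; auto).
  destruct (te_range j Hj _ _ Hdr) as [d' ->].
  assert (Hu : u ∈ j d') by (apply Hd; auto).
  assert (Hv : v ∈ j d') by (apply Hd; auto).
  destruct (te_range j Hj _ _ Hu) as [x ->].
  destruct (te_range j Hj _ _ Hv) as [y ->].
  exists x, y. split; [reflexivity|]. split; [reflexivity|]. apply j_rel, H.
Qed.

Lemma j_opair_inv x u v :
  j x = opair u v -> exists y z, u = j y /\ v = j z /\ x = opair y z.
Proof.
  intros E. destruct (exists_singleton x) as [r Hr].
  assert (H : rel (j r) u v).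
  { apply rel_iff. rewrite <- E. apply j_mem, Hr. reflexivity. }
  apply j_rel_elim in H. destruct H as (y & z & -> & -> & H).
  exists y, z. split; [reflexivity|]. split; [reflexivity|].
  apply rel_iff, Hr in H. symmetry. exact H.
Qed.

Lemma j_succ s x : is_succ s x -> is_succ (j s) (j x).
Proof.
  intros H. unfold is_succ. apply (j_members s _ (fun z => z ∈ j x \/ z = j x) H).
  - intros z. rewrite j_eq, j_mem. tauto.
  - intros z [Hz| ->]; [exact (te_range j Hj x z Hz)|eauto].
Qed.

Lemma j_inter w x y : is_inter w x y -> is_inter (j w) (j x) (j y).
Proof.
  intros H. unfold is_inter. apply (j_members w _ (fun z => z ∈ j x /\ z ∈ j y) H).
  - intros z. rewrite !j_mem. tauto.
  - intros z [Hz _]. exact (te_range j Hj x z Hz).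
Qed.

Lemma j_union2 w x y : (forall z, z ∈ w <-> z ∈ x \/ z ∈ y) ->
  forall z, z ∈ j w <-> z ∈ j x \/ z ∈ j y.
Proof.
  intros H. apply (j_members w _ (fun z => z ∈ j x \/ z ∈ j y) H).
  - intros z. rewrite !j_mem. tauto.
  - intros z [Hz|Hz]; [exact (te_range j Hj x z Hz)|exact (te_range j Hj y z Hz)].
Qed.

(** A least ground natural number outside an inductive set would be the successor
    of a member of that set, so foundation in the larger model suffices. *)
Lemma j_omega w : is_omega w -> is_omega (j w).
Proof.
  intros Hw. split.
  - destruct (exists_empty (A := M)) as [o Ho]. split.
    + exists (j o). split; [apply j_empty, Ho|apply j_mem, (omega_empty w Hw), Ho].
    + intros x Hx. apply j_elim in Hx. destruct Hx as (n & Hn & ->).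
      destruct (exists_succ n) as [s Hs]. exists (j s).
      split; [exact (j_succ s n Hs)|apply j_mem, (omega_succ w Hw n s Hn Hs)].
  - intros v Hv z Hz. apply NNPP. intros Hzv.
    destruct (exists_diff (j w) v) as [d Hd].
    destruct (zfc_foundation N HN d) as (x & Hx & Hmin); [exists z; apply Hd; auto|].
    apply Hd in Hx. destruct Hx as [Hx Hxv].
    apply j_elim in Hx. destruct Hx as (n & Hn & ->).
    destruct (omega_cases w Hw n Hn) as [Hn0|(m & Hm & Hnm)].
    + apply Hxv. destruct Hv as [(o & Ho & Hov) _].
      rewrite (empty_unique (j n) o); [exact Hov|apply j_empty, Hn0|exact Ho].
    + assert (Hmv : j m ∈ v).
      { apply NNPP. intros N'. apply (Hmin (j m)).
        - apply Hd. split; [apply j_mem, Hm|exact N'].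
        - apply j_mem, Hnm. auto. }
      destruct (proj2 Hv (j m) Hmv) as (s & Hs & Hsv). apply Hxv.
      rewrite (succ_unique (j n) s (j m) (j_succ n m Hnm) Hs). exact Hsv.
Qed.

Lemma j_function_on f a : is_function_on f a -> is_function_on (j f) (j a).
Proof.
  intros Hf. split.
  - intros p Hp. apply j_elim in Hp. destruct Hp as (r & Hr & ->).
    destruct (proj1 Hf r Hr) as (x & y & Hx & E). exists (j x), (j y).
    split; [apply j_mem, Hx|]. apply is_opair_iff in E. subst r.
    apply is_opair_iff. symmetry. apply j_opair.
  - intros x Hx. apply j_elim in Hx. destruct Hx as (x' & Hx' & ->).
    destruct (function_on_total f a x' Hf Hx') as [y Hy]. exists (j y).
    split; [apply j_rel, Hy|]. intros z Hz.
    apply j_rel_elim in Hz. destruct Hz as (x'' & y' & E & -> & Hz).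
    apply j_inj in E. subst x''. f_equal. exact (function_on_unique f a x' y y' Hf Hy Hz).
Qed.

Lemma j_bijection f a b : is_bijection f a b -> is_bijection (j f) (j a) (j b).
Proof.
  intros (Hf & Hr & Hi). split; [exact (j_function_on f a Hf)|]. split.
  - intros x y H. apply j_rel_elim in H. destruct H as (x' & y' & -> & -> & H).
    apply j_mem. exact (Hr x' y' H).
  - intros y Hy. apply j_elim in Hy. destruct Hy as (y' & Hy' & ->).
    destruct (Hi y' Hy') as (x & Hx & Hu). exists (j x).
    split; [apply j_rel, Hx|]. intros z Hz.
    apply j_rel_elim in Hz. destruct Hz as (x' & y'' & -> & E & Hz).
    apply j_inj in E. subst y''. f_equal. apply Hu, Hz.
Qed.

Lemma j_finite a : is_finite a -> is_finite (j a).
Proof.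
  intros (w & n & f & Hw & Hn & Hf). exists (j w), (j n), (j f).
  split; [exact (j_omega w Hw)|]. split; [apply j_mem, Hn|exact (j_bijection f n a Hf)].
Qed.

(** The induction needs a predicate that is definable in the larger model, which
    being in the range of [j] is not.  Membership in the set of all ground finite
    subsets of [a] is. *)
Lemma finite_subset_ground (a : M) (F : N) : is_finite F -> subset F (j a) ->
  exists G, F = j G /\ is_finite G /\ subset G a.
Proof.
  destruct (zfc_power M HM a) as [Pa HPa].
  destruct (separation (fun G => is_finite G) Pa) as [Phi HPhi]; [definability|].
  intros HF Hsub.
  assert (H : F ∈ j Phi).
  { revert Hsub.
    apply (finite_ind (fun F => subset F (j a) -> F ∈ j Phi)); [definability|..|exact HF].
    - intros o Ho _. destruct (exists_empty (A := M)) as [e He].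
      rewrite (empty_unique o (j e) Ho (proj2 (j_empty e) He)).
      apply j_mem, HPhi. split; [|apply finite_empty, He].
      apply HPa. intros z Hz. destruct (He z Hz).
    - intros b c x IH _ Hc Hsub.
      assert (Hb : b ∈ j Phi) by (apply IH; intros z Hz; apply Hsub, Hc; auto).
      apply j_elim in Hb. destruct Hb as (G & HG & ->).
      assert (Hx : x ∈ j a) by (apply Hsub, Hc; auto).
      apply j_elim in Hx. destruct Hx as (y & Hy & ->).
      destruct (exists_adjoin G y) as [G' HG'].
      replace c with (j G').
      + apply HPhi in HG. destruct HG as [HGa HGfin].
        apply j_mem, HPhi. split; [|exact (finite_adjoin G G' y HGfin HG')].
        apply HPa. intros z Hz. apply HG' in Hz.
        destruct Hz as [Hz| ->]; [|exact Hy]. apply (HPa G); assumption.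
      + apply set_ext. intros z. rewrite Hc.
        apply (j_members G' _ (fun z => z ∈ j G \/ z = j y) HG').
        * intros t. rewrite j_mem, j_eq. tauto.
        * intros t [Ht| ->]; [exact (te_range j Hj G t Ht)|eauto]. }
  apply j_elim in H. destruct H as (G & HG & ->). exists G.
  apply HPhi in HG. destruct HG as [HG Hfin]. split; [reflexivity|].
  split; [exact Hfin|apply (HPa G), HG].
Qed.

(** The rank function of the smaller model is still monotone in the larger one,
    and it would send a set without minimal element to one that violates
    foundation. *)
Lemma well_founded_absolute (T : M) (lt : M -> M -> Prop) (lt' : N -> N -> Prop) :
  definable (fun e => lt (e 0) (e 1)) ->
  (forall S, subset S T -> (exists x, x ∈ S) ->
     exists x, x ∈ S /\ forall y, y ∈ S -> ~ lt y x) ->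
  (forall s t, lt' (j s) (j t) -> lt s t) ->
  forall S, subset S (j T) -> (exists x, x ∈ S) ->
    exists x, x ∈ S /\ forall y, y ∈ S -> ~ lt' y x.
Proof.
  intros Hlt Hwf Habs S HS [x0 Hx0].
  destruct (exists_rank T lt Hlt Hwf) as (F & Htot & Hmono).
  destruct (exists_range (j F)) as [r Hr].
  destruct (separation (fun v => exists s, s ∈ S /\ rel (j F) s v) r) as [d Hd];
    [definability|].
  assert (Hval : forall x, x ∈ S -> exists t v, x = j t /\ t ∈ T /\ rel F t v /\ j v ∈ d).
  { intros x Hx. assert (HxT := HS x Hx). apply j_elim in HxT.
    destruct HxT as (t & Ht & ->). destruct (Htot t Ht) as [v Hv].
    exists t, v. split; [reflexivity|]. split; [exact Ht|]. split; [exact Hv|].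
    apply j_rel in Hv. apply Hd. split; [apply Hr; eauto|eauto]. }
  destruct (zfc_foundation N HN d) as (v & Hv & Hmin).
  { destruct (Hval x0 Hx0) as (t & v & _ & _ & _ & Hv). eauto. }
  apply Hd in Hv. destruct Hv as (_ & s & Hs & Hsv). exists s.
  split; [exact Hs|]. intros y Hy Hys.
  apply j_rel_elim in Hsv. destruct Hsv as (t & v' & -> & -> & Hsv).
  destruct (Hval y Hy) as (t' & u & -> & Ht' & Hu & Hud).
  apply (Hmin (j u) Hud).
  apply j_mem. exact (Hmono t' t u v' Ht' (Habs t' t Hys) Hu Hsv).
Qed.

End Embedding.

(** * Reflecting a pair of ultrafilters to a pair of points *)

(** The requirement made of the pair [C], [C'] about the [n]-th piece [V] of the
    family [s]: either [C] lies inside all members of a [k]-element subset of [V]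
    ([Z] relates numbers to sets of that size), or the pair is contained in one that
    [al] relates to [n].  It persists when [C] and [C'] shrink. *)
Definition many_or_related {A : set_structure} {HA : ZFC A} (s Z al k n C C' : A) : Prop :=
  (exists V F, rel s n V /\ rel Z k F /\ subset F V /\
     forall B, B ∈ F -> subset C B) \/
  (exists E E', subset C E /\ subset C' E' /\ rel al n (opair E E')).

#[global] Hint Unfold many_or_related : definable_unfold.

Section Nodes.
Context {A : set_structure} {HA : ZFC A}.
Context (P T : A) (HPT : is_compact_top P T).
Context (w s Z al a b : A) (Hw : is_omega w).
Context (HZ : forall k F, rel Z k F -> k ∈ w /\ equipotent k F).

(** The nodes of the tree: at level [k] the requirements about the first [k] pieces
    are met.  Recording only the last pair of closed sets loses nothing, because
    the requirements persist. *)
Definition is_node (z : A) : Prop :=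
  exists k C C', z = opair k (opair C C') /\ k ∈ w /\
    is_closed P T C /\ is_closed P T C' /\ subset C a /\ subset C' b /\
    (exists x, x ∈ C) /\ (exists x, x ∈ C') /\
    forall n, n ∈ k -> many_or_related s Z al k n C C'.

Definition node_below (z z' : A) : Prop :=
  exists k C C' l D D', z = opair k (opair C C') /\ z' = opair l (opair D D') /\
    l ∈ k /\ subset C D /\ subset C' D'.

Lemma node_below_definable : definable (fun e => node_below (e 0) (e 1)).
Proof. unfold node_below. definability. Qed.

Lemma node_below_opair k C C' l D D' :
  node_below (opair k (opair C C')) (opair l (opair D D')) <->
  l ∈ k /\ subset C D /\ subset C' D'.
Proof.
  split.
  - intros (k1 & C1 & C1' & l1 & D1 & D1' & E & E' & H).
    apply opair_inj in E. apply opair_inj in E'.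
    destruct E as [-> E]. destruct E' as [-> E'].
    apply opair_inj in E. apply opair_inj in E'.
    destruct E as [-> ->]. destruct E' as [-> ->]. exact H.
  - intros H. exists k, C, C', l, D, D'. auto.
Qed.

Lemma exists_nodes : exists Nd, forall z, z ∈ Nd <-> is_node z.
Proof.
  destruct (zfc_power A HA P) as [PP HPP].
  destruct (exists_product PP PP) as [X HX].
  destruct (exists_product w X) as [Y HY].
  destruct (separation is_node Y) as [Nd HNd].
  { unfold is_node. definability. }
  exists Nd. intros z. rewrite HNd. split; [tauto|]. intros H. split; [|exact H].
  destruct H as (k & C & C' & -> & Hk & HC & HC' & _).
  apply HY. exists k, (opair C C'). split; [exact Hk|]. split; [|reflexivity].
  apply HX. exists C, C'. split; [apply HPP, HC|]. split; [apply HPP, HC'|reflexivity].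
Qed.

(** Instead of choosing a branch step by step, take a maximal linearly ordered set
    of nodes; it has nodes of arbitrarily high level. *)
Lemma branch_chain S :
  (forall z, z ∈ S -> is_node z) -> (exists z, z ∈ S) ->
  (forall z, z ∈ S -> exists y, y ∈ S /\ node_below y z) ->
  exists c, subset c S /\
    (forall y z, y ∈ c -> z ∈ c -> y = z \/ node_below y z \/ node_below z y) /\
    forall i, i ∈ w -> exists k C C', opair k (opair C C') ∈ c /\ i ∈ k.
Proof.
  intros HS [z0 Hz0] Hdown. pose proof node_below_definable as HD.
  pose (linear := fun c => forall y z, y ∈ c -> z ∈ c ->
    y = z \/ node_below y z \/ node_below z y).
  destruct (zfc_power A HA S) as [PS HPS].
  destruct (separation linear PS) as [FF HFF].
  { unfold linear. definability. }
  destruct (exists_singleton z0) as [c0 Hc0].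
  destruct (zorn FF c0) as (c & Hc & Hc0c & Hmax).
  - apply HFF. split.
    + apply HPS. intros z Hz. apply Hc0 in Hz. subst z. exact Hz0.
    + intros y z Hy Hz. apply Hc0 in Hy. apply Hc0 in Hz. subst. auto.
  - intros d u Hd _ Hch Hu. apply HFF. split.
    + apply HPS. intros z Hz. apply Hu in Hz. destruct Hz as (e & He & Hz).
      apply Hd, HFF in He. apply (HPS e); [apply He|exact Hz].
    + intros y z Hy Hz. apply Hu in Hy. apply Hu in Hz.
      destruct Hy as (e & He & Hy). destruct Hz as (e' & He' & Hz).
      destruct (Hch e e' He He') as [H|H].
      * apply Hd, HFF in He'. apply He'; auto.
      * apply Hd, HFF in He. apply He; auto.
  - apply HFF in Hc. destruct Hc as [HcS Hlin]. apply HPS in HcS.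
    exists c. split; [exact HcS|]. split; [exact Hlin|].
    assert (Hz0c : z0 ∈ c) by (apply Hc0c, Hc0; reflexivity).
    (* A node of the chain without a successor in the chain would be its last
       one, and the chain could be extended below it. *)
    assert (Hnext : forall z, z ∈ c -> exists y, y ∈ c /\ node_below y z).
    { intros z Hz. apply NNPP. intros N.
      destruct (Hdown z (HcS z Hz)) as (y & HyS & Hyz).
      destruct (exists_adjoin c y) as [c' Hc'].
      assert (Hyt : forall t, t ∈ c -> node_below y t).
      { intros t Ht. destruct (Hlin t z Ht Hz) as [->|[H|H]]; [exact Hyz| |].
        - destruct N. eauto.
        - destruct (HS y HyS) as (k & C & C' & -> & Hk & _).
          destruct (HS z (HcS z Hz)) as (l & D & D' & -> & Hl & _).
          destruct (HS t (HcS t Ht)) as (m & E & E' & -> & Hm & _).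
          apply node_below_opair in H. apply node_below_opair in Hyz.
          apply node_below_opair. destruct H as (H1 & H2 & H3).
          destruct Hyz as (H4 & H5 & H6). split; [|split].
          + exact (omega_trans w Hw k l m Hk H4 H1).
          + intros x Hx. apply H2, H5, Hx.
          + intros x Hx. apply H3, H6, Hx. }
      assert (E : c' = c).
      { apply Hmax.
        - apply HFF. split.
          + apply HPS. intros x Hx. apply Hc' in Hx. destruct Hx as [Hx| ->]; auto.
          + intros u v Hu Hv. apply Hc' in Hu. apply Hc' in Hv.
            destruct Hu as [Hu| ->], Hv as [Hv| ->]; auto.
        - intros x Hx. apply Hc'. auto. }
      apply N. exists y. split; [|exact Hyz]. rewrite <- E. apply Hc'. auto. }
    apply (omega_ind w Hw (fun i => exists k C C', opair k (opair C C') ∈ c /\ i ∈ k));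
      [definability|..].
    + intros o Ho. destruct (Hnext z0 Hz0c) as (y & Hy & Hyz).
      destruct (HS y (HcS y Hy)) as (k & C & C' & -> & Hk & _).
      exists k, C, C'. split; [exact Hy|].
      destruct (omega_empty_le w Hw k o Hk Ho) as [H| ->]; [exact H|].
      destruct (HS z0 Hz0) as (l & D & D' & -> & _).
      apply node_below_opair in Hyz. destruct (Ho l). tauto.
    + intros i i' Hi (k & C & C' & Hkc & Hik) Hi'.
      destruct (Hnext _ Hkc) as (y & Hy & Hyz).
      destruct (HS y (HcS y Hy)) as (l & D & D' & -> & Hl & _).
      exists l, D, D'. split; [exact Hy|]. apply node_below_opair in Hyz.
      destruct Hyz as (Hkl & _).
      destruct (omega_succ_le w Hw k i i') as [H| ->]; auto.
      * exact (omega_mem w Hw l k Hl Hkl).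
      * exact (omega_trans w Hw l k i' Hl Hkl H).
Qed.

(** The closed sets along the branch are directed, so compactness gives a common
    point on either side.  Either a fixed piece has [k]-element subfamilies through
    [x] for all high levels [k], and the order of [x] is infinite there, or the
    second alternative occurs at some level. *)
Lemma branch_points S :
  (forall z, z ∈ S -> is_node z) -> (exists z, z ∈ S) ->
  (forall z, z ∈ S -> exists y, y ∈ S /\ node_below y z) ->
  is_function_on s w ->
  exists x y, x ∈ a /\ y ∈ b /\ forall n V, rel s n V ->
    ~ finite_ord x V \/ exists E E', x ∈ E /\ y ∈ E' /\ rel al n (opair E E').
Proof.
  intros HS Hne Hdown Hs.
  destruct (branch_chain S HS Hne Hdown) as (c & HcS & Hlin & Hunb).
  destruct (zfc_power A HA P) as [PP HPP].
  assert (Hnode : forall k C C', opair k (opair C C') ∈ c -> k ∈ w /\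
    is_closed P T C /\ is_closed P T C' /\ subset C a /\ subset C' b /\
    (exists x, x ∈ C) /\ (exists x, x ∈ C') /\
    forall n, n ∈ k -> many_or_related s Z al k n C C').
  { intros k C C' H. apply HcS, HS in H.
    destruct H as (k1 & C1 & C1' & E & H). apply opair_inj in E.
    destruct E as [-> E]. apply opair_inj in E. destruct E as [-> ->]. exact H. }
  assert (Hdir : forall k C C' l D D', opair k (opair C C') ∈ c ->
    opair l (opair D D') ∈ c -> (subset C D /\ subset C' D') \/ (subset D C /\ subset D' C')).
  { intros k C C' l D D' H1 H2. destruct (Hlin _ _ H1 H2) as [E|[H|H]].
    - apply opair_inj in E. destruct E as [-> E]. apply opair_inj in E.
      destruct E as [-> ->]. left. split; intros z; auto.
    - apply node_below_opair in H. tauto.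
    - apply node_below_opair in H. tauto. }
  destruct exists_empty as [o Ho].
  destruct (Hunb o (omega_empty w Hw o Ho)) as (k0 & C0 & C0' & H0 & _).
  destruct (separation (fun C => exists k C', opair k (opair C C') ∈ c) PP) as [K HK];
    [definability|].
  destruct (separation (fun C' => exists k C, opair k (opair C C') ∈ c) PP) as [K' HK'];
    [definability|].
  assert (HK1 : forall k C C', opair k (opair C C') ∈ c -> C ∈ K).
  { intros k C C' H. apply HK. split; [|eauto]. apply HPP. apply (Hnode k C C' H). }
  assert (HK1' : forall k C C', opair k (opair C C') ∈ c -> C' ∈ K').
  { intros k C C' H. apply HK'. split; [|eauto]. apply HPP. apply (Hnode k C C' H). }
  destruct (compact_directed P T HPT K) as [x Hx].
  { eauto. }
  { intros C HC. apply HK in HC. destruct HC as (_ & k & C' & H).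
    apply Hnode in H. tauto. }
  { intros C D HC HD. apply HK in HC. apply HK in HD.
    destruct HC as (_ & k & C' & HC). destruct HD as (_ & l & D' & HD).
    destruct (Hdir _ _ _ _ _ _ HC HD) as [[H _]|[H _]].
    - exists C. split; [eauto|]. split; [intros z; auto|exact H].
    - exists D. split; [eauto|]. split; [exact H|intros z; auto]. }
  destruct (compact_directed P T HPT K') as [y Hy].
  { eauto. }
  { intros C' HC. apply HK' in HC. destruct HC as (_ & k & C & H).
    apply Hnode in H. tauto. }
  { intros C' D' HC HD. apply HK' in HC. apply HK' in HD.
    destruct HC as (_ & k & C & HC). destruct HD as (_ & l & D & HD).
    destruct (Hdir _ _ _ _ _ _ HC HD) as [[_ H]|[_ H]].
    - exists C'. split; [eauto|]. split; [intros z; auto|exact H].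
    - exists D'. split; [eauto|]. split; [exact H|intros z; auto]. }
  exists x, y. split; [|split].
  - destruct (Hnode _ _ _ H0) as (_ & _ & _ & Ha & _). apply Ha, Hx. eauto.
  - destruct (Hnode _ _ _ H0) as (_ & _ & _ & _ & Hb & _). apply Hb, Hy. eauto.
  - intros n V HV. apply or_comm. apply NNPP. intros N.
    assert (HN1 : ~ exists E E', x ∈ E /\ y ∈ E' /\ rel al n (opair E E')) by tauto.
    assert (HN2 : finite_ord x V) by (apply NNPP; tauto).
    destruct HN2 as (t & Ht & Htfin). apply (is_finite_iff w t Hw) in Htfin.
    destruct Htfin as (m & Hm & Hmt).
    pose proof (function_on_dom s w n V Hs HV) as Hn.
    (* Above level [n] the requirement for [n] is in force; above the size [m] of
       the trace of [x] its first alternative is impossible. *)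
    assert (Hl : exists k C C', opair k (opair C C') ∈ c /\ m ∈ k /\ n ∈ k).
    { destruct (omega_total w Hw m n Hm Hn) as [H|[<-|H]].
      - destruct (Hunb n Hn) as (k & C & C' & Hk & Hnk). exists k, C, C'.
        split; [exact Hk|]. split; [|exact Hnk]. apply Hnode in Hk.
        exact (omega_trans w Hw k n m (proj1 Hk) Hnk H).
      - destruct (Hunb m Hm) as (k & C & C' & Hk & Hnk). exists k, C, C'. auto.
      - destruct (Hunb m Hm) as (k & C & C' & Hk & Hmk). exists k, C, C'.
        split; [exact Hk|]. split; [exact Hmk|]. apply Hnode in Hk.
        exact (omega_trans w Hw k m n (proj1 Hk) Hmk H). }
    destruct Hl as (k & C & C' & Hk & Hmk & Hnk).
    assert (HxC : x ∈ C) by (apply Hx; eauto).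
    assert (HyC : y ∈ C') by (apply Hy; eauto).
    destruct (Hnode k C C' Hk) as (Hkw & _ & _ & _ & _ & _ & _ & Hcond).
    destruct (Hcond n Hnk) as [(V' & F & HV' & HF & HFV & HCF)|(E & E' & HCE & HCE' & Hal)].
    + rewrite <- (function_on_unique s w n V V' Hs HV HV') in HFV.
      destruct (equipotent_subset_le w m k t F Hw Hm Hkw Hmt) as [H|H].
      * apply (HZ k F HF).
      * intros B HB. apply Ht. split; [apply HFV, HB|apply (HCF B HB), HxC].
      * exact (not_mem_cycle m k Hmk H).
      * subst k. exact (not_mem_self m Hmk).
    + apply HN1. exists E, E'. split; [apply HCE, HxC|].
      split; [apply HCE', HyC|exact Hal].
Qed.

End Nodes.

Section Reflection.
Context {M N : set_structure} {HM : ZFC M} {HN : ZFC N}.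
Context (j : M -> N) (Hj : transitive_embedding j).
Context (P T D R : M) (HPT : is_compact_top P T)
  (HD : forall C, C ∈ D <-> is_closed P T C)
  (HL : normal_lattice (j P) (j D) (j R)).
Context (w s : M) (Hw : is_omega w) (Hs : is_function_on s w)
  (HsT : forall n V, rel s n V -> subset V T).

Let j_mem := te_mem j Hj.

Lemma ultra_elim p C : is_ultrafilter (j D) (j R) p -> C ∈ p ->
  exists C', C = j C' /\ is_closed P T C'.
Proof.
  intros Hp HC. apply (ultra_subset _ _ p Hp) in HC.
  apply (j_elim j Hj) in HC. destruct HC as (C' & HC' & ->).
  exists C'. split; [reflexivity|apply HD, HC'].
Qed.

(** The relation between numbers and sets of that size, as a set of the smaller
    model to serve as a parameter in both. *)
Lemma exists_sizes : exists Z : M, forall k F, rel Z k F <->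
  k ∈ w /\ subset F T /\ equipotent k F.
Proof.
  destruct (zfc_power M HM T) as [PT HPT'].
  destruct (exists_relation (fun k F => equipotent k F) w PT) as [Z [HZ _]]; [definability|].
  exists Z. intros k F. rewrite HZ, (HPT' F). tauto.
Qed.

(** A finite subset of [j V] never exhausts an infinite trace, so it can always be
    enlarged by one element; the enlarged set is again a ground set. *)
Lemma many_inside Z p n V :
  (forall k F, rel Z k F <-> k ∈ w /\ subset F T /\ equipotent k F) ->
  rel s n V -> ~ finite_inside p (j V) ->
  forall k, k ∈ j w -> exists F, rel (j Z) k F /\ subset F (j V) /\
    is_finite F /\ forall B, B ∈ F -> inside p B.
Proof.
  intros HZ HV Hinf.
  apply (omega_ind (j w) (j_omega j Hj w Hw) (fun k => exists F, rel (j Z) k F /\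
    subset F (j V) /\ is_finite F /\ forall B, B ∈ F -> inside p B)); [definability|..].
  - intros o Ho. destruct (exists_empty (A := M)) as [e He].
    pose proof (proj2 (j_empty j Hj e) He) as Hje.
    rewrite (empty_unique o (j e) Ho Hje).
    exists (j e). split; [|split; [|split]].
    + apply (j_rel j Hj), HZ. split; [exact (omega_empty w Hw e He)|].
      split; [intros z Hz; destruct (He z Hz)|exact (equipotent_empty e e He He)].
    + intros z Hz. destruct (Hje z Hz).
    + exact (finite_empty _ Hje).
    + intros z Hz. destruct (Hje z Hz).
  - intros k k' Hk (F & HF & HFV & Hfin & Hin) Hk'.
    assert (HB : exists B, B ∈ j V /\ inside p B /\ B ∉ F).
    { apply NNPP. intros N0. apply Hinf. exists F. split; [|exact Hfin].
      intros B. split; [intros HB; auto|]. intros [HB HBp]. apply NNPP. intros HBF.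
      apply N0. eauto. }
    destruct HB as (B & HBV & HBp & HBF).
    apply (j_rel_elim j Hj) in HF. destruct HF as (k0 & F0 & -> & -> & HF).
    apply (j_elim j Hj) in HBV. destruct HBV as (B0 & HB0 & ->).
    apply j_mem in Hk.
    destruct (exists_succ k0) as [k1 Hk1].
    rewrite (succ_unique k' (j k1) (j k0) Hk' (j_succ j Hj k1 k0 Hk1)).
    destruct (exists_adjoin F0 B0) as [F1 HF1].
    assert (HF1' : forall z, z ∈ j F1 <-> z ∈ j F0 \/ z = j B0).
    { apply (j_members j Hj F1 _ (fun z => z ∈ j F0 \/ z = j B0) HF1).
      - intros t. rewrite j_mem, (j_eq j Hj). tauto.
      - intros t [Ht| ->]; [exact (te_range j Hj F0 t Ht)|eauto]. }
    exists (j F1). split; [|split; [|split]].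
    + apply (j_rel j Hj). apply HZ in HF. destruct HF as (_ & HFT & E). apply HZ.
      split; [exact (omega_succ w Hw k0 k1 Hk Hk1)|]. split.
      * intros z Hz. apply HF1 in Hz.
        destruct Hz as [Hz| ->]; [auto|exact (HsT n V HV B0 HB0)].
      * apply (equipotent_adjoin k0 k1 F0 F1 B0 E Hk1); [|exact HF1].
        intros H. apply HBF, j_mem, H.
    + intros z Hz. apply HF1' in Hz.
      destruct Hz as [Hz| ->]; [auto|apply j_mem, HB0].
    + exact (finite_adjoin (j F0) (j F1) (j B0) Hfin HF1').
    + intros z Hz. apply HF1' in Hz. destruct Hz as [Hz| ->]; auto.
Qed.

Lemma many_or_related_absolute Z al k n C C' :
  many_or_related (j s) (j Z) (j al) (j k) (j n) (j C) (j C') ->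
  many_or_related s Z al k n C C'.
Proof.
  intros [(V & F & HV & HF & HFV & H)|(E & E' & HE & HE' & H)].
  - left.
    apply (j_rel_elim j Hj) in HV. destruct HV as (n0 & V0 & En & -> & HV).
    apply (j_rel_elim j Hj) in HF. destruct HF as (k0 & F0 & Ek & -> & HF).
    apply (j_inj j Hj) in En. apply (j_inj j Hj) in Ek. subst n0 k0.
    exists V0, F0. split; [exact HV|]. split; [exact HF|].
    split; [apply (j_subset j Hj), HFV|]. intros B HB.
    apply (j_subset j Hj), H, j_mem, HB.
  - right. assert (H' := H).
    apply (j_rel_elim j Hj) in H. destruct H as (_ & q & _ & Eq & _).
    symmetry in Eq. apply (j_opair_inv j Hj) in Eq.
    destruct Eq as (E0 & E0' & -> & -> & _). exists E0, E0'.
    split; [apply (j_subset j Hj), HE|]. split; [apply (j_subset j Hj), HE'|].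
    rewrite (j_opair j Hj) in H'. apply (j_rel j Hj), H'.
Qed.

(** The pairs of members of [p] and [q] that are nodes form a subset of the tree
    without minimal element in the larger model.  Hence the tree is ill-founded in
    the smaller model as well, and [branch_points] applies there. *)
Theorem reflection (al a b : M) (p q : N) :
  is_closed P T a -> is_closed P T b ->
  is_ultrafilter (j D) (j R) p -> is_ultrafilter (j D) (j R) q ->
  j a ∈ p -> j b ∈ q ->
  (forall n V, rel s n V -> ~ finite_inside p (j V) \/
     exists E E', j E ∈ p /\ j E' ∈ q /\ rel al n (opair E E')) ->
  exists x y, x ∈ a /\ y ∈ b /\ forall n V, rel s n V ->
    ~ finite_ord x V \/ exists E E', x ∈ E /\ y ∈ E' /\ rel al n (opair E E').
Proof.
  intros Ha Hb Hp Hq Hap Hbq Hgen.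
  destruct exists_sizes as [Z HZ].
  assert (HZ1 : forall k F, rel Z k F -> k ∈ w /\ equipotent k F).
  { intros k F H. apply HZ in H. tauto. }
  destruct (exists_nodes P T w s Z al a b) as [Nd HNd].
  apply NNPP. intros Hno.
  assert (Hwf : forall S, subset S Nd -> (exists x, x ∈ S) ->
    exists x, x ∈ S /\ forall y, y ∈ S -> ~ node_below y x).
  { intros S HS Hne. apply NNPP. intros N0. apply Hno.
    apply (branch_points P T HPT w s Z al a b Hw HZ1 S); [..|exact Hs].
    - intros z Hz. apply HNd, HS, Hz.
    - exact Hne.
    - intros z Hz. apply NNPP. intros N1. apply N0. exists z. split; [exact Hz|].
      intros y Hy Hyz. apply N1. eauto. }
  assert (Habs : forall z z', node_below (j z) (j z') -> node_below z z').
  { intros z z' (k & C & C' & l & E & E' & Ez & Ez' & Hlk & HC & HC').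
    destruct (j_opair_inv j Hj _ _ _ Ez) as (k0 & y & -> & Ey & ->).
    destruct (j_opair_inv j Hj _ _ _ (eq_sym Ey)) as (C0 & C0' & -> & -> & ->).
    destruct (j_opair_inv j Hj _ _ _ Ez') as (l0 & y' & -> & Ey' & ->).
    destruct (j_opair_inv j Hj _ _ _ (eq_sym Ey')) as (E0 & E0' & -> & -> & ->).
    apply node_below_opair. split; [apply j_mem, Hlk|].
    split; apply (j_subset j Hj); assumption. }
  destruct (separation (fun z => exists k C C', z = opair k (opair C C') /\
    C ∈ p /\ C' ∈ q) (j Nd)) as [S HS]; [definability|].
  destruct (well_founded_absolute j Hj Nd node_below node_below
    node_below_definable Hwf Habs S) as (z & Hz & Hmin).
  { intros z Hz. apply HS in Hz. tauto. }
  { destruct (exists_empty (A := M)) as [o Ho].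
    exists (j (opair o (opair a b))). apply HS. split.
    - apply j_mem, HNd. exists o, a, b. split; [reflexivity|].
      split; [exact (omega_empty w Hw o Ho)|]. split; [exact Ha|]. split; [exact Hb|].
      split; [intros t; auto|]. split; [intros t; auto|]. split; [|split].
      + apply NNPP. intros N0. apply (ultra_empty _ _ _ HL p Hp (j a)); [|exact Hap].
        apply (j_empty j Hj). intros t Ht. apply N0. eauto.
      + apply NNPP. intros N0. apply (ultra_empty _ _ _ HL q Hq (j b)); [|exact Hbq].
        apply (j_empty j Hj). intros t Ht. apply N0. eauto.
      + intros n Hn. destruct (Ho n Hn).
    - exists (j o), (j a), (j b). rewrite !(j_opair j Hj). auto. }
  apply HS in Hz. destruct Hz as (HzNd & k' & C' & C2' & Ez & HCp & HCq).
  apply (j_elim j Hj) in HzNd. destruct HzNd as (z0 & Hz0 & ->).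
  apply HNd in Hz0.
  destruct Hz0 as (k & C & C2 & -> & Hk & HC & HC2 & HCa & HCb & _).
  rewrite <- !(j_opair j Hj) in Ez. apply opair_inj in Ez. destruct Ez as [<- Ez].
  apply opair_inj in Ez. destruct Ez as [<- <-].
  destruct (exists_succ k) as [l Hl].
  assert (Hlw : l ∈ w) by exact (omega_succ w Hw k l Hk Hl).
  (* A node at the next level: its requirements, one for each element of [l], are
     met by intersecting, along an induction on [i] inside the larger model. *)
  assert (Hstep : forall i, i ∈ j w -> subset i (j l) -> exists E E2, E ∈ p /\ E2 ∈ q /\
    subset E (j C) /\ subset E2 (j C2) /\
    forall n, n ∈ i -> many_or_related (j s) (j Z) (j al) (j l) n E E2).
  { apply (omega_ind (j w) (j_omega j Hj w Hw) (fun i => subset i (j l) ->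
      exists E E2, E ∈ p /\ E2 ∈ q /\ subset E (j C) /\ subset E2 (j C2) /\
      forall n, n ∈ i -> many_or_related (j s) (j Z) (j al) (j l) n E E2));
      [definability|..].
    - intros o Ho _. exists (j C), (j C2). split; [exact HCp|]. split; [exact HCq|].
      split; [intros t; auto|]. split; [intros t; auto|].
      intros n Hn. destruct (Ho n Hn).
    - intros i i' Hi IH Hi' Hsub.
      destruct IH as (E & E2 & HE & HE2 & HEC & HEC2 & Hcond).
      { intros t Ht. apply Hsub, Hi'. auto. }
      apply (j_elim j Hj) in Hi. destruct Hi as (n & Hn & ->).
      destruct (function_on_total s w n Hs Hn) as [V HV].
      assert (HG : exists G G2, G ∈ p /\ G2 ∈ q /\
        many_or_related (j s) (j Z) (j al) (j l) (j n) G G2).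
      { destruct (Hgen n V HV) as [Hinf|(G & G2 & HG & HG2 & Hal)].
        - destruct (many_inside Z p n V HZ HV Hinf (j l)) as (F & HF & HFV & Hfin & Hin);
            [apply j_mem, Hlw|].
          destruct (inside_all _ _ _ HL p Hp F Hfin Hin) as (G & HG & HGF).
          exists G, (j C2). split; [exact HG|]. split; [exact HCq|].
          left. exists (j V), F. split; [apply (j_rel j Hj), HV|]. auto.
        - exists (j G), (j G2). split; [exact HG|]. split; [exact HG2|].
          right. exists (j G), (j G2). split; [intros t; auto|].
          split; [intros t; auto|]. rewrite (j_opair j Hj). apply (j_rel j Hj), Hal. }
      destruct HG as (G & G2 & HG & HG2 & HGcond).
      destruct (exists_inter E G) as [X HX]. destruct (exists_inter E2 G2) as [X2 HX2].
      assert (Hmono : forall m Y Y2, subset X Y -> subset X2 Y2 ->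
        many_or_related (j s) (j Z) (j al) (j l) m Y Y2 ->
        many_or_related (j s) (j Z) (j al) (j l) m X X2).
      { intros m Y Y2 HXY HXY2 [(V' & F & H1 & H2 & H3 & H4)|(U & U2 & H1 & H2 & H3)].
        - left. exists V', F. split; [exact H1|]. split; [exact H2|].
          split; [exact H3|]. intros B HB t Ht. apply (H4 B HB), HXY, Ht.
        - right. exists U, U2. split; [intros t Ht; apply H1, HXY, Ht|].
          split; [intros t Ht; apply H2, HXY2, Ht|exact H3]. }
      assert (HXE : subset X E) by (intros t Ht; apply HX in Ht; tauto).
      assert (HXG : subset X G) by (intros t Ht; apply HX in Ht; tauto).
      assert (HXE2 : subset X2 E2) by (intros t Ht; apply HX2 in Ht; tauto).
      assert (HXG2 : subset X2 G2) by (intros t Ht; apply HX2 in Ht; tauto).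
      exists X, X2. split; [exact (ultra_inter _ _ _ HL p Hp E G X HE HG HX)|].
      split; [exact (ultra_inter _ _ _ HL q Hq E2 G2 X2 HE2 HG2 HX2)|].
      split; [intros t Ht; apply HEC, HXE, Ht|].
      split; [intros t Ht; apply HEC2, HXE2, Ht|].
      intros m Hm. apply Hi' in Hm. destruct Hm as [Hm| ->].
      + apply (Hmono m E E2); auto.
      + apply (Hmono (j n) G G2); auto. }
  destruct (Hstep (j l)) as (E & E2 & HE & HE2 & HEC & HEC2 & Hcond).
  { apply j_mem, Hlw. }
  { intros t; auto. }
  destruct (ultra_elim p E Hp HE) as (E0 & -> & HE0).
  destruct (ultra_elim q E2 Hq HE2) as (E1 & -> & HE1).
  apply (Hmin (j (opair l (opair E0 E1)))).
  - apply HS. split.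
    + apply j_mem, HNd. exists l, E0, E1. split; [reflexivity|].
      split; [exact Hlw|]. split; [exact HE0|]. split; [exact HE1|].
      apply (j_subset j Hj) in HEC. apply (j_subset j Hj) in HEC2.
      split; [intros t Ht; apply HCa, HEC, Ht|].
      split; [intros t Ht; apply HCb, HEC2, Ht|]. split; [|split].
      * apply NNPP. intros N0. apply (ultra_empty _ _ _ HL p Hp (j E0)); [|exact HE].
        apply (j_empty j Hj). intros t Ht. apply N0. eauto.
      * apply NNPP. intros N0. apply (ultra_empty _ _ _ HL q Hq (j E1)); [|exact HE2].
        apply (j_empty j Hj). intros t Ht. apply N0. eauto.
      * intros n Hn. apply many_or_related_absolute, Hcond, j_mem, Hn.
    + exists (j l), (j E0), (j E1). rewrite !(j_opair j Hj). auto.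
  - rewrite <- !(j_opair j Hj). apply node_below_opair.
    split; [apply j_mem, Hl; auto|]. auto.
Qed.

End Reflection.

(** * Gul'ko compact spaces *)

Section Lattice.
Context {A : set_structure} {HA : ZFC A}.
Context (P T : A) (HPT : is_compact_top P T).

Lemma exists_closed_lattice X : is_opair X P T ->
  exists L D R, is_opair L D R /\ is_closed_lattice X L /\
    (forall C, C ∈ D <-> is_closed P T C) /\
    (forall B C, rel R B C <-> B ∈ D /\ C ∈ D /\ subset B C).
Proof.
  intros HX. destruct (zfc_power A HA P) as [PP HPP].
  destruct (separation (fun C => is_closed P T C) PP) as [D HD]; [definability|].
  assert (HD' : forall C, C ∈ D <-> is_closed P T C).
  { intros C. rewrite HD, (HPP C). split; [tauto|]. intros H. split; [apply H|exact H]. }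
  destruct (exists_relation (fun B C => subset B C) D D) as (R & HR & HRp); [definability|].
  exists (opair D R), D, R. split; [apply opair_spec|]. split; [|auto].
  exists P, T, D, R. split; [exact HX|]. split; [apply opair_spec|].
  split; [exact HD'|]. intros r. split.
  - intros Hr. destruct (HRp r Hr) as (B & C & _ & _ & ->). exists B, C.
    apply rel_iff, HR in Hr. destruct Hr as (HB & HC & HBC).
    split; [exact HB|]. split; [exact HC|]. split; [exact HBC|apply opair_spec].
  - intros (B & C & HB & HC & HBC & E). apply is_opair_iff in E. subst r.
    apply rel_iff, HR. auto.
Qed.

Lemma compact_normal_closed B C : is_closed P T B -> is_closed P T C -> disjoint B C ->
  exists E F, is_closed P T E /\ is_closed P T F /\ disjoint B F /\ disjoint C E /\
    forall z, z ∈ P -> z ∈ E \/ z ∈ F.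
Proof.
  intros HB HC Hd.
  destruct (compact_normal P T HPT B C HB HC Hd) as (U & V & HU & HV & HBU & HCV & Hdis).
  destruct (exists_diff P V) as [E HE]. destruct (exists_diff P U) as [F HF].
  exists E, F. split; [exact (compl_closed P T HPT V E HV HE)|].
  split; [exact (compl_closed P T HPT U F HU HF)|]. split; [|split].
  - intros z [H1 H2]. apply HF in H2. apply H2, HBU, H1.
  - intros z [H1 H2]. apply HE in H2. apply H2, HCV, H1.
  - intros z Hz. rewrite (HE z), (HF z). destruct (classic (z ∈ U)) as [HzU|HzU].
    + left. split; [exact Hz|]. intros HzV. apply (Hdis z). auto.
    + right. auto.
Qed.

End Lattice.

Section Gulko.
Context {M N : set_structure} {HM : ZFC M} {HN : ZFC N}.
Context (j : M -> N) (Hj : transitive_embedding j).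
Context (P T D R : M) (HPT : is_compact_top P T)
  (HD : forall C, C ∈ D <-> is_closed P T C)
  (HR : forall B C, rel R B C <-> B ∈ D /\ C ∈ D /\ subset B C).

Let j_mem := te_mem j Hj.

Lemma closed_normal_lattice : normal_lattice (j P) (j D) (j R).
Proof.
  split.
  - intros C HC. apply (j_elim j Hj) in HC. destruct HC as (C' & HC & ->).
    apply (j_subset j Hj). apply HD in HC. apply HC.
  - intros o Ho. destruct (exists_empty (A := M)) as [e He].
    rewrite (empty_unique o (j e) Ho (proj2 (j_empty j Hj e) He)).
    apply j_mem, HD, (closed_empty P T HPT e He).
  - apply j_mem, HD, (closed_full P T HPT).
  - intros B C E HB HC HE.
    apply (j_elim j Hj) in HB. destruct HB as (B' & HB & ->).
    apply (j_elim j Hj) in HC. destruct HC as (C' & HC & ->).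
    destruct (exists_inter B' C') as [E' HE'].
    replace E with (j E').
    + apply j_mem, HD. apply HD in HB. apply HD in HC.
      exact (closed_inter2 P T HPT B' C' E' HB HC HE').
    + apply set_ext. intros z. rewrite (HE z), (j_inter j Hj E' B' C' HE' z). tauto.
  - intros B C E HB HC HE.
    apply (j_elim j Hj) in HB. destruct HB as (B' & HB & ->).
    apply (j_elim j Hj) in HC. destruct HC as (C' & HC & ->).
    destruct (exists_union2 B' C') as [E' HE'].
    replace E with (j E').
    + apply j_mem, HD. apply HD in HB. apply HD in HC.
      exact (closed_union2 P T HPT B' C' E' HB HC HE').
    + apply set_ext. intros z. rewrite HE, (j_union2 j Hj E' B' C' HE' z). tauto.
  - intros B C HB HC Hd.
    apply (j_elim j Hj) in HB. destruct HB as (B' & HB & ->).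
    apply (j_elim j Hj) in HC. destruct HC as (C' & HC & ->).
    apply (j_disjoint j Hj) in Hd. apply HD in HB. apply HD in HC.
    destruct (compact_normal_closed P T HPT B' C' HB HC Hd) as (E & F & HE & HF & H1 & H2 & H3).
    exists (j E), (j F). rewrite !j_mem, !HD, !(j_disjoint j Hj).
    repeat (split; [assumption|]). intros z Hz.
    apply (j_elim j Hj) in Hz. destruct Hz as (z' & Hz & ->). rewrite !j_mem. auto.
  - intros B C. split.
    + intros H. apply (j_rel_elim j Hj) in H. destruct H as (B' & C' & -> & -> & H).
      rewrite !j_mem, (j_subset j Hj). apply HR, H.
    + intros (HB & HC & H).
      apply (j_elim j Hj) in HB. destruct HB as (B' & HB & ->).
      apply (j_elim j Hj) in HC. destruct HC as (C' & HC & ->).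
      apply (j_rel j Hj), HR. apply (j_subset j Hj) in H. auto.
Qed.

Let HL := closed_normal_lattice.

Let ultra_closed := ultra_elim j Hj P T D R HD.

Lemma inside_compl p B C : is_ultrafilter (j D) (j R) p ->
  B ∈ T -> is_diff C P B -> inside p (j B) <-> j C ∉ p.
Proof.
  intros Hp HB HC. split.
  - intros (E & HE & HEB) HCp.
    apply (ultra_not_disjoint _ _ _ HL p Hp E (j C) HE HCp).
    intros z [H1 H2]. apply HEB in H1. apply (j_elim j Hj) in H1.
    destruct H1 as (t & Ht & ->). apply j_mem, HC in H2. tauto.
  - intros HCp. destruct (ultra_disjoint _ _ _ HL p Hp (j C)) as (E & HE & Hd).
    + apply j_mem, HD. exact (compl_closed P T HPT B C HB HC).
    + exact HCp.
    + exists E. split; [exact HE|].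
      destruct (ultra_closed p E Hp HE) as (E' & -> & HE').
      apply (j_subset j Hj). apply (j_disjoint j Hj) in Hd.
      intros z Hz. apply NNPP. intros HzB. apply (Hd z). split; [|exact Hz].
      apply HC. split; [apply HE', Hz|exact HzB].
Qed.

(** The open sets of the larger space commute with unions of ground families,
    because the smaller space is compact. *)
Lemma inside_union p F K : is_ultrafilter (j D) (j R) p ->
  subset F T -> is_closed P T K -> j K ∈ p ->
  (forall x, x ∈ K -> exists B, B ∈ F /\ x ∈ B) ->
  exists B, B ∈ F /\ inside p (j B).
Proof.
  intros Hp HF HK HKp Hcov.
  destruct (compact_subcover P T HPT F K HF HK Hcov) as (G & HG & Hfin & HGcov).
  apply NNPP. intros Hno.
  destruct (ultra_finite_choice _ _ _ HL p Hp (fun C B => disjoint C B) (j G))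
    as (C & HC & HCG); auto.
  - definability.
  - intros C C' B H1 H2 z [Hz1 Hz2]. apply (H2 z). auto.
  - exact (j_finite j Hj G Hfin).
  - intros B HB. apply (j_elim j Hj) in HB. destruct HB as (B' & HB & ->).
    destruct (exists_diff P B') as [E HE]. exists (j E).
    assert (HBT : B' ∈ T) by auto. split.
    + apply NNPP. intros HEp. apply Hno. exists B'. split; [auto|].
      apply (inside_compl p B' E Hp HBT HE), HEp.
    + apply (j_disjoint j Hj). intros z [Hz1 Hz2]. apply HE in Hz1. tauto.
  - apply (ultra_not_disjoint _ _ _ HL p Hp (j K) C HKp HC).
    intros z [H1 H2]. apply (j_elim j Hj) in H1. destruct H1 as (x & Hx & ->).
    destruct (HGcov x Hx) as (B & HB & HxB).
    apply (HCG (j B) (proj2 (j_mem B G) HB) (j x)).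
    split; [exact H2|apply j_mem, HxB].
Qed.

(** The finite trace of [p] is a ground set, so the union of the members of [V]
    outside the trace is an open set of the smaller space; by [inside_union] the
    ultrafilter contains its complement, which is intersected with a member of [p]
    inside all the sets of the trace. *)
Lemma trace_decided p V : is_ultrafilter (j D) (j R) p -> subset V T ->
  finite_inside p (j V) ->
  exists E, is_closed P T E /\ j E ∈ p /\ forall B, B ∈ V ->
    (inside p (j B) /\ subset E B) \/ (~ inside p (j B) /\ disjoint E B).
Proof.
  intros Hp HV (t & Ht & Hfin).
  destruct (finite_subset_ground j Hj V t Hfin) as (G & -> & HGfin & HGV).
  { intros B HB. apply Ht in HB. tauto. }
  destruct (inside_all _ _ _ HL p Hp (j G) Hfin) as (C & HC & HCG).
  { intros B HB. apply Ht in HB. tauto. }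
  destruct (ultra_closed p C Hp HC) as (C' & -> & HC').
  destruct (separation (fun B => B ∉ G) V) as [F HF]; [definability|].
  assert (HFT : subset F T) by (intros B HB; apply HF in HB; apply HV; tauto).
  destruct (separation (fun z => forall B, B ∈ F -> z ∉ B) P) as [E HE]; [definability|].
  assert (HEc : is_closed P T E) by exact (closed_avoiding P T HPT F E HFT HE).
  assert (HEp : j E ∈ p).
  { apply NNPP. intros HEp.
    destruct (ultra_disjoint _ _ _ HL p Hp (j E)) as (K & HK & Hd); [|exact HEp|].
    { apply j_mem, HD, HEc. }
    destruct (ultra_closed p K Hp HK) as (K' & -> & HK').
    apply (j_disjoint j Hj) in Hd.
    destruct (inside_union p F K' Hp HFT HK' HK) as (B & HB & HBp).
    { intros x Hx. apply NNPP. intros Hno. apply (Hd x). split; [|exact Hx].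
      apply HE. split; [apply HK', Hx|]. intros B HB HxB. apply Hno. eauto. }
    apply HF in HB. destruct HB as [HBV HBG]. apply HBG, j_mem, Ht.
    split; [apply j_mem, HBV|exact HBp]. }
  destruct (exists_inter C' E) as [X HX]. exists X.
  split; [exact (closed_inter2 P T HPT C' E X HC' HEc HX)|].
  split; [exact (ultra_inter _ _ _ HL p Hp (j C') (j E) (j X) HC HEp
            (j_inter j Hj X C' E HX))|].
  intros B HB. destruct (classic (B ∈ G)) as [HBG|HBG].
  - left. split; [apply Ht, j_mem, HBG|].
    apply (proj2 (j_mem B G)), HCG, (j_subset j Hj) in HBG.
    intros z Hz. apply HX in Hz. apply HBG. tauto.
  - right. split.
    + intros HBp. apply HBG, j_mem, Ht. split; [apply j_mem, HB|exact HBp].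
    + intros z [Hz1 Hz2]. apply HX in Hz1. destruct Hz1 as [_ Hz1]. apply HE in Hz1.
      apply (proj2 Hz1 B); [apply HF; auto|exact Hz2].
Qed.

Context (U w s : M) (HU : forall B, B ∈ U -> B ∈ T /\ is_F_sigma P T B)
  (HT0 : T0_separating P U) (Hw : is_omega w) (Hs : is_function_on s w)
  (HUs : forall B, B ∈ U <-> exists n V, rel s n V /\ B ∈ V)
  (Hwspf : forall x, x ∈ P -> forall B, B ∈ U <->
     exists n V, rel s n V /\ finite_ord x V /\ B ∈ V).

Lemma family_open n V : rel s n V -> subset V T.
Proof. intros HV B HB. apply HU, HUs. eauto. Qed.

(** A definable ternary relation on numbers and closed sets, as a set.  The
    formula for [Phi] receives its arguments in reverse, as the two bound variables
    come before [n]. *)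
Lemma exists_triples (Phi : M -> M -> M -> Prop) :
  definable (fun e => Phi (e 0) (e 1) (e 2)) ->
  exists al, forall n E E', rel al n (opair E E') <->
    n ∈ w /\ is_closed P T E /\ is_closed P T E' /\ Phi n E E'.
Proof.
  intros (f & c & Hf).
  assert (HPhi : definable (fun e => exists E E', e 1 = opair E E' /\
    is_closed P T E /\ is_closed P T E' /\ Phi (e 0) E E')).
  { apply (definable_ex (fun E e => exists E', e 1 = opair E E' /\
      is_closed P T E /\ is_closed P T E' /\ Phi (e 0) E E')).
    apply (definable_ex (fun E' e => e 2 = opair (e 0) E' /\
      is_closed P T (e 0) /\ is_closed P T E' /\ Phi (e 1) (e 0) E')).
    repeat apply definable_and; [definability..|].
    apply (definable_rename (fun e => Phi (e 0) (e 1) (e 2))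
      (fun n => match n with 0 => 2 | 1 => 1 | _ => 0 end)).
    exists f, c. exact Hf. }
  destruct (zfc_power M HM P) as [PP HPP].
  destruct (exists_product PP PP) as [X HX].
  destruct (exists_relation (fun n z => exists E E', z = opair E E' /\
    is_closed P T E /\ is_closed P T E' /\ Phi n E E') w X HPhi) as (al & Hal & _).
  exists al. intros n E E'. rewrite Hal, HX. split.
  - intros (Hn & _ & E1 & E1' & Eq & H). apply opair_inj in Eq.
    destruct Eq as [<- <-]. auto.
  - intros (Hn & HE & HE' & H). split; [exact Hn|]. split.
    + exists E, E'. split; [apply HPP, HE|]. split; [apply HPP, HE'|reflexivity].
    + exists E, E'. auto.
Qed.

(** Otherwise every piece containing [B] has infinite trace at [p]; relating [n] to
    everything exactly if the [n]-th piece omits [B], reflection yields a point of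
    the smaller space with the same defect. *)
Lemma inside_sigma_point_finite p B : is_ultrafilter (j D) (j R) p -> B ∈ U ->
  exists n V, rel s n V /\ finite_inside p (j V) /\ B ∈ V.
Proof.
  intros Hp HB. apply NNPP. intros Hno.
  destruct (exists_triples (fun n _ _ => exists V, rel s n V /\ B ∉ V)) as [al Hal];
    [definability|].
  pose proof (closed_full P T HPT) as HP.
  destruct (reflection j Hj P T D R HPT HD HL w s Hw Hs family_open al P P p p HP HP Hp Hp)
    as (x & y & Hx & _ & Hxs).
  - exact (ultra_full _ _ _ HL p Hp).
  - exact (ultra_full _ _ _ HL p Hp).
  - intros n V HV. destruct (classic (B ∈ V)) as [HBV|HBV].
    + left. intros Hfin. apply Hno. eauto.
    + right. exists P, P. split; [exact (ultra_full _ _ _ HL p Hp)|].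
      split; [exact (ultra_full _ _ _ HL p Hp)|]. apply Hal.
      split; [exact (function_on_dom s w n V Hs HV)|]. eauto.
  - destruct (proj1 (Hwspf x Hx B) HB) as (n & V & HV & Hfin & HBV).
    destruct (Hxs n V HV) as [H|(E & E' & _ & _ & H)]; [exact (H Hfin)|].
    apply Hal in H. destruct H as (_ & _ & _ & V' & HV' & HBV').
    rewrite (function_on_unique s w n V' V Hs HV' HV) in HBV'. tauto.
Qed.

(** The relation asks the two closed sets to be on the same side of every member of
    the [n]-th piece.  The points [x] and [y] obtained by reflection are then
    unseparated by all pieces in which [x] has finite order, hence by all of [U]. *)
Lemma inside_T0 p q : is_ultrafilter (j D) (j R) p -> is_ultrafilter (j D) (j R) q ->
  (forall B, B ∈ U -> inside p (j B) <-> inside q (j B)) ->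
  forall C E, C ∈ p -> E ∈ q -> ~ disjoint C E.
Proof.
  intros Hp Hq Hsame C E HC HE Hd.
  destruct (ultra_closed p C Hp HC) as (a & -> & Ha).
  destruct (ultra_closed q E Hq HE) as (b & -> & Hb).
  apply (j_disjoint j Hj) in Hd.
  destruct (exists_triples (fun n E E' => exists V, rel s n V /\ forall B, B ∈ V ->
    (subset E B /\ subset E' B) \/ (disjoint E B /\ disjoint E' B))) as [al Hal];
    [definability|].
  destruct (reflection j Hj P T D R HPT HD HL w s Hw Hs family_open al a b p q
    Ha Hb Hp Hq HC HE) as (x & y & Hx & Hy & Hxy).
  - intros n V HV. destruct (classic (finite_inside p (j V))) as [Hfin|Hinf]; [|auto].
    right. pose proof (family_open n V HV) as HVT.
    destruct (trace_decided p V Hp HVT Hfin) as (X & HX & HXp & HXV).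
    destruct (trace_decided q V Hq HVT) as (Y & HY & HYq & HYV).
    { destruct Hfin as (t & Ht & Hfin). exists t. split; [|exact Hfin].
      intros B. rewrite Ht. split; intros [HB H]; (split; [exact HB|]);
        apply (j_elim j Hj) in HB; destruct HB as (B' & HB & ->);
        apply (Hsame B'); auto; apply HUs; eauto. }
    exists X, Y. split; [exact HXp|]. split; [exact HYq|]. apply Hal.
    split; [exact (function_on_dom s w n V Hs HV)|]. split; [exact HX|].
    split; [exact HY|]. exists V. split; [exact HV|]. intros B HB.
    assert (HBU : B ∈ U) by (apply HUs; eauto).
    specialize (Hsame B HBU).
    destruct (HXV B HB) as [[H1 H2]|[H1 H2]], (HYV B HB) as [[H3 H4]|[H3 H4]]; tauto.
  - assert (HxP : x ∈ P) by (apply Ha, Hx). assert (HyP : y ∈ P) by (apply Hb, Hy).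
    assert (Hne : x <> y) by (intros ->; apply (Hd y); auto).
    destruct (HT0 x y HxP HyP Hne) as (B & HB & z & [Hz HzB] & Huniq).
    destruct (proj1 (Hwspf x HxP B) HB) as (n & V & HV & Hfin & HBV).
    destruct (Hxy n V HV) as [H|(X & Y & HxX & HyY & H)]; [exact (H Hfin)|].
    apply Hal in H. destruct H as (_ & _ & _ & V' & HV' & H).
    rewrite (function_on_unique s w n V' V Hs HV' HV) in H.
    destruct (H B HBV) as [[H1 H2]|[H1 H2]].
    + apply Hne. rewrite <- (Huniq x), <- (Huniq y); auto.
    + destruct Hz as [-> | ->]; [apply (H1 x)|apply (H2 y)]; auto.
Qed.

Context (Q TQ : N) (HQ : forall p, p ∈ Q <-> is_ultrafilter (j D) (j R) p)
  (HTQ : forall O, O ∈ TQ <-> ultra_open (j D) Q O).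

(** The interpretation in the larger space of the open set [B]. *)
Definition is_lift (O B : N) : Prop := forall p, p ∈ O <-> p ∈ Q /\ inside p B.

Lemma exists_lift B : exists O, is_lift O B.
Proof.
  destruct (separation (fun p => inside p B) Q) as [O HO]; [definability|].
  exists O. exact HO.
Qed.

Lemma lift_unique O O' B : is_lift O B -> is_lift O' B -> O = O'.
Proof. intros H H'. apply set_ext. intros p. rewrite (H p), (H' p). tauto. Qed.

Lemma lift_open O B : B ∈ T -> is_lift O (j B) -> O ∈ TQ.
Proof.
  intros HB HO. destruct (exists_diff P B) as [C HC].
  apply (minus_open (j D) Q TQ HTQ (j C)).
  - apply j_mem, HD. exact (compl_closed P T HPT B C HB HC).
  - intros p. rewrite (HO p). split; intros [Hp H]; (split; [exact Hp|]);
      apply HQ in Hp; apply (inside_compl p B C Hp HB HC), H.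
Qed.

Lemma lift_F_sigma O B : B ∈ U -> is_lift O (j B) -> is_F_sigma Q TQ O.
Proof.
  intros HBU HO. destruct (HU B HBU) as [HB HBF].
  destruct (F_sigma_exhaustion P T HPT w B Hw HB HBF) as (t & Ht & Htc & Htex).
  destruct (zfc_power N HN Q) as [PQ HPQ].
  destruct (exists_function (fun n C => exists K, rel (j t) n K /\
    forall p, p ∈ C <-> p ∈ Q /\ K ∈ p) (j w) PQ) as (f & Hf & Hfr); [definability|..].
  { intros n Hn.
    destruct (function_on_total (j t) (j w) n (j_function_on j Hj t w Ht) Hn) as [K HK].
    destruct (separation (fun p => K ∈ p) Q) as [C HC]; [definability|].
    exists C. split; [apply HPQ; intros p Hp; apply HC in Hp; tauto|eauto]. }
  { intros n C C' _ (K & HK & HC) (K' & HK' & HC').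
    rewrite (function_on_unique (j t) (j w) n K' K (j_function_on j Hj t w Ht) HK' HK) in HC'.
    apply set_ext. intros p. rewrite HC, HC'. tauto. }
  exists (j w), f. split; [exact (j_omega j Hj w Hw)|]. split; [exact Hf|]. split.
  - intros n C HC. apply Hfr in HC. destruct HC as (_ & _ & K & HK & HC).
    apply (j_rel_elim j Hj) in HK. destruct HK as (n0 & K0 & -> & -> & HK).
    apply (star_closed (j D) Q TQ HTQ (j K0)); [|exact HC].
    apply j_mem, HD. apply (Htc n0 K0 HK).
  - intros p. rewrite (HO p). split.
    + intros [Hp (C & HC & HCB)]. pose proof (proj1 (HQ p) Hp) as Hpu.
      destruct (ultra_closed p C Hpu HC) as (C' & -> & HC').
      apply (j_subset j Hj) in HCB.
      destruct (Htex C' HC' HCB) as (n & K & HK & HCK).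
      destruct (separation (fun p => j K ∈ p) Q) as [E HE]; [definability|].
      exists (j n), E. split.
      * apply Hfr. split; [apply j_mem, (function_on_dom t w n K Ht HK)|].
        split; [apply HPQ; intros q Hq; apply HE in Hq; tauto|].
        exists (j K). split; [apply (j_rel j Hj), HK|exact HE].
      * apply HE. split; [exact Hp|].
        apply (ultra_up _ _ _ HL p Hpu (j C') (j K) HC).
        -- apply j_mem, HD. apply (Htc n K HK).
        -- apply (j_subset j Hj), HCK.
    + intros (n & C & HC & HpC). apply Hfr in HC. destruct HC as (_ & _ & K & HK & HC).
      apply HC in HpC. split; [tauto|]. exists K. split; [tauto|].
      apply (j_rel_elim j Hj) in HK. destruct HK as (n0 & K0 & -> & -> & HK).
      apply (j_subset j Hj). apply (Htc n0 K0 HK).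
Qed.

Lemma ultra_gulko : is_gulko_compact (opair Q TQ).
Proof.
  exists Q, TQ. split; [apply opair_spec|].
  split; [exact (ultra_compact_top _ _ _ HL Q TQ HQ HTQ)|].
  assert (HliftD : definable (fun e => is_lift (e 0) (e 1))) by (unfold is_lift; definability).
  destruct (separation (fun O => exists B, B ∈ j U /\ is_lift O B) TQ) as [W HW];
    [definability|].
  assert (HW' : forall O, O ∈ W <-> exists B, B ∈ U /\ is_lift O (j B)).
  { intros O. rewrite HW. split.
    - intros [_ (B & HB & HO)]. apply (j_elim j Hj) in HB.
      destruct HB as (B' & HB & ->). eauto.
    - intros (B & HB & HO). split; [exact (lift_open O B (proj1 (HU B HB)) HO)|].
      exists (j B). rewrite j_mem. auto. }
  exists W. split; [|split].
  - intros O HO. apply HW' in HO. destruct HO as (B & HB & HO).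
    split; [exact (lift_open O B (proj1 (HU B HB)) HO)|exact (lift_F_sigma O B HB HO)].
  - intros p q Hp Hq Hne.
    destruct (ultra_separate _ _ _ HL Q HQ p q Hp Hq Hne) as (C & E & HC & HE & Hd).
    pose proof (proj1 (HQ p) Hp) as Hpu. pose proof (proj1 (HQ q) Hq) as Hqu.
    assert (HB : exists B, B ∈ U /\ ~ (inside p (j B) <-> inside q (j B))).
    { apply NNPP. intros Hno. apply (inside_T0 p q Hpu Hqu) with C E; auto.
      intros B HB. apply NNPP. intros H. apply Hno. eauto. }
    destruct HB as (B & HB & Hsep). destruct (exists_lift (j B)) as [O HO].
    exists O. split; [apply HW'; eauto|].
    destruct (classic (inside p (j B))) as [HpB|HpB].
    + exists p. split; [split; [auto|apply HO; auto]|].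
      intros z [[-> | ->] Hz]; [reflexivity|]. apply HO in Hz. tauto.
    + exists q. split; [split; [auto|apply HO; split; [exact Hq|tauto]]|].
      intros z [[-> | ->] Hz]; [|reflexivity]. apply HO in Hz. tauto.
  - destruct (zfc_power N HN TQ) as [PT HPTQ].
    destruct (exists_function (fun n Wn => exists V, rel (j s) n V /\
      forall O, O ∈ Wn <-> exists B, B ∈ V /\ is_lift O B) (j w) PT)
      as (f & Hf & Hfr); [definability|..].
    { intros n Hn. apply (j_elim j Hj) in Hn. destruct Hn as (n0 & Hn & ->).
      destruct (function_on_total s w n0 Hs Hn) as [V HV].
      destruct (separation (fun O => exists B, B ∈ j V /\ is_lift O B) TQ) as [Wn HWn];
        [definability|].
      exists Wn. split; [apply HPTQ; intros O HO; apply HWn in HO; tauto|].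
      exists (j V). split; [apply (j_rel j Hj), HV|]. intros O. rewrite HWn.
      split; [tauto|]. intros (B & HB & HO). split; [|eauto].
      apply (j_elim j Hj) in HB. destruct HB as (B' & HB & ->).
      exact (lift_open O B' (family_open n0 V HV B' HB) HO). }
    { intros n X Y _ (V & HV & HX) (V' & HV' & HY).
      rewrite (function_on_unique (j s) (j w) n V' V (j_function_on j Hj s w Hs) HV' HV) in HY.
      apply set_ext. intros O. rewrite HX, HY. tauto. }
    assert (Hfr' : forall n Wn, rel f n Wn -> exists n0 V, n = j n0 /\ rel s n0 V /\
      forall O, O ∈ Wn <-> exists B, B ∈ V /\ is_lift O (j B)).
    { intros n Wn H. apply Hfr in H. destruct H as (_ & _ & V & HV & HWn).
      apply (j_rel_elim j Hj) in HV. destruct HV as (n0 & V0 & -> & -> & HV).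
      exists n0, V0. split; [reflexivity|]. split; [exact HV|]. intros O. rewrite HWn.
      split.
      - intros (B & HB & HO). apply (j_elim j Hj) in HB.
        destruct HB as (B' & HB & ->). eauto.
      - intros (B & HB & HO). exists (j B). rewrite j_mem. auto. }
    assert (Hfex : forall n V, rel s n V -> exists Wn, rel f (j n) Wn /\
      forall O, O ∈ Wn <-> exists B, B ∈ V /\ is_lift O (j B)).
    { intros n V HV.
      destruct (function_on_total f (j w) (j n) Hf) as [Wn HWn].
      { apply j_mem, (function_on_dom s w n V Hs HV). }
      exists Wn. split; [exact HWn|]. destruct (Hfr' _ _ HWn) as (n0 & V0 & En & HV0 & H).
      apply (j_inj j Hj) in En. subst n0.
      rewrite (function_on_unique s w n V V0 Hs HV HV0). exact H. }
    assert (Hback : forall n Wn O, rel f n Wn -> O ∈ Wn -> O ∈ W).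
    { intros n Wn O H HO. destruct (Hfr' n Wn H) as (n0 & V & _ & HV & HWn).
      apply HWn in HO. destruct HO as (B & HB & HO). apply HW'. exists B.
      split; [apply HUs; eauto|exact HO]. }
    exists (j w), f. split; [exact (j_omega j Hj w Hw)|]. split; [exact Hf|]. split.
    + intros O. split; [|intros (n & Wn & H & HO); eauto].
      intros HO. apply HW' in HO. destruct HO as (B & HB & HO).
      apply HUs in HB. destruct HB as (n & V & HV & HB).
      destruct (Hfex n V HV) as (Wn & H & HWn). exists (j n), Wn.
      split; [exact H|]. apply HWn. eauto.
    + intros p Hp O. split; [|intros (n & Wn & H & _ & HO); eauto].
      intros HO. apply HW' in HO. destruct HO as (B & HB & HO).
      destruct (inside_sigma_point_finite p B) as (n & V & HV & (t & Ht & Hfin) & HBV);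
        [apply HQ, Hp|exact HB|].
      destruct (Hfex n V HV) as (Wn & H & HWn). exists (j n), Wn.
      split; [exact H|]. split; [|apply HWn; eauto].
      destruct (separation (fun O => p ∈ O) Wn) as [r Hr]; [definability|].
      exists r. split; [exact Hr|].
      (* The members of the new family through [p] are the images of the finitely
         many ground sets in the trace of [p]. *)
      apply (finite_image (fun B O => is_lift O B) t r); [definability|..].
      * intros x y z Hy Hz. exact (lift_unique y z x Hy Hz).
      * exact Hfin.
      * intros O' HO'. apply Hr in HO'. destruct HO' as [HO' HpO'].
        apply HWn in HO'. destruct HO' as (B' & HB' & HO'). exists (j B').
        split; [|exact HO']. apply Ht. split; [apply j_mem, HB'|].
        apply HO' in HpO'. tauto.
Qed.

End Gulko.

Theorem gulko_absolute {M N : set_structure} {HM : ZFC M} {HN : ZFC N} (j : M -> N)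
  (Hj : transitive_embedding j) (X : M) :
  is_gulko_compact X ->
  exists Y, (exists L, is_closed_lattice X L /\ is_Ult (j L) Y) /\ is_gulko_compact Y.
Proof.
  intros (P & T & HX & HPT & U & HU & HT0 & w & s & Hw & Hs & HUs & Hwspf).
  destruct (exists_closed_lattice P T X HX) as (L & D & R & HLDR & HXL & HD & HR).
  pose proof (closed_normal_lattice j Hj P T D R HPT HD HR) as HL.
  destruct (exists_Ult (j D) (j R) (j L)) as (Q & TQ & HUlt & HQ & HTQ).
  { apply is_opair_iff. apply is_opair_iff in HLDR. subst L.
    symmetry. apply (j_opair j Hj). }
  exists (opair Q TQ). split; [eauto|].
  apply (ultra_gulko j Hj P T D R HPT HD HR U w s); assumption.
Qed.

Theorem theorem4p6 (V : set_structure) (HV : ZFC V)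
  (M N : V -> Prop)
  (M_trans : transitive_class M) (N_trans : transitive_class N)
  (MN : forall x, M x -> N x)
  (M_zfc : ZFC (model M)) (N_zfc : ZFC (model N))
  (X : model M) (HX : is_gulko_compact X) :
  exists Y : model N, is_interpretation MN X Y /\ is_gulko_compact Y.
Proof.
  apply (gulko_absolute (incl MN)); [|exact HX].
  split.
  - intros x y. reflexivity.
  (* An element in [N] of a member of [M] is in [M] by transitivity. *)
  - intros x z Hz. exists (exist M (proj1_sig z) (M_trans _ _ (proj2_sig x) Hz)).
    apply set_ext. intros y. reflexivity.
Qed.
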